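(* Let $P$ be the $n\times n$ random stochastic matrix $P(i,j)=p_{i,\sigma_i^{-1}(j)}$ described in the context, and assume that the parameters $(p_{i,j})$ satisfy the sparsity and non-degeneracy assumptions stated there. Then, with high probability, the Markov chain with transition matrix $P$ has a unique stationary distribution $\pi$. Moreover, for any fixed $\varepsilon\in(0,1)$, $$\max_{i\in[n]}\left|\frac{t^{(i)}_{\mathrm{mix}}(\varepsilon)}{t_{\mathrm{ent}}}-1\right|\longrightarrow 0\quad\text{in probability as } n\to\infty .$$ In other words, for any fixed $\lambda\ge 0$ and any sequence of nonnegative integers $t=t_n$ with $t=\lambda t_{\mathrm{ent}}+o(t_{\mathrm{ent}})$ as $n\to\infty$: $$\lambda<1\ \Longrightarrow\ \min_{i\in[n]}\|P^t(i,\cdot)-\pi\|_{\mathrm{TV}}\longrightarrow 1\ \text{ in probability},$$ $$\lambda>1\ \Longrightarrow\ \max_{i\in[n]}\|P^t(i,\cdot)-\pi\|_{\mathrm{TV}}\longrightarrow 0\ \text{ in probability}.$$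
   Context: For each $n$, write $[n]=\{1,\dots,n\}$ and let $p_{i,1}\ge\dots\ge p_{i,n}\ge 0$, $i\in[n]$, be given deterministic numbers with $\sum_{j=1}^n p_{i,j}=1$ (their dependence on $n$ is implicit). Let $\sigma=(\sigma_i)_{1\le i\le n}$ be independent, uniformly random permutations of $[n]$ (the environment), and set $P(i,j):=p_{i,\sigma_i^{-1}(j)}$ for $1\le i,j\le n$. With the convention $0\log 0=0$, define the average row entropy and the entropic time $$\mathrm H:=-\frac1n\sum_{i,j=1}^n p_{i,j}\log p_{i,j},\qquad t_{\mathrm{ent}}:=\frac{\log n}{\mathrm H}.$$ Assumptions (as $n\to\infty$). Sparsity: $\mathrm H=O(1)$ and $\max_{i\in[n]}\sum_{j=1}^n p_{i,j}(\log p_{i,j})^2=o(\log n)$ (terms with $p_{i,j}=0$ are $0$). Non-degeneracy: $\limsup_{n\to\infty}\big\{\frac1n\sum_{i,j=1}^n\mathbf 1_{\{p_{i,j}>1-\varepsilon\}}\big\}\to 0$ as $\varepsilon\to0^+$. When $P$ has a unique invariant law $\pi$, the mixing time from state $i\in[n]$ with precision $\varepsilon\in(0,1)$ is $t^{(i)}_{\mathrm{mix}}(\varepsilon):=\inf\{t\in\mathbb N:\|P^t(i,\cdot)-\pi\|_{\mathrm{TV}}\le\varepsilon\}$, where $\|\cdot\|_{\mathrm{TV}}$ is the total variation distance. An event depending on $n$ holds with high probability if its probability tends to $1$ as $n\to\infty$. Probability refers to the randomness of $\sigma$; quantities involving $\pi$ are considered on the high-probability event that $\pi$ is unique. *)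

(* Defs.v *)
From mathcomp Require Import all_boot all_order all_algebra all_fingroup.
From mathcomp Require Import all_classical all_reals all_analysis.

Set Implicit Arguments.
Unset Strict Implicit.
Unset Printing Implicit Defensive.

Import Order.TTheory GRing.Theory Num.Theory.
Import numFieldNormedType.Exports.

Local Open Scope classical_set_scope.
Local Open Scope ring_scope.

Definition env (n : nat) := {ffun 'I_n -> 'S_n}.

(* Product over i of the uniform laws on 'S_n: under Pr the coordinates
   s i are independent, uniformly random permutations. *)
Definition Pr (R : realType) (n : nat) (A : set (env n)) : R :=
  \sum_(s : env n | `[< A s >]) \prod_(i < n) (#|{: 'S_n}|%:R)^-1.

Definition whp (R : realType) (A : forall n, set (env n)) : Prop :=
  (fun n => Pr R (A n)) @ \oo --> (1 : R).

(* Extended-real-valued, because a mixing time is infinite when the chain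
   does not converge to its invariant law. *)
Definition cvg_in_prob (R : realType) (X : forall n, env n -> \bar R) (l : R) :
    Prop :=
  forall delta : R, 0 < delta ->
    (fun n => Pr R [set s : env n | (delta%:E < `|X n s - l%:E|)%E])
      @ \oo --> (0 : R).

Section Model.
Variable R : realType.

(* p i lists the entries of row i in nonincreasing order. The library has
   ln 0 = 0, hence 0 * ln 0 = 0 and 0 * (ln 0) ^+ 2 = 0. *)
Definition trans_mx (n : nat) (p : 'M[R]_n) (s : env n) : 'M[R]_n :=
  \matrix_(i, j) p i (((s i)^-1)%g j).

Definition avg_entropy (n : nat) (p : 'M[R]_n) : R :=
  - (n%:R^-1 * \sum_(i < n) \sum_(j < n) p i j * ln (p i j)).

Definition t_ent (n : nat) (p : 'M[R]_n) : R := ln n%:R / avg_entropy p.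

Definition invariant_law (n : nat) (P : 'M[R]_n) : set 'rV[R]_n :=
  [set pi : 'rV[R]_n | [/\ forall j, 0 <= pi 0 j, \sum_j pi 0 j = 1 & pi *m P = pi]].

Definition unique_invariant (n : nat) (P : 'M[R]_n) : Prop :=
  exists! pi, invariant_law P pi.

(* The invariant law when it is unique; otherwise an arbitrary choice. *)
Definition inv_law (n : nat) (P : 'M[R]_n) : 'rV[R]_n :=
  xget 0 (invariant_law P).

Definition tv_dist (n : nat) (mu nu : 'rV[R]_n) : R :=
  \big[Num.max/0]_(A : {set 'I_n})
    `|\sum_(j in A) mu 0 j - \sum_(j in A) nu 0 j|.

(* || P^t(i, .) - pi ||_TV *)
Definition dist_to_inv (n : nat) (P : 'M[R]_n) (t : nat) (i : 'I_n) : R :=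
  tv_dist (row i (P ^+ t)) (inv_law P).

(* The infimum of the empty set is +oo. *)
Definition t_mix (n : nat) (P : 'M[R]_n) (i : 'I_n) (eps : R) : \bar R :=
  ereal_inf [set (t%:R)%:E | t in [set t : nat | dist_to_inv P t i <= eps]].

Definition max_mix_dev (n : nat) (p : 'M[R]_n) (eps : R) (s : env n) : \bar R :=
  \big[maxe/0%E]_(i < n)
    `|t_mix (trans_mx p s) i eps / (t_ent p)%:E - 1|%E.

Definition max_dist (n : nat) (p : 'M[R]_n) (t : nat) (s : env n) : \bar R :=
  (\big[Num.max/0]_(i < n) dist_to_inv (trans_mx p s) t i)%:E.

(* The neutral value 1 is harmless: total variation distances between
   probability vectors are at most 1. *)
Definition min_dist (n : nat) (p : 'M[R]_n) (t : nat) (s : env n) : \bar R :=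
  (\big[Num.min/1]_(i < n) dist_to_inv (trans_mx p s) t i)%:E.

Definition sparse (p : forall n, 'M[R]_n) : Prop :=
  ((fun n => avg_entropy (p n) : R^o) =O_\oo (fun _ => 1 : R^o)) /\
  ((fun n => \big[Num.max/0]_(i < n)
       \sum_(j < n) p n i j * ln (p n i j) ^+ 2 : R^o)
     =o_\oo (fun n => ln n%:R : R^o)).

(* Average number of entries exceeding 1 - eps per row. *)
Definition near_one_frac (n : nat) (p : 'M[R]_n) (eps : R) : R :=
  n%:R^-1 * \sum_(i < n) \sum_(j < n) (1 - eps < p i j)%R%:R.

Definition non_degenerate (p : forall n, 'M[R]_n) : Prop :=
  limn_esup (fun n => (near_one_frac (p n) eps)%:E) @[eps --> (0:R)^'+]
    --> (0 : \bar R).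

End Model.

(* Main.v *)
(** Let target(j) be the average over y of P^l(y,j), with l slightly larger
    than t_ent. From a vertex i, reveal the environment best first, following
    only edges whose path weight is at least a small power of 1/n. With high
    probability, for all i at once, the tree obtained meets at most one
    collision, and by non-degeneracy (no cycle of labels close to 1) the
    collision carries mass at most 1 - eta. The exits of the tree are fresh and
    light, so their targets behave like independent uniform vertices: a moment
    bound over small batches of exits shows that the mass leaving the tree is
    spread as the environment average, which is close to target. Hence the
    worst-case defect F(T) = max_i sum_j (target(j) - P^T(i,j))^+ satisfies
    F(T) <= o(1) + (1 - eta) F(T - s0) with s0 a small multiple of log n, and
    a bounded number of iterations makes it small at a time close to t_ent. The
    concentration step needs kernels with l2 norm O(1/sqrt n); these are
    obtained by keeping only the paths whose last l labels have product at most
    1/n, which by a law of large numbers loses little mass.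

    The same recursion, for the probability that the product of the labels read
    before time (1 - delta) t_ent is below theta (with 1/n << theta), shows that
    this probability is small; then P^t(i,.) is carried by at most
    1/theta = o(n) states, which have small mass under the invariant law since
    the sum of the squares of target is nearly 1/n. *)

Require Import Defs.
From mathcomp Require Import all_boot all_order all_algebra all_fingroup.
From mathcomp Require Import all_classical all_reals all_analysis.
From mathcomp Require Import zify ring lra.
Import Order.TTheory GRing.Theory Num.Theory.
Import numFieldNormedType.Exports.

Set Implicit Arguments.
Unset Strict Implicit.
Unset Printing Implicit Defensive.

Local Open Scope ring_scope.

(** The recursion needs only lower bounds on $P^T(i,\cdot)$: both laws have mass one, so a one-sided
    defect controls total variation, and paths may be discarded freely. This freedom buys
    independence: kernels that avoid the explored vertices do not depend on the rows just exposed.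
    Exact conditional laws never appear; a fresh edge is only compared with a uniform one, at the
    price of a factor $n/(n-L)$. A vertex may have up to $n$ exits, too many to expose together at
    that price; hence the batches, sampled from the exit law, whose mean fluctuation bounds that of
    the whole sum by convexity. A fixed low moment would not survive the union bound over $n$
    starting vertices: with $a\approx n^{1/r}$ each batch gains a factor of order $1/a$, and the
    moment of order $r+1$ gains $a^{-(r+1)}$ against $n<(a+1)^r$. The best-first order is what makes
    a heavy collision close a cycle of heavy labels. Only a fraction $\eta$ of the mass is sure to
    leave a tree through its exits, hence several rounds of exploration instead of one. *)

Lemma eqle (R : numDomainType) (x y : R) : x = y -> x <= y.
Proof. by move=> ->. Qed.

(** * Uniform environments: independence of rows and domination of revealed edges *)

Section Expectation.
Variables (R : realType) (n : nat).
Implicit Types (S : seq 'I_n) (s t : env n).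

Definition EE (f : env n -> R) : R :=
  (\sum_(s : env n) f s) * \prod_(i < n) (#|{: 'S_n}|%:R)^-1.

Lemma EE_cst_ge0 : 0 <= \prod_(i < n) (#|{: 'S_n}|%:R : R)^-1.
Proof. by apply: prodr_ge0 => i _; rewrite invr_ge0 ler0n. Qed.

Lemma EE1 : EE (fun=> 1) = 1.
Proof.
rewrite /EE sumr_const card_ffun -mulr_natl mulr1 natrX prodr_const.
by rewrite -exprMn divff ?expr1n// pnatr_eq0 -lt0n; apply/card_gt0P; exists 1%g.
Qed.

Lemma EEZ c f : EE (fun s => c * f s) = c * EE f.
Proof. by rewrite /EE -mulr_sumr mulrA. Qed.

Lemma EED f g : EE (fun s => f s + g s) = EE f + EE g.
Proof. by rewrite /EE big_split mulrDl. Qed.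

Lemma EE_sum I (r : seq I) (P : pred I) (f : I -> env n -> R) :
  EE (fun s => \sum_(i <- r | P i) f i s) = \sum_(i <- r | P i) EE (f i).
Proof. by rewrite /EE exchange_big/= big_distrl. Qed.

Lemma EE_le f g : (forall s, f s <= g s) -> EE f <= EE g.
Proof. by move=> fg; rewrite /EE ler_wpM2r ?EE_cst_ge0 ?ler_sum. Qed.

Lemma EE_ext f g : f =1 g -> EE f = EE g.
Proof. by move=> fg; rewrite /EE (eq_bigr g). Qed.

Lemma EE_cst c : EE (fun=> c) = c.
Proof. by rewrite (@EE_ext _ (fun=> c * 1)) ?EEZ ?EE1 ?mulr1// => s; rewrite mulr1. Qed.

Lemma EE_ge0 f : (forall s, 0 <= f s) -> 0 <= EE f.
Proof. by move=> f0; rewrite -(EE_cst 0) EE_le. Qed.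

Lemma EE_le_cst f c : (forall s, f s <= c) -> EE f <= c.
Proof. by move=> fc; rewrite -[leRHS]EE_cst EE_le. Qed.

Lemma PrE (A : set (env n)) : Pr R A = EE (fun s => `[< A s >]%:R).
Proof.
rewrite /Pr /EE big_distrl/= big_mkcond/=.
by apply: eq_bigr => s _; case: ifP; rewrite ?mul1r ?mul0r.
Qed.

Definition indep_of S (f : env n -> R) : Prop :=
  forall s t, (forall x, x \notin S -> s x = t x) -> f s = f t.

Definition splice S s t : env n := [ffun x => if x \in S then s x else t x].

Lemma spliceK S : involutive (fun st : env n * env n =>
  (splice S st.1 st.2, splice S st.2 st.1)).
Proof.
by move=> [s t]; congr pair; apply/ffunP => x; rewrite !ffunE/=; case: ifP => // h;
  rewrite h.
Qed.

(** The product is averaged over two independent environments [s] and [t]; the involution [spliceK],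
    which exchanges their rows outside [S], turns [g s * f s] into [g s * f t]. *)
Lemma EE_indep S f g : indep_of S f ->
  (forall s t, (forall x, x \in S -> s x = t x) -> g s = g t) ->
  EE (fun s => g s * f s) = EE g * EE f.
Proof.
move=> fS gS.
transitivity (EE (fun s => EE (fun t => g s * f s))).
  by apply: EE_ext => s; rewrite EE_cst.
transitivity (EE (fun s => EE (fun t => g s * f t))); last first.
  by rewrite mulrC -EEZ; apply: EE_ext => s; rewrite EEZ mulrC.
rewrite /EE -!big_distrl/= !pair_bigA/=; congr (_ * _ * _).
rewrite (reindex_inj (inv_inj (spliceK S)))/=; apply: eq_bigr => -[s t] _ /=.
by congr (_ * _); [apply: gS | apply: fS] => x xS; rewrite ffunE ?xS// (negbTE xS).
Qed.

(** [G] lists revealed edges as ((vertex, label), target). Conditioning on an exploration is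
    expressed by multiplying with this indicator, so that no conditional expectation is formed. *)
Definition comp (G : seq ('I_n * 'I_n * 'I_n)) s : bool :=
  all (fun e => s e.1.1 e.1.2 == e.2) G.

Definition PG G : R := EE (fun s => (comp G s)%:R).

Lemma PG_ge0 G : 0 <= PG G.
Proof. by apply: EE_ge0 => s; rewrite ler0n. Qed.

Lemma PG_nil : PG [::] = 1.
Proof. by rewrite /PG -[RHS]EE1; apply: EE_ext. Qed.

Lemma EE_split_target G e (f : 'I_n -> env n -> R) :
  EE (fun s => (comp G s)%:R * f (s e.1 e.2) s) =
  \sum_a EE (fun s => (comp ((e, a) :: G) s)%:R * f a s).
Proof.
rewrite -EE_sum; apply: EE_ext => s.
rewrite (bigD1 (s e.1 e.2))//= eqxx/= [X in _ + X]big1 ?addr0// => a /negbTE.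
by rewrite eq_sym => ->; rewrite mul0r.
Qed.

Definition retarget (x y y' : 'I_n) s : env n :=
  [ffun z => if z == x then (s z * tperm y y')%g else s z].

Lemma retargetK x y y' : involutive (retarget x y y').
Proof.
move=> s; apply/ffunP => z; rewrite !ffunE; case: eqP => // _.
by rewrite -mulgA tperm2 mulg1.
Qed.

(** Composing row [x] with the transposition of [y] and [y'] preserves the uniform law. No other
    revealed edge is destroyed: at [x] none has target [y'] by hypothesis, and none has target [y]
    because the row is injective and label [k] already takes that value. *)
Lemma PG_retarget G x k y y' : (x, k) \notin map fst G ->
  (forall k', (x, k', y') \notin G) ->
  PG ((x, k, y) :: G) <= PG ((x, k, y') :: G).
Proof.
move=> xkG y'G; rewrite /PG /EE ler_wpM2r ?EE_cst_ge0//.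
rewrite (reindex_inj (inv_inj (retargetK x y y')))/=.
apply: ler_sum => s _; rewrite ler_nat /=.
case: (boolP (_ && _)) => // /andP[/eqP sk /allP sG]; rewrite ffunE eqxx permM in sk.
have {}sk : s x k = y' by apply: (perm_inj (s := tperm y y')); rewrite sk tpermR.
rewrite sk eqxx/= lt0b; apply/allP => -[[x' k'] z] eG /=.
have /= := sG _ eG; rewrite ffunE; case: (eqVneq x' x) => // ?; subst x'.
rewrite permM => /eqP ez.
have k'k : k' != k.
  by apply: contraNneq xkG => <-; apply/mapP; exists (x, k', z).
have : s x k' != y'.
  by rewrite -sk; apply: contraNneq k'k => /perm_inj ->.
case: tpermP ez => [sy zy'|->/eqP//|_ _ ->//]; last by rewrite eqxx.
by have := y'G k'; rewrite zy' eG.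
Qed.

Lemma PG_cons G x k y : (x, k) \notin map fst G ->
  PG ((x, k, y) :: G) * (n - count (fun e => e.1.1 == x) G)%:R <= PG G.
Proof.
move=> xkG; set c := count _ _.
pose T := [seq e.2 | e <- G & e.1.1 == x].
have -> : PG G = \sum_a PG ((x, k, a) :: G).
  transitivity (EE (fun s => (comp G s)%:R * 1)).
    by apply: EE_ext => s; rewrite mulr1.
  rewrite (EE_split_target G (x, k) (fun _ _ => 1)); apply: eq_bigr => a _.
  by apply: EE_ext => s; rewrite mulr1.
apply: (@le_trans _ _ (\sum_(a | a \notin T) PG ((x, k, a) :: G))); last first.
  by rewrite [leRHS](bigID (fun a => a \notin T))/= lerDl sumr_ge0// => a _; exact: PG_ge0.
apply: (@le_trans _ _ (\sum_(a | a \notin T) PG ((x, k, y) :: G))); last first.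
  apply: ler_sum => a aT; apply: PG_retarget => // k'.
  by apply: contra aT => kG; apply/mapP; exists (x, k', a) => //; rewrite mem_filter eqxx.
rewrite sumr_const -[leRHS]mulr_natr ler_wpM2l ?PG_ge0// ler_nat.
have -> : c = size T by rewrite size_map size_filter.
rewrite leq_subLR -[X in (X <= _)%N](card_ord n) -(cardC (mem T)) leq_add2r.
exact: card_size.
Qed.

End Expectation.

(** * Exposing the environment; hitting and meeting of walks *)

Section Exposure.
Variables (R : realType) (n : nat).
Implicit Types (S : seq 'I_n) (s t : env n) (G : seq ('I_n * 'I_n * 'I_n)).
Local Notation EE := (@EE R n).
Local Notation PG := (@PG R n).

Definition avg (f : 'I_n -> R) : R := n%:R^-1 * \sum_a f a.

Lemma avg_le f g : (forall a, f a <= g a) -> avg f <= avg g.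
Proof. by move=> fg; rewrite ler_wpM2l ?invr_ge0 ?ler0n ?ler_sum. Qed.

Lemma avg_ge0 f : (forall a, 0 <= f a) -> 0 <= avg f.
Proof. by move=> f0; rewrite mulr_ge0 ?invr_ge0 ?ler0n ?sumr_ge0. Qed.

Lemma avgD f g : avg (fun a => f a + g a) = avg f + avg g.
Proof. by rewrite /avg big_split mulrDr. Qed.

Lemma avgB f g : avg (fun a => f a - g a) = avg f - avg g.
Proof. by rewrite /avg sumrB mulrBr. Qed.

Lemma avgZ c f : avg (fun a => c * f a) = c * avg f.
Proof. by rewrite /avg -mulr_sumr mulrCA. Qed.

Lemma avg_cst c : (0 < n)%N -> avg (fun=> c) = c.
Proof.
move=> n0; rewrite /avg sumr_const card_ord -[c *+ n]mulr_natl mulrA mulVf ?mul1r//.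
by rewrite pnatr_eq0 -lt0n.
Qed.

Lemma avg_ext f g : f =1 g -> avg f = avg g.
Proof. by move=> fg; rewrite /avg (eq_bigr g). Qed.

Lemma EE_avg (f : 'I_n -> env n -> R) : EE (fun s => avg (f^~ s)) = avg (fun a => EE (f a)).
Proof. by rewrite EEZ EE_sum. Qed.

Lemma avg_sum I (r : seq I) (P : pred I) (f : I -> 'I_n -> R) :
  avg (fun a => \sum_(i <- r | P i) f i a) = \sum_(i <- r | P i) avg (f i).
Proof. by rewrite /avg exchange_big/= mulr_sumr. Qed.

Lemma indep_comp S G s t : {subset [seq e.1.1 | e <- G] <= S} ->
  (forall x, x \in S -> s x = t x) -> comp G s = comp G t.
Proof.
by move=> GS st; apply: eq_in_all => e eG; rewrite st//; apply/GS/map_f.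
Qed.

Lemma EE_comp_indep S G f : {subset [seq e.1.1 | e <- G] <= S} ->
  indep_of S f -> EE (fun s => (comp G s)%:R * f s) = PG G * EE f.
Proof. by move=> GS fS; apply: EE_indep fS _ => s t st; rewrite (indep_comp GS st). Qed.

(** Since [f] does not read the rows of [S], it factors out of the event once the target is fixed;
    [PG_cons] bounds the remaining probability. *)
Lemma expose S G e (f : 'I_n -> env n -> R) :
  {subset [seq e.1.1 | e <- G] <= S} -> e.1 \in S -> e \notin map fst G ->
  (forall a, indep_of S (f a)) -> (forall a s, 0 <= f a s) ->
  (count (fun e' => e'.1.1 == e.1) G < n)%N ->
  EE (fun s => (comp G s)%:R * f (s e.1 e.2) s) <=
  PG G * ((n - count (fun e' => e'.1.1 == e.1) G)%:R^-1 * \sum_a EE (f a)).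
Proof.
case: e => x k /= GS xS eG fS f0 cn; rewrite (EE_split_target G (x, k)) !mulr_sumr.
apply: ler_sum => a _; rewrite (@EE_comp_indep S)//; last first.
  by move=> z /=; rewrite inE => /predU1P[->//|]; apply: GS.
rewrite [leRHS]mulrA; apply: ler_wpM2r; first exact: EE_ge0.
by rewrite ler_pdivlMr ?ltr0n ?subn_gt0// PG_cons.
Qed.

Lemma expose1 x k (f : 'I_n -> env n -> R) :
  (forall a, indep_of [:: x] (f a)) -> (forall a s, 0 <= f a s) ->
  EE (fun s => f (s x k) s) <= avg (fun a => EE (f a)).
Proof.
move=> fS f0; have n0 : (0 < n)%N by apply: leq_trans (ltn_ord x).
apply: (@le_trans _ _ (EE (fun s => (comp [::] s)%:R * f (s x k) s))).
  by apply: EE_le => s /=; rewrite mul1r.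
have := @expose [:: x] [::] (x, k) f; rewrite PG_nil mul1r subn0; apply => //.
by rewrite inE.
Qed.

(** Two edges of one vertex have different targets, hence the denominator [n - 1] in that case; the
    boolean [e.1 == e'.1] serves as a number. *)
Lemma expose2 (e e' : 'I_n * 'I_n) (f : 'I_n -> 'I_n -> env n -> R) : e != e' ->
  (forall a b, indep_of [:: e.1; e'.1] (f a b)) -> (forall a b s, 0 <= f a b s) ->
  ((e.1 == e'.1) < n)%N ->
  EE (fun s => f (s e.1 e.2) (s e'.1 e'.2) s) <=
  n%:R^-1 * (n - (e.1 == e'.1))%:R^-1 * \sum_a \sum_b EE (f a b).
Proof.
case: e e' => [x k] [x' k'] /= ee fS f0 cn.
have n0 : (0 < n)%N by apply: leq_trans (ltn_ord x).
apply: (@le_trans _ _ (EE (fun s => (comp [::] s)%:R *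
    (fun a s => f a (s x' k') s) (s x k) s))).
  by apply: EE_le => s /=; rewrite mul1r.
have := EE_split_target [::] (x, k) (fun a s => f a (s x' k') s).
rewrite /= => ->; rewrite mulr_sumr; apply: ler_sum => a _.
apply: le_trans (@expose [:: x; x'] [:: (x, k, a)] (x', k') _ _ _ _ _ _ _) _ => //=.
- by move=> z; rewrite !inE => ->.
- by rewrite !inE eqxx orbT.
- by rewrite inE eq_sym.
- by rewrite addn0.
rewrite addn0 [leLHS]mulrA; apply: ler_wpM2r.
  by apply: sumr_ge0 => b _; apply: EE_ge0.
apply: ler_wpM2r; first by rewrite invr_ge0 ler0n.
have := @PG_cons R n [::] x k a; rewrite PG_nil subn0 => /(_ isT).
by rewrite -ler_pdivlMr ?ltr0n// div1r.
Qed.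

End Exposure.

Section Walks.
Variables (R : realType) (n : nat) (p : 'M[R]_n).
Hypotheses (p0 : forall i j, 0 <= p i j) (p1 : forall i, \sum_j p i j = 1).
Implicit Types (S : seq 'I_n) (s t : env n).
Local Notation EE := (@EE R n).

Fixpoint hit S T s x : R :=
  if x \in S then 1 else
  if T is T'.+1 then \sum_k p x k * hit S T' s (s x k) else 0.

Fixpoint dirty S T s x : R :=
  if x \in S then 1 else
  if T is T'.+1 then \sum_k p x k * dirty (x :: S) T' s (s x k) else 0.

Lemma row_le x (f : 'I_n -> R) c : (forall k, f k <= c) -> \sum_k p x k * f k <= c.
Proof.
move=> fc; rewrite -[leRHS]mul1r -(p1 x) mulr_suml; apply: ler_sum => k _.
exact: ler_wpM2l.
Qed.

Lemma row_ge0 x (f : 'I_n -> R) : (forall k, 0 <= f k) -> 0 <= \sum_k p x k * f k.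
Proof. by move=> f0; apply: sumr_ge0 => k _; apply: mulr_ge0. Qed.

Lemma row_mono x (f g : 'I_n -> R) : (forall k, f k <= g k) ->
  \sum_k p x k * f k <= \sum_k p x k * g k.
Proof. by move=> fg; apply: ler_sum => k _; apply: ler_wpM2l. Qed.

Lemma hit_ge0 S T s x : 0 <= hit S T s x.
Proof. by elim: T x => [|T IH] x /=; case: ifP => // _; apply: row_ge0. Qed.

Lemma hit_le1 S T s x : hit S T s x <= 1.
Proof. by elim: T x => [|T IH] x /=; case: ifP => // _; apply: row_le. Qed.

Lemma dirty_ge0 S T s x : 0 <= dirty S T s x.
Proof. by elim: T S x => [|T IH] S x /=; case: ifP => // _; apply: row_ge0. Qed.

Lemma dirty_le1 S T s x : dirty S T s x <= 1.
Proof. by elim: T S x => [|T IH] S x /=; case: ifP => // _; apply: row_le. Qed.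

Lemma hit_le_dirty S S' T s x : {subset S <= S'} -> hit S T s x <= dirty S' T s x.
Proof.
elim: T S' x => [|T IH] S' x SS /=.
  by case: (boolP (x \in S)) => [/SS ->|_] //; case: ifP.
case: (boolP (x \in S)) => [/SS ->//|_]; case: ifP => _.
  by apply: row_le => k; apply: hit_le1.
by apply: row_mono => k; apply: IH => z /SS; rewrite inE orbC => ->.
Qed.

Lemma indep_hit S T x : indep_of S (fun s => hit S T s x).
Proof.
move=> s t st; elim: T x => [|T IH] x //=; case: ifP => // /negbT xS.
by apply: eq_bigr => k _; rewrite IH st.
Qed.

Lemma indep_dirty S T x : indep_of S (fun s => dirty S T s x).
Proof.
move=> s t; elim: T S x => [|T IH] S x //= st; case: ifP => // /negbT xS.
apply: eq_bigr => k _; rewrite st// IH// => z; rewrite inE negb_or => /andP[_].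
exact: st.
Qed.

Lemma sub_indep S S' (f : env n -> R) : {subset S' <= S} -> indep_of S f -> indep_of S' f.
Proof. by move=> SS fS s t st; apply: fS => x xS; apply: st; apply: contra xS; apply: SS. Qed.

Lemma n_gt0 (x : 'I_n) : (0 < n)%N. Proof. exact: leq_trans (ltn_ord x). Qed.

Lemma sum_in_seq_le S : \sum_(a : 'I_n) (a \in S)%:R <= (size S)%:R :> R.
Proof.
rewrite -natr_sum ler_nat; have -> : (\sum_(a : 'I_n) (a \in S) = #|mem S|)%N.
  by rewrite -sum1_card [RHS]big_mkcond; apply: eq_bigr => a _; case: (a \in S).
exact: card_size.
Qed.

(** Each of the [T] targets is dominated by a uniform vertex, while at most [size S + T] vertices
    are forbidden. *)
Lemma EE_dirty S T x : x \notin S ->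
  EE (fun s => dirty S T s x) <= T%:R * (size S + T)%:R / n%:R.
Proof.
elim: T S x => [|T IH] S x xS; have n0 := n_gt0 x.
  by rewrite mul0r mul0r; apply: EE_le_cst => s /=; rewrite (negbTE xS).
rewrite (@EE_ext _ _ _ (fun s => \sum_k p x k * dirty (x :: S) T s (s x k))); last first.
  by move=> s /=; rewrite (negbTE xS).
rewrite EE_sum; under eq_bigr do rewrite EEZ.
apply: row_le => k; apply: le_trans.
  apply: (@expose1 R n x k (fun a s => dirty (x :: S) T s a)).
    by move=> a; apply: sub_indep (@indep_dirty _ _ _) => z; rewrite !inE => ->.
  by move=> a s; exact: dirty_ge0.
rewrite mulrC ler_wpM2l ?invr_ge0 ?ler0n//.
apply: (@le_trans _ _ (\sum_(a : 'I_n) ((a \in x :: S)%:R + T%:R * ((size S).+1 + T)%:R / n%:R))).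
  apply: ler_sum => a _; have [aS|aS] := boolP (a \in x :: S).
    rewrite (le_trans (y := 1))//; first by apply: EE_le_cst => s; exact: dirty_le1.
    by rewrite lerDl mulr_ge0 ?mulr_ge0 ?invr_ge0 ?ler0n.
  by rewrite add0r; apply: IH.
rewrite big_split/= sumr_const card_ord -[_ *+ n]mulr_natr divfK ?pnatr_eq0 -?lt0n//.
apply: le_trans (lerD (sum_in_seq_le _) (lexx _)) _ => /=.
by rewrite -!natrM -natrD ler_nat /= mulSn (addSnnS (size S) T) leq_add2r addnS ltnS leq_addr.
Qed.

Lemma EE_avg_dirty S T : (0 < n)%N ->
  avg (fun a => EE (fun s => dirty S T s a)) <= T.+1%:R * (size S + T)%:R / n%:R.
Proof.
move=> n0; rewrite mulrC ler_wpM2l ?invr_ge0 ?ler0n//.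
apply: (@le_trans _ _ (\sum_(a : 'I_n) ((a \in S)%:R + T%:R * (size S + T)%:R / n%:R))).
  apply: ler_sum => a _; have [aS|aS] := boolP (a \in S).
    rewrite (le_trans (y := 1))//; first by apply: EE_le_cst => s; exact: dirty_le1.
    by rewrite lerDl mulr_ge0 ?mulr_ge0 ?invr_ge0 ?ler0n.
  by rewrite add0r; apply: EE_dirty.
rewrite big_split/= sumr_const card_ord -[_ *+ n]mulr_natr divfK ?pnatr_eq0 -?lt0n//.
apply: le_trans (lerD (sum_in_seq_le _) (lexx _)) _ => /=.
by rewrite -!natrM -natrD ler_nat mulSn leq_add2r leq_addr.
Qed.

Lemma EE_avg_hit S T : (0 < n)%N ->
  avg (fun a => EE (fun s => hit S T s a)) <= T.+1%:R * (size S + T)%:R / n%:R.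
Proof.
move=> n0; apply: le_trans (EE_avg_dirty S T n0); apply: avg_le => a; apply: EE_le => s.
exact: hit_le_dirty.
Qed.

(** Two independent walks in the same environment; with empty [S] this is the inner product of their
    laws at time [T] ([law_meet]). *)
Fixpoint meet S T s a b : R :=
  if (a \in S) || (b \in S) then 0 else
  if T is T'.+1 then \sum_k p a k * \sum_l p b l * meet S T' s (s a k) (s b l)
  else (a == b)%:R.

(* Probability that two walks from [a] read the same labels for a while, then
   different ones, and are at the same vertex at time [T]. *)
Fixpoint remeet S T s a : R :=
  if a \in S then 0 else
  if T is T'.+1 then \sum_k p a k * (p a k * remeet S T' s (s a k) +
    \sum_(l | l != k) p a l * meet S T' s (s a k) (s a l))
  else 0.

Lemma meet_ge0 S T s a b : 0 <= meet S T s a b.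
Proof.
elim: T a b => [|T IH] a b /=; case: ifP => // _.
by apply: row_ge0 => k; apply: row_ge0.
Qed.

Lemma meet_le1 S T s a b : meet S T s a b <= 1.
Proof.
elim: T a b => [|T IH] a b /=; case: ifP => // _; first by case: (a == b).
by apply: row_le => k; apply: row_le.
Qed.

(** Once a walk enters [S] the left side is at most 1, which the hitting terms pay. What remains is
    independent of the rows of [S], which can then be exposed. *)
Lemma meet_hit S T s a b :
  meet [::] T s a b <= meet S T s a b + hit S T s a + hit S T s b.
Proof.
elim: T a b => [|T IH] a b /=.
  have : (a == b)%:R <= 1 :> R by case: (a == b).
  by case: (a \in S); case: (b \in S) => /=; lra.
case: (boolP (a \in S)) => [aS|aS] /=.
  rewrite add0r; apply: (@le_trans _ _ 1).
    by apply: row_le => k; apply: row_le => l; apply: meet_le1.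
  by rewrite lerDl; have := hit_ge0 S T.+1 s b => /=.
case: (boolP (b \in S)) => [bS|bS].
  rewrite add0r; apply: (@le_trans _ _ 1).
    by apply: row_le => k; apply: row_le => l; apply: meet_le1.
  by rewrite lerDr; have := hit_ge0 S T.+1 s a; rewrite /= (negbTE aS).
have -> : \sum_k p b k * hit S T s (s b k) =
    \sum_k p a k * \sum_l p b l * hit S T s (s b l).
  by rewrite -mulr_suml p1 mul1r.
rewrite -!big_split/=; apply: ler_sum => k _; rewrite -!mulrDr ler_wpM2l//.
have -> : hit S T s (s a k) = \sum_l p b l * hit S T s (s a k).
  by rewrite -mulr_suml p1 mul1r.
by rewrite -!big_split/=; apply: ler_sum => l _; rewrite -!mulrDr ler_wpM2l.
Qed.

Lemma meet_mono S T s a b : meet S T s a b <= meet [::] T s a b.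
Proof.
elim: T a b => [|T IH] a b /=; case: ifP => // _.
  by apply: row_ge0 => k; apply: row_ge0 => l; apply: meet_ge0.
by apply: row_mono => k; apply: row_mono.
Qed.

Lemma remeet_ge0 S T s a : 0 <= remeet S T s a.
Proof.
elim: T a => [|T IH] a /=; case: ifP => // _.
apply: row_ge0 => k; apply: addr_ge0; first exact: mulr_ge0.
by apply: sumr_ge0 => l _; rewrite mulr_ge0 ?meet_ge0.
Qed.

Lemma row_split a k : 1 = p a k + \sum_(l | l != k) p a l.
Proof. by rewrite -(p1 a) (bigD1 k). Qed.

Lemma remeet_le1 S T s a : remeet S T s a <= 1.
Proof.
elim: T a => [|T IH] a /=; case: ifP => // _.
apply: row_le => k; rewrite [leRHS](row_split a k); apply: lerD.
  by rewrite -[leRHS]mulr1 ler_wpM2l.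
by apply: ler_sum => l _; rewrite -[leRHS]mulr1 ler_wpM2l ?meet_le1.
Qed.

Lemma remeet_mono S T s a : remeet S T s a <= remeet [::] T s a.
Proof.
elim: T a => [|T IH] a /=; case: ifP => // _.
  by have := remeet_ge0 [::] T.+1 s a.
apply: row_mono => k; apply: lerD; first by rewrite ler_wpM2l.
by apply: ler_sum => l _; rewrite ler_wpM2l ?meet_mono.
Qed.

Lemma remeet_hit S T s a : remeet [::] T s a <= remeet S T s a + 2 * hit S T s a.
Proof.
elim: T a => [|T IH] a /=; first by case: ifP => _; lra.
case: ifP => aS.
  by have /= := remeet_le1 [::] T.+1 s a; lra.
have -> : 2 * (\sum_k p a k * hit S T s (s a k)) =
    \sum_k p a k * hit S T s (s a k) + \sum_l p a l * hit S T s (s a l) by lra.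
have h2 : \sum_l p a l * hit S T s (s a l) =
    \sum_k p a k * \sum_l p a l * hit S T s (s a l).
  by rewrite -[RHS]mulr_suml p1 mul1r.
rewrite [X in _ <= _ + (_ + X)]h2.
rewrite -!big_split/=; apply: ler_sum => k _; rewrite -!mulrDr ler_wpM2l//.
rewrite [X in _ <= _ + (_ + X)](bigD1 k)//=.
have hE : hit S T s (s a k) = p a k * hit S T s (s a k) +
    \sum_(l | l != k) p a l * hit S T s (s a k).
  by rewrite -mulr_suml -mulrDl -row_split mul1r.
rewrite [X in _ <= _ + (X + _)]hE.
rewrite [leRHS](_ : _ = p a k * (remeet S T s (s a k) + 2 * hit S T s (s a k)) +
  (\sum_(l | l != k) p a l * meet S T s (s a k) (s a l) +
   \sum_(l | l != k) p a l * hit S T s (s a k) +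
   \sum_(l | l != k) p a l * hit S T s (s a l))); last by ring.
apply: lerD; first by rewrite ler_wpM2l.
rewrite -!big_split/=; apply: ler_sum => l _; rewrite -!mulrDr ler_wpM2l//.
exact: meet_hit.
Qed.

Lemma indep_meet S T a b : indep_of S (fun s => meet S T s a b).
Proof.
move=> s t st; elim: T a b => [|T IH] a b //=; case: ifP => // /norP[aS bS].
by apply: eq_bigr => k _; congr (_ * _); apply: eq_bigr => l _; rewrite IH !st.
Qed.

Lemma indep_remeet S T a : indep_of S (fun s => remeet S T s a).
Proof.
move=> s t st; elim: T a => [|T IH] a //=; case: ifP => // /negbT aS.
apply: eq_bigr => k _; congr (_ * _); rewrite IH st//; congr (_ + _).
by apply: eq_bigr => l _; rewrite (indep_meet _ _ _ st).
Qed.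

End Walks.

(** * Expected meeting and remeeting probabilities *)

Section MeetingTimes.
Variables (R : realType) (n : nat) (p : 'M[R]_n).
Hypotheses (p0 : forall i j, 0 <= p i j) (p1 : forall i, \sum_j p i j = 1).
Implicit Types (S : seq 'I_n) (s t : env n).
Local Notation EE := (@EE R n).
Local Notation hit := (hit p).
Local Notation meet := (meet p).
Local Notation remeet := (remeet p).

Let hT T0 : R := T0.+1%:R * (2 + T0)%:R / n%:R.

Let hT_ge0 T0 : 0 <= hT T0.
Proof. by rewrite /hT mulr_ge0 ?invr_ge0 ?mulr_ge0 ?ler0n. Qed.

Let avg_hit_le S T T0 : (0 < n)%N -> (T <= T0)%N -> (size S <= 2)%N ->
  avg (fun a => EE (fun s => hit S T s a)) <= hT T0.
Proof.
move=> n0 TT S2; apply: le_trans (EE_avg_hit p0 p1 S T n0) _.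
rewrite ler_wpM2r ?invr_ge0 ?ler0n// -!natrM ler_nat.
by apply: leq_mul; [rewrite ltnS | apply: leq_add].
Qed.

Let F S T a b s := meet S T s a b + hit S T s a + hit S T s b.

Let avg_F S T T0 m : (0 < n)%N -> (T <= T0)%N -> (size S <= 2)%N ->
  (forall a b, a != b -> EE (fun s => meet [::] T s a b) <= m) -> 0 <= m ->
  avg (fun a => avg (fun b => EE (F S T a b))) <= n%:R^-1 + m + 2 * hT T0.
Proof.
move=> n0 TT S2 mm m0.
have n0' : n%:R != 0 :> R by rewrite pnatr_eq0 -lt0n.
apply: (@le_trans _ _ (avg (fun a => avg (fun b => (a == b)%:R + m +
   EE (fun s => hit S T s a) + EE (fun s => hit S T s b))))).
  apply: avg_le => a; apply: avg_le => b; rewrite /F !EED !lerD2r.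
  case: (eqVneq a b) => ab.
    rewrite (le_trans (y := 1))//; first by apply: EE_le_cst => s; apply: meet_le1.
    by rewrite lerDl.
  by rewrite add0r; apply: le_trans (mm _ _ ab); apply: EE_le => s; exact: meet_mono.
rewrite (_ : (fun a => _) = fun a => n%:R^-1 + m +
   (EE (fun s => hit S T s a) + avg (fun b => EE (fun s => hit S T s b)))); last first.
  apply/funext => a; rewrite !avgD !avg_cst// -!addrA; congr (_ + _).
  by rewrite /avg (bigD1 a)//= eqxx big1 ?addr0 ?mulr1// => b; rewrite eq_sym => /negbTE ->.
rewrite !avgD !avg_cst// lerD2l.
by have := @avg_hit_le S T T0 n0 TT S2; lra.
Qed.

Let F_ge0 S T a b s : 0 <= F S T a b s.
Proof. by rewrite !addr_ge0 ?meet_ge0 ?hit_ge0. Qed.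

Let indep_F S T a b : indep_of S (F S T a b).
Proof.
by move=> s t st; rewrite /F (indep_meet p T a b st) !(indep_hit p T _ st).
Qed.

(** The first step exposes edges in two different rows: their targets are dominated by independent
    uniform vertices, equal with probability [1/n], and later returns to [a] or [b] are paid by
    [hT]. *)
Lemma EE_meet T T0 a b : (T <= T0)%N -> a != b ->
  EE (fun s => meet [::] T s a b) <= T%:R * (n%:R^-1 + 2 * hT T0).
Proof.
elim: T a b => [|T IH] a b TT ab.
  by rewrite mul0r; apply: EE_le_cst => s /=; rewrite (negbTE ab).
have n0 := n_gt0 a.
apply: (@le_trans _ _ (EE (fun s => \sum_k p a k * \sum_l p b l *
    F [:: a; b] T (s a k) (s b l) s))).
  by apply: EE_le => s /=; apply: row_mono => // k; apply: row_mono => // l; apply: meet_hit.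
rewrite EE_sum; under eq_bigr do rewrite EEZ EE_sum.
apply: row_le => // k; under eq_bigr do rewrite EEZ.
apply: row_le => // l.
apply: (@le_trans _ _ (avg (fun u => avg (fun v => EE (F [:: a; b] T u v))))).
  have := @expose2 R n (a, k) (b, l) (F [:: a; b] T).
  rewrite /= (negbTE ab) subn0 => /(_ _ _ _ n0) le2.
  apply: le_trans (le2 _ _ _) _ => //.
    by rewrite xpair_eqE (negbTE ab).
  rewrite /avg -mulrA !ler_wpM2l ?invr_ge0 ?ler0n//.
  by rewrite mulr_sumr.
have m0 : 0 <= T%:R * (n%:R^-1 + 2 * hT T0).
  by rewrite mulr_ge0 ?addr_ge0 ?invr_ge0 ?ler0n// mulr_ge0.
apply: le_trans (@avg_F [:: a; b] T T0 _ n0 (ltnW TT) isT _ m0) _.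
  by move=> u v uv; apply: IH => //; exact: ltnW.
by rewrite -[in leRHS]natr1; lra.
Qed.

Let Q T0 := 2 * (n%:R^-1 + T0%:R * (n%:R^-1 + 2 * hT T0) + 2 * hT T0).

Let Q_ge0 T0 : 0 <= Q T0.
Proof.
rewrite /Q; have := hT_ge0 T0; have : 0 <= n%:R^-1 :> R by rewrite invr_ge0 ler0n.
have : 0 <= T0%:R :> R by rewrite ler0n.
move=> ht hn hh; have := mulr_ge0 ht hn; have := mulr_ge0 ht hh.
by move=> *; lra.
Qed.

(** While the labels agree the walks stay together and the induction continues; when they first
    differ, the two targets come from one row, and the factor 2 in [Q] bounds [n / (n - 1)]. The two
    cases have weights [p a k] and its complement, so [Q] is paid once and not at every step. *)
Lemma EE_remeet_aux T T0 a : (1 < n)%N -> (T <= T0)%N ->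
  EE (fun s => remeet [::] T s a) <= T%:R * (2 * hT T0) + Q T0.
Proof.
move=> n1; have n0 : (0 < n)%N by exact: ltnW.
elim: T a => [|T IH] a TT.
  by rewrite mul0r add0r; apply: EE_le_cst => s /=; exact: Q_ge0.
apply: (@le_trans _ _ (EE (fun s => \sum_k p a k *
   (p a k * (remeet [:: a] T s (s a k) + 2 * hit [:: a] T s (s a k)) +
    \sum_(l | l != k) p a l * F [:: a; a] T (s a k) (s a l) s)))).
  apply: EE_le => s /=; apply: row_mono => // k; apply: lerD.
    by rewrite ler_wpM2l ?remeet_hit.
  by apply: ler_sum => l _; rewrite ler_wpM2l// meet_hit.
rewrite EE_sum; under eq_bigr do rewrite EEZ EED EEZ EE_sum.
apply: row_le => // k; under [X in _ + X]eq_bigr do rewrite EEZ.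
rewrite [leRHS](_ : _ = p a k * (T.+1%:R * (2 * hT T0) + Q T0) +
   \sum_(l | l != k) p a l * (T.+1%:R * (2 * hT T0) + Q T0)); last first.
  by rewrite -mulr_suml -mulrDl -row_split// mul1r.
apply: lerD.
  rewrite ler_wpM2l//.
  apply: le_trans.
    apply: (@expose1 R n a k (fun u s => remeet [:: a] T s u + 2 * hit [:: a] T s u)).
      by move=> u s t st; rewrite (indep_remeet p T u st) (indep_hit p T u st).
    by move=> u s; rewrite addr_ge0 ?remeet_ge0 ?mulr_ge0 ?hit_ge0.
  rewrite (_ : (fun u => _) = fun u => EE (fun s => remeet [:: a] T s u) +
    2 * EE (fun s => hit [:: a] T s u)); last by apply/funext => u; rewrite EED EEZ.
  rewrite avgD avgZ [leRHS](_ : _ = T%:R * (2 * hT T0) + Q T0 + 2 * hT T0); last first.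
    by rewrite -[T.+1%:R]natr1; ring.
  apply: lerD; last by rewrite ler_wpM2l//; apply: avg_hit_le => //; exact: ltnW.
  apply: (@le_trans _ _ (avg (fun _ : 'I_n => T%:R * (2 * hT T0) + Q T0))); last first.
    by rewrite avg_cst.
  apply: avg_le => u; apply: le_trans (IH u (ltnW TT)); apply: EE_le => s; exact: remeet_mono.
apply: ler_sum => l lk; rewrite ler_wpM2l//.
apply: (@le_trans _ _ (2 * avg (fun u => avg (fun v => EE (F [:: a; a] T u v))))).
  have := @expose2 R n (a, k) (a, l) (F [:: a; a] T).
  rewrite /= eqxx => /(_ _ _ _ n1) le2.
  apply: le_trans (le2 _ _ _) _ => //.
    by rewrite xpair_eqE eqxx eq_sym.
  rewrite /avg [in leRHS]mulrCA -[leLHS]mulrA ler_wpM2l ?invr_ge0 ?ler0n//.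
  rewrite -mulr_sumr [leRHS]mulrA ler_wpM2r//.
    by apply: sumr_ge0 => u _; apply: sumr_ge0 => v _; apply: EE_ge0.
  rewrite -[2]invrK -invfM lef_pV2 ?posrE ?mulr_gt0 ?ltr0n ?subn_gt0//.
  rewrite mulrC ler_pdivrMr// -natrM ler_nat.
  by rewrite /=; lia.
have m0 : 0 <= T0%:R * (n%:R^-1 + 2 * hT T0).
  by rewrite mulr_ge0 ?addr_ge0 ?invr_ge0 ?ler0n// mulr_ge0.
apply: (@le_trans _ _ (Q T0)); last by rewrite lerDr mulr_ge0// mulr_ge0.
rewrite /Q ler_pM2l//; apply: avg_F => //; first exact: ltnW.
move=> u v uv; apply: le_trans (@EE_meet T T0 u v (ltnW TT) uv) _.
by rewrite ler_wpM2r ?addr_ge0 ?invr_ge0 ?ler0n ?mulr_ge0// ler_nat ltnW.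
Qed.

Lemma EE_remeet T a : (1 < n)%N ->
  EE (fun s => remeet [::] T s a) <= 14 * T.+2%:R ^+ 3 / n%:R.
Proof.
move=> n1; apply: le_trans (EE_remeet_aux a n1 (leqnn T)) _.
rewrite /Q /hT.
set x : R := T%:R; have x0 : 0 <= x by rewrite ler0n.
have -> : (2 + T)%:R = 2 + x :> R by rewrite natrD.
have -> : T.+1%:R = x + 1 :> R by rewrite natr1.
set i : R := n%:R^-1; have i0 : 0 <= i by rewrite invr_ge0 ler0n.
rewrite -subr_ge0 (_ : _ - _ = i * (14 * (2 + x) ^+ 3 - x * (2 * ((x + 1) * (2 + x))) -
  2 * (1 + x * (1 + 2 * ((x + 1) * (2 + x))) + 2 * ((x + 1) * (2 + x))))); last by ring.
by rewrite mulr_ge0//; nra.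
Qed.

Lemma EE_avg_meet T : (0 < n)%N ->
  avg (fun a => avg (fun b => EE (fun s => meet [::] T s a b))) <=
  6 * T.+2%:R ^+ 3 / n%:R.
Proof.
move=> n0; pose m : R := T%:R * (n%:R^-1 + 2 * hT T).
apply: (@le_trans _ _ (avg (fun a => avg (fun b => (a == b)%:R + m)))).
  apply: avg_le => a; apply: avg_le => b; case: (eqVneq a b) => [->|ab].
    rewrite (le_trans (y := 1))//; first by apply: EE_le_cst => s; apply: meet_le1.
    rewrite lerDl /m mulr_ge0 ?addr_ge0 ?invr_ge0 ?ler0n//.
    by rewrite mulr_ge0.
  by rewrite add0r EE_meet.
rewrite (_ : (fun a => _) = fun a => n%:R^-1 + m); last first.
  apply/funext => a; rewrite !avgD !avg_cst//; congr (_ + _).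
  by rewrite /avg (bigD1 a)//= eqxx big1 ?addr0 ?mulr1// => b; rewrite eq_sym => /negbTE ->.
rewrite avg_cst// /m /hT.
set x : R := T%:R; have x0 : 0 <= x by rewrite ler0n.
have -> : (2 + T)%:R = 2 + x :> R by rewrite natrD.
have -> : T.+1%:R = x + 1 :> R by rewrite natr1.
set i : R := n%:R^-1; have i0 : 0 <= i by rewrite invr_ge0 ler0n.
rewrite -subr_ge0 (_ : _ - _ = i * (6 * (2 + x) ^+ 3 - 1 -
   x * (1 + 2 * ((x + 1) * (2 + x))))); last by ring.
by rewrite mulr_ge0//; nra.
Qed.

End MeetingTimes.

(** * Path weights and truncated kernels *)

Section Kernels.
Variables (R : realType) (n : nat) (p : 'M[R]_n).
Hypotheses (p0 : forall i j, 0 <= p i j) (p1 : forall i, \sum_j p i j = 1).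
Implicit Types (S : seq 'I_n) (s t : env n).
Local Notation EE := (@EE R n).
Local Notation hit := (hit p).
Local Notation meet := (meet p).
Local Notation remeet := (remeet p).

(* [c] records the product of the labels read since the start of the walk. *)
Fixpoint walk S T s (phi : R -> 'I_n -> R) c x : R :=
  if x \in S then 0 else
  if T is T'.+1 then \sum_k p x k * walk S T' s phi (c * p x k) (s x k) else phi c x.

Definition law S T s (f : 'I_n -> R) x : R := walk S T s (fun _ => f) 1 x.

Definition dirac (j z : 'I_n) : R := (z == j)%:R.

Definition low (theta : R) j (c : R) z : R := (c <= theta)%R%:R * dirac j z.

(* Law after [v + l] steps avoiding [S], restricted to the paths whose last [l]
   labels have product at most [theta]. *)
Definition ker theta l S v s y j : R := law S v s (walk S l s (low theta j) 1) y.

Lemma walk_ext S T s phi psi c x : (forall c x, phi c x = psi c x) ->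
  walk S T s phi c x = walk S T s psi c x.
Proof.
move=> pp; elim: T c x => [|T IH] c x /=; case: ifP => // _.
by apply: eq_bigr => k _; rewrite IH.
Qed.

Lemma walk_le S T s phi psi c x : (forall c x, phi c x <= psi c x) ->
  walk S T s phi c x <= walk S T s psi c x.
Proof.
move=> pp; elim: T c x => [|T IH] c x /=; case: ifP => // _.
exact: row_mono.
Qed.

Lemma walk_le1 S T s phi c x : (forall c x, phi c x <= 1) -> walk S T s phi c x <= 1.
Proof.
move=> pp; elim: T c x => [|T IH] c x /=; case: ifP => // _.
exact: row_le.
Qed.

Lemma walk_ge0 S T s phi c x : (forall c x, 0 <= phi c x) -> 0 <= walk S T s phi c x.
Proof.
move=> pp; elim: T c x => [|T IH] c x /=; case: ifP => // _.
exact: row_ge0.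
Qed.

Lemma walk_sum S T s I (r : seq I) (P : pred I) (phi : I -> R -> 'I_n -> R) c x :
  walk S T s (fun c x => \sum_(i <- r | P i) phi i c x) c x =
  \sum_(i <- r | P i) walk S T s (phi i) c x.
Proof.
elim: T c x => [|T IH] c x /=; case: ifP => // _; first by rewrite big1.
  by rewrite big1.
rewrite exchange_big/=; apply: eq_bigr => k _; rewrite IH mulr_sumr.
by [].
Qed.

Lemma walk_const S T s (f : 'I_n -> R) c d x :
  walk S T s (fun _ => f) c x = walk S T s (fun _ => f) d x.
Proof.
elim: T c d x => [|T IH] c d x //=; case: ifP => // _.
by apply: eq_bigr => k _; rewrite (IH _ (d * p x k)).
Qed.

Lemma lawS S T s f x : law S T.+1 s f x =
  if x \in S then 0 else \sum_k p x k * law S T s f (s x k).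
Proof.
rewrite /law /=; case: ifP => // _; apply: eq_bigr => k _; congr (_ * _).
exact: walk_const.
Qed.

Lemma law0 S s f x : law S 0 s f x = if x \in S then 0 else f x.
Proof. by []. Qed.

Lemma indep_walk S T phi c x : indep_of S (fun s => walk S T s phi c x).
Proof.
move=> s t st; elim: T c x => [|T IH] c x //=; case: ifP => // /negbT xS.
by apply: eq_bigr => k _; rewrite IH st.
Qed.

Lemma law_ext S T s f g x : f =1 g -> law S T s f x = law S T s g x.
Proof. by move=> fg; apply: walk_ext. Qed.

Lemma law_le S T s f g x : (forall z, f z <= g z) -> law S T s f x <= law S T s g x.
Proof. by move=> fg; apply: walk_le. Qed.

Lemma law_ge0 S T s f x : (forall z, 0 <= f z) -> 0 <= law S T s f x.
Proof. by move=> fg; apply: walk_ge0. Qed.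

Lemma law_sum S T s I (r : seq I) (P : pred I) (f : I -> 'I_n -> R) x :
  law S T s (fun x => \sum_(i <- r | P i) f i x) x =
  \sum_(i <- r | P i) law S T s (f i) x.
Proof. exact: (walk_sum S T s r P (fun i _ => f i)). Qed.

Lemma law_cst T s a x : law [::] T s (fun=> a) x = a.
Proof.
elim: T x => [|T IH] x //; rewrite lawS/=.
by under eq_bigr do rewrite IH; rewrite -mulr_suml p1 mul1r.
Qed.

Lemma law_add T T' s f x : law [::] (T + T') s f x = law [::] T s (law [::] T' s f) x.
Proof.
elim: T x => [|T IH] x //; rewrite addSn !lawS/=.
by apply: eq_bigr => k _; rewrite IH.
Qed.

Lemma trans_mxX T s i j : (trans_mx p s ^+ T) i j = law [::] T s (dirac j) i.
Proof.
elim: T i => [|T IH] i.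
  rewrite law0/= expr0; have [->|ij] := eqVneq i j; first by rewrite /dirac eqxx mxE eqxx.
  by rewrite mxE /dirac (negbTE ij).
rewrite exprS mxE lawS/= (reindex_inj (@perm_inj _ (s i)))/=.
by apply: eq_bigr => k _; rewrite mxE permK IH.
Qed.

Lemma walk_hit S T s phi c x : (forall c x, 0 <= phi c x <= 1) ->
  walk [::] T s phi c x <= walk S T s phi c x + hit S T s x.
Proof.
move=> pp; elim: T c x => [|T IH] c x /=.
  by case: ifP => _; rewrite ?add0r ?addr0//; case/andP: (pp c x).
case: ifP => _.
  by rewrite add0r; apply: row_le => // k; apply: walk_le1 => c' z; case/andP: (pp c' z).
rewrite -big_split/=; apply: ler_sum => k _; rewrite -mulrDr ler_wpM2l//.
Qed.

Lemma walk_mono S T s phi c x : (forall c x, 0 <= phi c x) ->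
  walk S T s phi c x <= walk [::] T s phi c x.
Proof.
move=> pp; elim: T c x => [|T IH] c x /=; case: ifP => // _.
  exact: row_ge0 (fun k => walk_ge0 _ _ _ _ _ pp).
exact: row_mono.
Qed.

Lemma dirac_ge0 j z : 0 <= dirac j z. Proof. exact: ler0n. Qed.

Lemma dirac_sum z : \sum_j dirac j z = 1.
Proof.
rewrite (bigD1 z)//= /dirac eqxx big1 ?addr0// => j.
by rewrite eq_sym => /negbTE ->.
Qed.

Lemma low_ge0 theta j c z : 0 <= low theta j c z.
Proof. by rewrite mulr_ge0 ?ler0n. Qed.

Lemma low_sum theta c z : \sum_j low theta j c z = (c <= theta)%R%:R.
Proof. by rewrite -mulr_sumr dirac_sum mulr1. Qed.

Lemma ker_ge0 theta l S v s y j : 0 <= ker theta l S v s y j.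
Proof. by apply: law_ge0 => z; apply: walk_ge0 => c z'; exact: low_ge0. Qed.

Lemma ker_sum theta l S v s y :
  \sum_j ker theta l S v s y j =
  law S v s (walk S l s (fun c _ => (c <= theta)%R%:R) 1) y.
Proof.
rewrite -law_sum; apply: law_ext => z; rewrite -walk_sum.
by apply: walk_ext => c x; rewrite low_sum.
Qed.

Lemma ker_sum_le1 theta l S v s y : \sum_j ker theta l S v s y j <= 1.
Proof.
rewrite ker_sum; apply: walk_le1 => _ x; apply: walk_le1 => c _.
by case: (c <= theta).
Qed.

Lemma ker_mono theta l S v s y j : ker theta l S v s y j <= ker theta l [::] v s y j.
Proof.
apply: (@le_trans _ _ (law S v s (walk [::] l s (low theta j) 1) y)).
  by apply: law_le => z; apply: walk_mono => c x; apply: low_ge0.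
by apply: walk_mono => _ x; apply: walk_ge0 => c z; exact: low_ge0.
Qed.

Lemma indep_ker theta l S v y j : indep_of S (fun s => ker theta l S v s y j).
Proof.
move=> s t st; rewrite /ker /law -(indep_walk _ _ _ _ st); apply: walk_ext => _ x.
exact: indep_walk st.
Qed.

Lemma ker_hit theta l S v s y :
  \sum_j ker theta l [::] v s y j <= \sum_j ker theta l S v s y j + hit S (v + l) s y.
Proof.
rewrite !ker_sum; have lp (c : R) : 0 <= ((c <= theta)%R%:R : R) <= 1 by rewrite ler0n lern1 leq_b1.
elim: v y => [|v IH] y.
  rewrite !law0/= add0n; case: ifP => yS; last exact: walk_hit.
  rewrite add0r; apply: (@le_trans _ _ 1).
    by apply: walk_le1 => c _; case/andP: (lp c).
  by case: l => [|l] /=; rewrite yS.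
rewrite !lawS/=; case: ifP => _.
  rewrite add0r; apply: row_le => // k; apply: walk_le1 => _ z; apply: walk_le1 => c _.
  by case/andP: (lp c).
by rewrite -big_split/=; apply: ler_sum => k _; rewrite -mulrDr ler_wpM2l.
Qed.

Lemma ker_le_law theta l v s y j : ker theta l [::] v s y j <= law [::] (v + l) s (dirac j) y.
Proof.
rewrite law_add; apply: law_le => z; apply: walk_le => c x.
by rewrite /low ler_piMl ?dirac_ge0//; case: (c <= theta).
Qed.

Lemma sum_row_mul x y (F G : 'I_n -> 'I_n -> R) :
  \sum_j (\sum_k p x k * F k j) * (\sum_l p y l * G l j) =
  \sum_k p x k * \sum_l p y l * \sum_j F k j * G l j.
Proof.
under eq_bigr do rewrite big_distrlr/=.
rewrite exchange_big/=; apply: eq_bigr => k _; rewrite exchange_big mulr_sumr/=.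
apply: eq_bigr => l _; rewrite !mulr_sumr; apply: eq_bigr => j _; ring.
Qed.

Lemma sum_row_sqr x (F : 'I_n -> 'I_n -> R) :
  \sum_j (\sum_k p x k * F k j) ^+ 2 =
  \sum_k p x k * (p x k * (\sum_j F k j ^+ 2) +
    \sum_(l | l != k) p x l * \sum_j F k j * F l j).
Proof.
rewrite (eq_bigr _ (fun j _ => expr2 _)) sum_row_mul; apply: eq_bigr => k _.
by rewrite (bigD1 k)//=.
Qed.

Lemma law_meet T s a b :
  \sum_j law [::] T s (dirac j) a * law [::] T s (dirac j) b = meet [::] T s a b.
Proof.
elim: T a b => [|T IH] a b.
  under eq_bigr do rewrite !law0/=; rewrite /= (bigD1 a)//= {1}/dirac eqxx mul1r.
  rewrite [X in _ + X]big1 ?addr0 /dirac 1?eq_sym// => j.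
  by rewrite eq_sym => /negbTE ->; rewrite mul0r.
under eq_bigr do rewrite !lawS/=.
by rewrite sum_row_mul; apply: eq_bigr => k _; congr (_ * _); apply: eq_bigr => l _; rewrite IH.
Qed.

Lemma low_meet theta l s c c' a b :
  \sum_j walk [::] l s (low theta j) c a * walk [::] l s (low theta j) c' b <=
  meet [::] l s a b.
Proof.
rewrite -law_meet; apply: ler_sum => j _.
have h c0 z : 0 <= walk [::] l s (low theta j) c0 z <= law [::] l s (dirac j) z.
  rewrite walk_ge0 ?andTb; last exact: low_ge0.
  rewrite /law (walk_const _ _ _ _ 1 c0); apply: walk_le => d x.
  by rewrite /low ler_piMl ?dirac_ge0//; case: (d <= theta).
have /andP[? ?] := h c a; have /andP[? ?] := h c' b.
exact: ler_pM.
Qed.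

(** The left side is the probability that two independent walks end at the same vertex, both with
    product at most [theta]. Pairs reading identical labels contribute the sum of the squared path
    weights, each weight being at most [theta / c]; all other pairs have separated at some step and
    are counted by [remeet]. *)
Lemma low_remeet theta l s c a : 0 <= theta -> 0 < c ->
  \sum_j walk [::] l s (low theta j) c a ^+ 2 <= theta / c + remeet [::] l s a.
Proof.
move=> th0; elim: l c a => [|l IH] c a c0 /=.
  rewrite addr0; rewrite (bigD1 a)//= big1 ?addr0; last first.
    by move=> j; rewrite /low /dirac eq_sym => /negbTE ->; rewrite mulr0 expr0n.
  rewrite /low /dirac eqxx mulr1; case: (boolP (c <= theta)) => ct; rewrite ?expr1n ?expr0n/=.
    by rewrite ler_pdivlMr// mul1r.
  by rewrite divr_ge0// ltW.
rewrite sum_row_sqr.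
apply: (@le_trans _ _ (\sum_k (p a k * (theta / c) + p a k * (p a k * remeet [::] l s (s a k) +
   \sum_(l0 | l0 != k) p a l0 * meet [::] l s (s a k) (s a l0))))); last first.
  by rewrite big_split/= -mulr_suml p1 mul1r.
apply: ler_sum => k _; rewrite -mulrDr ler_wpM2l// addrA; apply: lerD; last first.
  by apply: ler_sum => l0 _; rewrite ler_wpM2l// low_meet.
have [->|pk] := eqVneq (p a k) 0; first by rewrite !mul0r addr0 divr_ge0// ltW.
have pk0 : 0 < p a k by rewrite lt_def pk p0.
apply: (@le_trans _ _ (p a k * (theta / (c * p a k) + remeet [::] l s (s a k)))).
  by rewrite ler_wpM2l// IH// mulr_gt0.
rewrite mulrDr lerD2r le_eqVlt; apply/orP; left; apply/eqP; field.
by rewrite pk gt_eqF.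
Qed.

Lemma ker_meet theta l v s a b :
  \sum_j ker theta l [::] v s a j * ker theta l [::] v s b j <= meet [::] (v + l) s a b.
Proof.
rewrite -law_meet; apply: ler_sum => j _.
by rewrite ler_pM ?ker_ge0 ?ker_le_law.
Qed.

(** Untruncated initial steps do not spoil the bound: they multiply [theta] by a sum of squared
    labels. With [theta = 1/n] this is, in expectation, the l2 bound required of the kernels up to
    powers of logarithms. *)
Lemma ker_remeet theta l v s a : 0 <= theta ->
  \sum_j ker theta l [::] v s a j ^+ 2 <= theta + remeet [::] (v + l) s a.
Proof.
move=> th0; elim: v a => [|v IH] a.
  by apply: le_trans (low_remeet _ _ _ th0 ltr01) _; rewrite divr1.
under eq_bigr do rewrite /ker lawS/=; rewrite sum_row_sqr.
apply: (@le_trans _ _ (\sum_k p a k * (p a k * (theta + remeet [::] (v + l) s (s a k)) +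
   \sum_(l0 | l0 != k) p a l0 * meet [::] (v + l) s (s a k) (s a l0)))).
  apply: row_mono => // k; apply: lerD; first by apply: ler_wpM2l => //; exact: IH.
  by apply: ler_sum => l0 _; apply: ler_wpM2l => //; exact: ker_meet.
rewrite /= [leLHS](_ : _ = \sum_k p a k * (p a k * theta) +
  \sum_k p a k * (p a k * remeet [::] (v + l) s (s a k) +
   \sum_(l0 | l0 != k) p a l0 * meet [::] (v + l) s (s a k) (s a l0))); last first.
  by rewrite -big_split/=; apply: eq_bigr => k _; ring.
rewrite lerD2r; apply: row_le => // k; rewrite ler_piMl//.
by rewrite (row_split p1 a k) lerDl sumr_ge0.
Qed.

Definition occ s u x : R := avg (law [::] u s (dirac x)).

Lemma occ_ge0 s u x : 0 <= occ s u x.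
Proof. by apply: avg_ge0 => a; apply: law_ge0 => z; apply: dirac_ge0. Qed.

Lemma occ_sqr s u :
  \sum_x occ s u x ^+ 2 = avg (fun a => avg (fun b => meet [::] u s a b)).
Proof.
transitivity (\sum_x avg (fun a => avg (fun b =>
   law [::] u s (dirac x) a * law [::] u s (dirac x) b))).
  apply: eq_bigr => x _; rewrite /avg -[in RHS]mulr_sumr mulrA -expr2 exprMn; congr (_ * _).
  rewrite expr2 mulr_suml; apply: eq_bigr => a _.
  by rewrite mulr_sumr.
rewrite -avg_sum; apply: avg_ext => a; rewrite -avg_sum; apply: avg_ext => b.
exact: law_meet.
Qed.

Lemma hit_le_occ S T s x :
  hit S T s x <= \sum_(u < T.+1) \sum_(z <- S) law [::] u s (dirac z) x.
Proof.
have ge0 T' y : 0 <= \sum_(u < T') \sum_(z <- S) law [::] u s (dirac z) y.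
  by apply: sumr_ge0 => u _; apply: sumr_ge0 => z _; apply: law_ge0 => w; apply: dirac_ge0.
have in1 y : y \in S -> 1 <= \sum_(z <- S) law [::] 0 s (dirac z) y.
  move=> yS; rewrite (perm_big _ (perm_to_rem yS)) big_cons law0/= /dirac eqxx lerDl.
  by apply: sumr_ge0 => z _; rewrite law0/= ler0n.
elim: T x => [|T IH] x.
  rewrite /=; case: ifP => xS; last exact: ge0.
  by rewrite big_ord_recl big_ord0 addr0 in1.
rewrite /=; case: ifP => xS.
  rewrite big_ord_recl; apply: le_trans (in1 _ xS) _; rewrite lerDl.
  by apply: sumr_ge0 => u _; apply: sumr_ge0 => z _; apply: law_ge0 => w; apply: dirac_ge0.
rewrite big_ord_recl; apply: ler_wpDl.
  by apply: sumr_ge0 => z _; apply: law_ge0 => w; apply: dirac_ge0.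
apply: le_trans (row_mono p0 _ (fun k => IH _)) _.
under eq_bigr do rewrite mulr_sumr; rewrite exchange_big/=.
apply: ler_sum => u _; under eq_bigr do rewrite mulr_sumr; rewrite exchange_big/=.
by apply: ler_sum => z _; rewrite lawS.
Qed.

(** Quenched counterpart of [EE_avg_hit]: it applies to sets [S] built from the environment, such as
    the vertices of an explored tree. *)
Lemma avg_hit_le_occ S T s b : (forall u x, (u <= T)%N -> occ s u x <= b) ->
  avg (hit S T s) <= (T.+1 * size S)%:R * b.
Proof.
move=> ob; apply: (@le_trans _ _ (avg (fun x => \sum_(u < T.+1) \sum_(z <- S)
    law [::] u s (dirac z) x))); first by apply: avg_le => x; exact: hit_le_occ.
rewrite avg_sum; under eq_bigr do rewrite avg_sum.
apply: (@le_trans _ _ (\sum_(u < T.+1) \sum_(z <- S) b)).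
  by apply: ler_sum => u _; apply: ler_sum => z _; apply: ob; rewrite -ltnS.
have -> : \sum_(z <- S) b = (size S)%:R * b.
  by rewrite big_const_seq count_predT iter_addr_0 mulr_natl.
by rewrite sumr_const card_ord natrM -mulrA -[leLHS]mulr_natl.
Qed.

End Kernels.

(** * Self-avoiding walks: first-moment bounds and the law of large numbers *)

Section SelfAvoidingWalks.
Variables (R : realType) (n : nat) (p : 'M[R]_n).
Hypotheses (p0 : forall i j, 0 <= p i j) (p1 : forall i, \sum_j p i j = 1).
Implicit Types (S : seq 'I_n) (s t : env n).
Local Notation EE := (@EE R n).
Local Notation dirty := (dirty p).
Local Notation walk := (walk p).

(** Weights other than [p] are allowed: indicators of heavy labels and powers of [p] serve to
    exclude cycles and heavy paths. The final vertex is not tested against [S], so that a path may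
    close up into a cycle. *)
Fixpoint sawalk (g : 'I_n -> 'I_n -> R) S T s phi c x : R :=
  if T is T'.+1 then
    if x \in S then 0 else
    \sum_k g x k * sawalk g (x :: S) T' s phi (c * p x k) (s x k)
  else phi c x.

(* The walk in which every step meets a fresh uniform row: an upper bound for
   the expectation of a self-avoiding walk. *)
Fixpoint iidwalk (g : 'I_n -> 'I_n -> R) T phi (c : R) (x : 'I_n) : R :=
  if T is T'.+1 then \sum_k g x k * avg (iidwalk g T' phi (c * p x k))
  else phi c x.

Lemma indep_sawalk g S T phi c x : indep_of S (fun s => sawalk g S T s phi c x).
Proof.
move=> s t; elim: T S c x => [|T IH] S c x //= st; case: ifP => // /negbT xS.
apply: eq_bigr => k _; rewrite st// IH// => z; rewrite inE negb_or => /andP[_].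
exact: st.
Qed.

Lemma sawalk_ge0 g S T s phi c x : (forall x k, 0 <= g x k) ->
  (forall c x, 0 <= phi c x) -> 0 <= sawalk g S T s phi c x.
Proof.
move=> g0 pp; elim: T S c x => [|T IH] S c x //=; case: ifP => // _.
by apply: sumr_ge0 => k _; rewrite mulr_ge0.
Qed.

Lemma iidwalk_ge0 g T phi c x : (forall x k, 0 <= g x k) ->
  (forall c x, 0 <= phi c x) -> 0 <= iidwalk g T phi c x.
Proof.
move=> g0 pp; elim: T c x => [|T IH] c x //=.
by apply: sumr_ge0 => k _; rewrite mulr_ge0// avg_ge0.
Qed.

(** Each step of a self-avoiding walk reads a new row, so [expose1] may replace its target by a
    uniform vertex. *)
Lemma EE_sawalk g S T phi c x : (forall x k, 0 <= g x k) ->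
  (forall c x, 0 <= phi c x) ->
  EE (fun s => sawalk g S T s phi c x) <= iidwalk g T phi c x.
Proof.
move=> g0 pp; elim: T S c x => [|T IH] S c x; first by rewrite /= EE_cst.
have [xS|xS] := boolP (x \in S).
  by apply: EE_le_cst => s; rewrite /= xS; exact: (iidwalk_ge0 T.+1).
rewrite (@EE_ext _ _ _ (fun s => \sum_k g x k *
   sawalk g (x :: S) T s phi (c * p x k) (s x k))); last first.
  by move=> s /=; rewrite (negbTE xS).
rewrite EE_sum /=; apply: ler_sum => k _; rewrite EEZ ler_wpM2l//.
apply: le_trans.
  apply: (@expose1 R n x k (fun a s => sawalk g (x :: S) T s phi (c * p x k) a)).
    move=> a; apply: sub_indep (@indep_sawalk _ _ _ _ _ _) => z.
    by rewrite !inE => ->.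
  by move=> a s; exact: sawalk_ge0.
by apply: avg_le => a; apply: IH.
Qed.

Lemma walk_le_sawalk S T s phi c x : (forall c x, 0 <= phi c x <= 1) ->
  walk [::] T s phi c x <= sawalk p S T s phi c x + dirty S T s x.
Proof.
move=> pp; elim: T S c x => [|T IH] S c x /=.
  by case: ifP => _; rewrite ?addr0// lerDl.
case: ifP => _.
  rewrite add0r; apply: row_le => // k; apply: walk_le1 => // c' z.
  by case/andP: (pp c' z).
by rewrite -big_split/=; apply: ler_sum => k _; rewrite -mulrDr ler_wpM2l.
Qed.

Lemma iidwalk_end g T (psi : 'I_n -> R) c x : (0 < n)%N ->
  iidwalk g T.+1 (fun _ => psi) c x =
  (\sum_k g x k) * avg (fun x => \sum_k g x k) ^+ T * avg psi.
Proof.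
move=> n0; elim: T c x => [|T IH] c x; first by rewrite expr0 mulr1/= mulr_suml.
set C := avg _ in IH *.
have e d : avg (iidwalk g T.+1 (fun _ => psi) d) = C ^+ T.+1 * avg psi.
  rewrite (avg_ext (g := fun z => (C ^+ T * avg psi) * \sum_k g z k)).
    by rewrite avgZ -/C exprSr; ring.
  by move=> z; rewrite IH; ring.
transitivity (\sum_k g x k * (C ^+ T.+1 * avg psi)); last by rewrite -mulr_suml mulrA.
by apply: eq_bigr => k _; rewrite -(e (c * p x k)).
Qed.

(** The first row is the fixed row [x], bounded by 1; only the [T] later rows are averaged. *)
Lemma EE_sawalk_pow g T c x : (0 < n)%N -> (forall x k, 0 <= g x k) ->
  \sum_k g x k <= 1 ->
  EE (fun s => sawalk g [::] T.+1 s (fun _ _ => 1) c x) <=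
  avg (fun x => \sum_k g x k) ^+ T.
Proof.
move=> n0 g0 g1; apply: le_trans (EE_sawalk _ _ _ _ g0 _) _ => //.
rewrite iidwalk_end// avg_cst// mulr1 ler_piMl// exprn_ge0// avg_ge0// => z.
exact: sumr_ge0.
Qed.

(** Summing over the base point averages the first row as well, and closing up at the last, uniform
    target cancels the factor [n]. *)
Lemma EE_sawalk_cycle g T c : (0 < n)%N -> (forall x k, 0 <= g x k) ->
  \sum_x EE (fun s => sawalk g [::] T.+1 s (fun _ => dirac R x) c x) <=
  avg (fun x => \sum_k g x k) ^+ T.+1.
Proof.
move=> n0 g0.
apply: (@le_trans _ _ (\sum_x (\sum_k g x k) * (avg (fun x => \sum_k g x k) ^+ T * n%:R^-1))).
  apply: ler_sum => x _; apply: le_trans (EE_sawalk _ _ _ _ g0 _) _.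
    by move=> _ z; apply: dirac_ge0.
  rewrite iidwalk_end// -mulrA; apply: eqle; congr (_ * (_ * _)).
  rewrite /avg (bigD1 x)//= /dirac eqxx big1 ?addr0 ?mulr1// => z /negbTE ->.
  by [].
by rewrite -big_distrl/= exprSr /avg; apply: eqle; ring.
Qed.

Lemma iidwalkZ g T a phi c x :
  iidwalk g T (fun c x => a * phi c x) c x = a * iidwalk g T phi c x.
Proof.
elim: T c x => [|T IH] c x //=; rewrite mulr_sumr; apply: eq_bigr => k _.
rewrite [in RHS]mulrCA; congr (_ * _); rewrite -[RHS]avgZ; apply: avg_ext => z; exact: IH.
Qed.

(** Comparison for [c > 0] suffices because zero labels carry no mass; this keeps the convention
    [ln 0 = 0] out of the estimates. *)
Lemma iidwalk_le_pos T phi psi c x : (forall c x, 0 < c -> phi c x <= psi c x) -> 0 < c ->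
  iidwalk p T phi c x <= iidwalk p T psi c x.
Proof.
move=> pp; elim: T c x => [|T IH] c x c0 /=; first exact: pp.
apply: ler_sum => k _; have [->|pk] := eqVneq (p x k) 0; first by rewrite !mul0r.
rewrite ler_wpM2l// avg_le// => z; apply: IH.
by rewrite mulr_gt0// lt_def pk p0.
Qed.

Let H := avg_entropy p.
Definition log_sqr : R := avg (fun x => \sum_k p x k * ln (p x k) ^+ 2).

(** The logarithms of the labels have mean [- H] and second moment [log_sqr], so each step moves the
    mean by [- H] and adds at most [log_sqr] to the variance; the term discarded at the end is
    [H ^+ 2]. *)
Lemma iidwalk_log T b c : (0 < n)%N -> 0 < c ->
  avg (iidwalk p T (fun c _ => (ln c + b) ^+ 2) c) <=
  (ln c + b - T%:R * H) ^+ 2 + T%:R * log_sqr.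
Proof.
move=> n0; move: (erefl log_sqr); rewrite {1}/log_sqr; move: (log_sqr) => V eV.
elim: T c => [|T IH] c c0; first by rewrite /= avg_cst// !mul0r subr0 addr0.
set A := ln c + b - T%:R * H.
apply: (@le_trans _ _ (avg (fun x => \sum_k p x k * ((A + ln (p x k)) ^+ 2 + T%:R * V)))).
  apply: avg_le => x /=; apply: ler_sum => k _.
  have [->|pk] := eqVneq (p x k) 0; first by rewrite !mul0r.
  have pk0 : 0 < p x k by rewrite lt_def pk p0.
  rewrite ler_wpM2l//; apply: le_trans (IH _ _) _; first exact: mulr_gt0.
  rewrite lnM ?posrE// /A; apply: eqle; congr (_ ^+ 2 + _); ring.
rewrite (avg_ext (g := fun x => (A ^+ 2 + T%:R * V) +
   (2 * A * (\sum_k p x k * ln (p x k)) + \sum_k p x k * ln (p x k) ^+ 2))); last first.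
  move=> x; have -> : A ^+ 2 + T%:R * V = \sum_k p x k * (A ^+ 2 + T%:R * V).
    by rewrite -mulr_suml p1 mul1r.
  rewrite mulr_sumr -!big_split/=.
  by apply: eq_bigr => k _; ring.
rewrite !avgD !avgZ !avg_cst// eV.
have -> : avg (fun x => \sum_k p x k * ln (p x k)) = - H by rewrite /H /avg_entropy opprK.
rewrite -[T.+1%:R]natr1 -subr_ge0 (_ : _ - _ = H ^+ 2) ?sqr_ge0//; rewrite /A; ring.
Qed.

(** Chebyshev's inequality for a test function: the assumption on [phi] fits products that are too
    large as well as products that are too small. The last term pays for walks that are not
    self-avoiding. *)
Lemma walk_lln T phi D : (0 < n)%N -> 0 < D -> (forall c x, 0 <= phi c x <= 1) ->
  (forall c x, 0 < c -> phi c x <= (ln c + T%:R * H) ^+ 2 / D ^+ 2) ->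
  EE (fun s => avg (walk [::] T s phi 1)) <=
  T%:R * log_sqr / D ^+ 2 + T.+1%:R * T%:R / n%:R.
Proof.
move=> n0 D0 pp pD.
apply: (@le_trans _ _ (EE (fun s => avg (fun x => sawalk p [::] T s phi 1 x) +
    avg (fun x => dirty [::] T s x)))).
  by apply: EE_le => s; rewrite -avgD; apply: avg_le => x; apply: walk_le_sawalk.
rewrite EED (EE_avg (fun x s => sawalk p [::] T s phi 1 x)) (EE_avg (fun x s => dirty [::] T s x)).
apply: lerD; last by apply: le_trans (EE_avg_dirty p0 p1 [::] T n0) _; rewrite add0n.
apply: (@le_trans _ _ (avg (iidwalk p T (fun c _ => D ^- 2 * (ln c + T%:R * H) ^+ 2) 1))).
  apply: avg_le => x; apply: le_trans (EE_sawalk _ _ _ _ p0 _) _.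
    by move=> c z; case/andP: (pp c z).
  by apply: iidwalk_le_pos => // c z c0; rewrite mulrC pD.
have -> : avg (iidwalk p T (fun c _ => D ^- 2 * (ln c + T%:R * H) ^+ 2) 1) =
   D ^- 2 * avg (iidwalk p T (fun c _ => (ln c + T%:R * H) ^+ 2) 1).
  by rewrite -avgZ; apply: avg_ext => x; rewrite iidwalkZ.
rewrite mulrC ler_wpM2r ?invr_ge0 ?sqr_ge0//.
apply: le_trans (iidwalk_log _ _ n0 ltr01) _.
by rewrite ln1 add0r subrr expr0n add0r.
Qed.

Fixpoint pathto s x (es : seq ('I_n * 'I_n)) y : bool :=
  if es is e :: es' then (e.1 == x) && pathto s (s x e.2) es' y else x == y.

Definition wprod (g : 'I_n -> 'I_n -> R) (es : seq ('I_n * 'I_n)) : R :=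
  \prod_(e <- es) g e.1 e.2.

(** A single self-avoiding path bounds the walk functional from below, so Markov's inequality for
    the latter excludes such paths. *)
Lemma sawalk_path g S s phi c x es y : (forall x k, 0 <= g x k) ->
  (forall c x, 0 <= phi c x) -> pathto s x es y -> uniq (map fst es) ->
  (forall z, z \in map fst es -> z \notin S) ->
  wprod g es * phi (c * wprod p es) y <= sawalk g S (size es) s phi c x.
Proof.
move=> g0 pp; rewrite /wprod; elim: es S c x => [|[z k] es IH] S c x /=.
  by move=> /eqP -> _ _; rewrite !big_nil mul1r mulr1.
move=> /andP[/eqP -> pes] /andP[xes ues] esS; rewrite (negbTE (esS x _)) ?inE ?eqxx//.
rewrite (bigD1 k)//= !big_cons/= -mulrA mulrA.
apply: ler_wpDr.
  by apply: sumr_ge0 => l _; rewrite mulr_ge0 ?sawalk_ge0.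
rewrite -mulrA ler_wpM2l// mulrA; apply: IH => // w wes.
rewrite inE negb_or esS ?inE ?wes ?orbT// andbT.
by apply: contraNneq xes => <-.
Qed.

Lemma pathto_rcons s x es y k : pathto s x es y -> pathto s x (rcons es (y, k)) (s y k).
Proof.
elim: es x => [|e es IH] x /=; first by move=> /eqP ->; rewrite !eqxx.
by move=> /andP[-> /IH].
Qed.

End SelfAvoidingWalks.

(** * Concentration along fresh edges *)

Section Batches.
Variables (R : realType) (n : nat).
Implicit Types (S : seq 'I_n) (s t : env n) (G : seq ('I_n * 'I_n * 'I_n)).
Local Notation E := ('I_n * 'I_n)%type.
Implicit Types (e : E) (es X : seq E) (ys : seq 'I_n).
Local Notation EE := (@EE R n).
Local Notation PG := (@PG R n).

(* Average over [k] independent uniform vertices. *)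
Fixpoint avl k (h : seq 'I_n -> R) : R :=
  if k is k'.+1 then avg (fun y => avl k' (fun ys => h (y :: ys))) else h [::].

Lemma avl_le k h h' : (forall ys, size ys = k -> h ys <= h' ys) -> avl k h <= avl k h'.
Proof.
elim: k h h' => [|k IH] h h' hh /=; first exact: hh.
by apply: avg_le => y; apply: IH => ys sz; apply: hh; rewrite /= sz.
Qed.

Lemma avl_ext k h h' : (forall ys, size ys = k -> h ys = h' ys) -> avl k h = avl k h'.
Proof. by move=> hh; apply/eqP; rewrite eq_le !avl_le// => ys /hh ->. Qed.

Lemma avlZ k c h : avl k (fun ys => c * h ys) = c * avl k h.
Proof.
elim: k h => [|k IH] h //=; rewrite -avgZ; apply: avg_ext => y; exact: IH.
Qed.

Lemma avlD k h h' : avl k (fun ys => h ys + h' ys) = avl k h + avl k h'.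
Proof.
elim: k h h' => [|k IH] h h' //=; rewrite -avgD; apply: avg_ext => y; exact: IH.
Qed.

Lemma avl_cst k c : (0 < n)%N -> avl k (fun=> c) = c.
Proof. by move=> n0; elim: k => //= k IH; rewrite IH avg_cst. Qed.

Lemma avl_ge0 k h : (forall ys, 0 <= h ys) -> 0 <= avl k h.
Proof. by elim: k h => [|k IH] h h0 //=; apply: avg_ge0 => y; apply: IH. Qed.

Lemma EE_avl k (h : seq 'I_n -> env n -> R) :
  EE (fun s => avl k (h^~ s)) = avl k (fun ys => EE (h ys)).
Proof.
elim: k h => [|k IH] h //=.
rewrite (EE_avg (fun y s => avl k (fun ys => h (y :: ys) s))); apply: avg_ext => y.
exact: (IH (fun ys => h (y :: ys))).
Qed.

Variable J : finType.

Fixpoint batch_sum (xi : E -> 'I_n -> J -> R) es ys j : R :=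
  if es is e :: es' then
    if ys is y :: ys' then xi e y j + batch_sum xi es' ys' j else 0
  else 0.

(** Orthogonality: centered functions of independent targets have no cross terms. *)
Lemma avl_sqr xi es acc : (0 < n)%N ->
  (forall e j, e \in es -> avg (fun y => xi e y j) = 0) ->
  avl (size es) (fun ys => \sum_j (acc j + batch_sum xi es ys j) ^+ 2) =
  \sum_j acc j ^+ 2 + \sum_(e <- es) avg (fun y => \sum_j xi e y j ^+ 2).
Proof.
move=> n0; elim: es acc => [|e es IH] acc xi0 /=.
  by rewrite big_nil addr0; apply: eq_bigr => j _; rewrite addr0.
rewrite (avg_ext (g := fun y => \sum_j (acc j + xi e y j) ^+ 2 +
    \sum_(e <- es) avg (fun y => \sum_j xi e y j ^+ 2))); last first.
  move=> y; rewrite -IH; last by move=> e' j e'es; apply: xi0; rewrite inE e'es orbT.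
  by apply: avl_ext => ys _; apply: eq_bigr => j _; rewrite addrA.
rewrite avgD avg_cst// big_cons addrA; congr (_ + _).
rewrite (avg_ext (g := fun y => \sum_j acc j ^+ 2 + \sum_j xi e y j ^+ 2 +
    \sum_j 2 * acc j * xi e y j)); last first.
  by move=> y; rewrite -!big_split/=; apply: eq_bigr => j _; ring.
rewrite !avgD avg_cst// [X in _ + X](_ : _ = 0) ?addr0// avg_sum big1// => j _.
by rewrite avgZ xi0 ?mulr0// inE eqxx.
Qed.

(** Uses [|x| <= t + x ^+ 2 / t] in each coordinate. The value [t = lam * M / #|J|] makes the first
    parts add up to [lam * M]; the variance of a batch mean supplies the factor [1 / M] of the
    second. *)
Lemma avl_L1 xi es lam K : (0 < n)%N -> 0 < lam -> (0 < #|J|)%N ->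
  (forall e j, e \in es -> avg (fun y => xi e y j) = 0) ->
  (forall e, e \in es -> #|J|%:R * avg (fun y => \sum_j xi e y j ^+ 2) <= K) ->
  (0 < size es)%N ->
  avl (size es) (fun ys => (size es)%:R^-1 * \sum_j `|batch_sum xi es ys j|) <=
  lam + K / (lam * (size es)%:R).
Proof.
move=> n0 lam0 J0 xi0 xiK es0; set M : R := (size es)%:R.
have M0 : 0 < M by rewrite ltr0n.
have c0 : 0 < #|J|%:R :> R by rewrite ltr0n.
rewrite avlZ; pose t := lam * M / #|J|%:R.
have t0 : 0 < t by rewrite divr_gt0 ?mulr_gt0.
have abs_le (x : R) : `|x| <= t + x ^+ 2 / t.
  rewrite -(ler_pM2r t0) mulrDl divfK ?gt_eqF//.
  by rewrite -[x ^+ 2]real_normK ?num_real//; have := normr_ge0 x; nra.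
apply: (@le_trans _ _ (M^-1 * avl (size es) (fun ys =>
    lam * M + t^-1 * \sum_j (0 + batch_sum xi es ys j) ^+ 2))).
  rewrite ler_wpM2l ?invr_ge0 ?(ltW M0)//; apply: avl_le => ys _.
  apply: (@le_trans _ _ (\sum_(j : J) (t + batch_sum xi es ys j ^+ 2 / t))).
    by apply: ler_sum => j _; apply: abs_le.
  rewrite big_split/= sumr_const -[t *+ _]mulr_natr divfK ?gt_eqF// lerD2l.
  by rewrite -mulr_suml mulrC; under [in leRHS]eq_bigr do rewrite add0r.
rewrite avlD avl_cst// avlZ (avl_sqr (fun=> 0))// [X in _ * (_ + _ * (X + _))]big1 ?add0r; last first.
  by move=> j _; rewrite expr0n.
rewrite mulrDr mulrCA mulVf ?gt_eqF// mulr1 lerD2l.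
apply: (@le_trans _ _ (M^-1 * (t^-1 * (M * (K / #|J|%:R))))).
  rewrite !ler_wpM2l ?invr_ge0 ?(ltW t0) ?(ltW M0)//.
  apply: (@le_trans _ _ (\sum_(e <- es) (K / #|J|%:R))).
    by rewrite !big_seq; apply: ler_sum => e ees; rewrite ler_pdivlMr// mulrC xiK.
  by rewrite big_const_seq count_predT iter_addr_0 mulr_natl.
rewrite /t; apply: eqle; field.
by rewrite !gt_eqF.
Qed.

Definition centered (f : 'I_n -> J -> R) y j : R := f y j - avg (f^~ j).

Lemma centered_mean f j : (0 < n)%N -> avg (fun y => centered f y j) = 0.
Proof.
move=> n0; rewrite /centered avgD avg_cst//.
by rewrite addrN.
Qed.

Lemma centered_sqr f : (0 < n)%N ->
  avg (fun y => \sum_j centered f y j ^+ 2) <= avg (fun y => \sum_j f y j ^+ 2).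
Proof.
move=> n0; rewrite !avg_sum; apply: ler_sum => j _.
rewrite (avg_ext (g := fun y => f y j ^+ 2 + ((- 2 * avg (f^~ j)) * f y j + avg (f^~ j) ^+ 2))).
  rewrite !avgD avgZ avg_cst// gerDl.
  rewrite (_ : _ + _ = - (avg (f^~ j)) ^+ 2) ?oppr_le0 ?sqr_ge0//.
  ring.
by move=> y; rewrite /centered; ring.
Qed.

Lemma centered_L1 f y : (0 < n)%N -> (forall y, \sum_j `|f y j| <= 1) ->
  \sum_j `|centered f y j| <= 2.
Proof.
move=> n0 f1; apply: (@le_trans _ _ (\sum_j (`|f y j| + avg (fun y => `|f y j|)))).
  apply: ler_sum => j _; apply: le_trans (ler_normB _ _) _; rewrite lerD2l /avg normrM.
  by rewrite ger0_norm ?invr_ge0 ?ler0n// ler_wpM2l ?invr_ge0 ?ler0n// ler_norm_sum.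
rewrite big_split/= -avg_sum; have -> : (2 : R) = 1 + 1 by lra.
apply: lerD => //; apply: (@le_trans _ _ (avg (fun _ : 'I_n => 1))); [exact: avg_le|by rewrite avg_cst].
Qed.

Lemma batch_sum_L1 (f : E -> 'I_n -> J -> R) es ys : (0 < n)%N ->
  (forall e y, \sum_j `|f e y j| <= 1) ->
  \sum_j `|batch_sum (fun e => centered (f e)) es ys j| <= (size es)%:R * 2.
Proof.
move=> n0 f1; elim: es ys => [|e es IH] ys /=.
  by rewrite mul0r big1// => j _; rewrite normr0.
case: ys => [|y ys]; first by rewrite big1 ?mulr_ge0 ?ler0n// => j _; rewrite normr0.
apply: (@le_trans _ _ (\sum_j (`|centered (f e) y j| +
    `|batch_sum (fun e => centered (f e)) es ys j|))).
  by apply: ler_sum => j _; exact: ler_normD.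
rewrite big_split/= -natr1 mulrDl mul1r addrC; apply: lerD; first exact: IH.
by apply: centered_L1.
Qed.

Variable mu : E -> R.
Hypotheses (mu0 : forall e, 0 <= mu e) (mu1 : \sum_e mu e = 1).

(* Expectation over [M] independent edges of law [mu]. *)
Fixpoint pick M (h : seq E -> R) : R :=
  if M is M'.+1 then \sum_e mu e * pick M' (fun es => h (e :: es)) else h [::].

Lemma pick_le M h h' :
  (forall es, size es = M -> (forall e, e \in es -> mu e != 0) -> h es <= h' es) ->
  pick M h <= pick M h'.
Proof.
elim: M h h' => [|M IH] h h' hh /=; first exact: hh.
apply: ler_sum => e _; have [->|me] := eqVneq (mu e) 0; first by rewrite !mul0r.
rewrite ler_wpM2l//; apply: IH => es sz es0; apply: hh; first by rewrite /= sz.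
by move=> e'; rewrite inE => /predU1P[->//|]; apply: es0.
Qed.

Lemma pickD M h h' : pick M (fun es => h es + h' es) = pick M h + pick M h'.
Proof.
elim: M h h' => [|M IH] h h' //=; rewrite -big_split/=; apply: eq_bigr => e _.
by rewrite -mulrDr -IH.
Qed.

Lemma pickZ M c h : pick M (fun es => c * h es) = c * pick M h.
Proof.
elim: M h => [|M IH] h //=; rewrite mulr_sumr; apply: eq_bigr => e _.
by rewrite mulrCA -IH.
Qed.

Lemma pick_cst M c : pick M (fun=> c) = c.
Proof. by elim: M => //= M ->; rewrite -mulr_suml mu1 mul1r. Qed.

Lemma pick_sum M I (r : seq I) (P : pred I) (h : I -> seq E -> R) :
  pick M (fun es => \sum_(i <- r | P i) h i es) = \sum_(i <- r | P i) pick M (h i).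
Proof.
elim: M h => [|M IH] h //=; rewrite exchange_big/=; apply: eq_bigr => e _.
by rewrite (IH (fun i es => h i (e :: es))) mulr_sumr.
Qed.

Lemma pick_abs M h : `|pick M h| <= pick M (fun es => `|h es|).
Proof.
elim: M h => [|M IH] h //=; apply: le_trans (ler_norm_sum _ _ _) _.
by apply: ler_sum => e _; rewrite normrM (ger0_norm (mu0 e)) ler_wpM2l.
Qed.

Lemma EE_pick M (h : seq E -> env n -> R) :
  EE (fun s => pick M (h^~ s)) = pick M (fun es => EE (h es)).
Proof.
elim: M h => [|M IH] h //=; rewrite EE_sum; apply: eq_bigr => e _.
by rewrite EEZ (IH (fun es => h (e :: es))).
Qed.

Lemma pick_mean M (F : E -> R) : pick M (fun es => \sum_(e <- es) F e) = M%:R * \sum_e mu e * F e.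
Proof.
elim: M => [|M IH] /=; first by rewrite big_nil mul0r.
rewrite (eq_bigr (fun e => mu e * F e + mu e * (M%:R * \sum_e mu e * F e))); last first.
  move=> e _; rewrite -mulrDr; congr (_ * _); rewrite -IH -[F e in RHS](pick_cst M) -pickD.
  by congr pick; apply/funext => es; rewrite big_cons.
by rewrite big_split/= -mulr_suml mu1 mul1r -natr1 mulrDl mul1r addrC.
Qed.

Fixpoint fresh X es : bool := if es is e :: es' then (e \notin X) && fresh (e :: X) es' else true.

Lemma pick_stale M X w : (forall e, mu e <= w) ->
  pick M (fun es => (~~ fresh X es)%:R) <= M%:R * (size X + M)%:R * w.
Proof.
move=> muw; have w0 : 0 <= w.
  have [e0 _|E0] := pickP (fun e : E => true); first by apply: le_trans (mu0 e0) (muw e0).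
  by have := mu1; rewrite big_pred0// => /esym/eqP; rewrite oner_eq0.
elim: M X => [|M IH] X; first by rewrite /= !mul0r.
apply: (@le_trans _ _ (\sum_e (mu e * (e \in X)%:R + mu e * (M%:R * ((size X).+1 + M)%:R * w)))).
  apply: ler_sum => e _; rewrite -mulrDr ler_wpM2l//.
  apply: (@le_trans _ _ (pick M (fun es => (e \in X)%:R + (~~ fresh (e :: X) es)%:R))).
    apply: pick_le => es _ _ /=; rewrite negb_and negbK -natrD ler_nat.
    by case: (e \in X); case: (fresh _ _).
  by rewrite pickD pick_cst lerD2l; apply: IH.
rewrite big_split/= -mulr_suml mu1 mul1r.
apply: (@le_trans _ _ ((size X)%:R * w + M%:R * ((size X).+1 + M)%:R * w)).
  rewrite lerD2r; apply: (@le_trans _ _ (\sum_e w * (e \in X)%:R)).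
    by apply: ler_sum => e _; rewrite ler_wpM2r ?ler0n.
  rewrite -mulr_sumr mulrC ler_wpM2r ?w0//.
  rewrite -natr_sum ler_nat; have -> : (\sum_(a : E) (a \in X) = #|mem X|)%N.
    by rewrite -sum1_card [RHS]big_mkcond; apply: eq_bigr => a _; case: (a \in X).
  exact: card_size.
rewrite -mulrDl ler_wpM2r ?w0// -!natrM -natrD ler_nat.
by rewrite addSnnS mulSn leq_add2r leq_addr.
Qed.

Definition tgt s e : 'I_n := s e.1 e.2.

Lemma batch_sum_tgt (xi : E -> 'I_n -> J -> R) es s j :
  batch_sum xi es (map (tgt s) es) j = \sum_(e <- es) xi e (tgt s e) j.
Proof. by elim: es => [|e es IH] /=; rewrite ?big_nil ?big_cons ?IH. Qed.

(** Convexity: the weighted sum over all edges is the expectation of a batch mean, so a sum over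
    very many edges is controlled by [M] of them. *)
Lemma pick_L1 M (xi : E -> 'I_n -> J -> R) s : (0 < M)%N ->
  \sum_j `|\sum_e mu e * xi e (tgt s e) j| <=
  pick M (fun es => M%:R^-1 * \sum_j `|batch_sum xi es (map (tgt s) es) j|).
Proof.
move=> M0; rewrite pickZ pick_sum mulr_sumr; apply: ler_sum => j _.
have M0' : 0 < M%:R :> R by rewrite ltr0n.
rewrite ler_pdivlMl// -{1}(ger0_norm (ltW M0')) -normrM -pick_mean.
apply: le_trans (pick_abs _ _) _; apply: pick_le => es _ _.
by rewrite batch_sum_tgt.
Qed.

Fixpoint extend es ys G :=
  if es is e :: es' then
    if ys is y :: ys' then extend es' ys' ((e, y) :: G) else G
  else G.

Lemma extend_dom es ys G : size ys = size es ->
  map fst (extend es ys G) =i es ++ map fst G.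
Proof.
elim: es ys G => [|e es IH] [|y ys] G //= [sz] z; rewrite IH//.
by rewrite !(inE, mem_cat) orbCA.
Qed.

Lemma extend_size es ys G : size ys = size es ->
  size (extend es ys G) = (size es + size G)%N.
Proof. by elim: es ys G => [|e es IH] [|y ys] G //= [sz]; rewrite IH//= addnS. Qed.

(** The batch is revealed edge by edge. Freshness allows [PG_cons] each time, and as at most [L]
    edges are ever revealed, each costs a factor at most [n / (n - L)] against a uniform target. *)
Lemma expose_batch L es G (h : seq 'I_n -> env n -> R) (b : seq 'I_n -> R) :
  (size es + size G <= L)%N -> (L < n)%N -> (forall ys s, 0 <= h ys s) ->
  (forall ys, 0 <= b ys) -> fresh (map fst G) es ->
  (forall ys, size ys = size es -> EE (fun s => (comp (extend es ys G) s)%:R * h ys s) <=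
    PG (extend es ys G) * b ys) ->
  EE (fun s => (comp G s)%:R * h (map (tgt s) es) s) <=
  PG G * ((n%:R / (n - L)%:R) ^+ size es * avl (size es) b).
Proof.
move=> + Ln; elim: es G h b => [|e es IH] G h b szL h0 b0 /=.
  by move=> _ /(_ [::] erefl) /=; rewrite expr0 mul1r.
move=> /andP[eG fr] hb.
have n0 : (0 < n)%N by exact: leq_ltn_trans (leq0n _) Ln.
rewrite (EE_split_target G e (fun y s => h (y :: map (tgt s) es) s)).
apply: (@le_trans _ _ (\sum_y PG ((e, y) :: G) *
   ((n%:R / (n - L)%:R) ^+ size es * avl (size es) (fun ys => b (y :: ys))))).
  apply: ler_sum => y _; apply: (IH ((e, y) :: G) (fun ys => h (y :: ys))) => //=.
    by rewrite addnS.
  by move=> ys sz; apply: (hb (y :: ys)); rewrite /= sz.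
have nL0 : 0 < (n - L)%:R :> R by rewrite ltr0n subn_gt0.
apply: (@le_trans _ _ (\sum_y (PG G / (n - L)%:R) *
   ((n%:R / (n - L)%:R) ^+ size es * avl (size es) (fun ys => b (y :: ys))))).
  apply: ler_sum => y _; apply: ler_wpM2r.
    by rewrite mulr_ge0 ?avl_ge0// exprn_ge0// divr_ge0 ?ler0n// ltW.
  rewrite ler_pdivlMr//; have := @PG_cons R n G e.1 e.2 y.
  rewrite -surjective_pairing => /(_ eG); apply: le_trans.
  rewrite ler_wpM2l ?PG_ge0// ler_nat.
  rewrite leq_sub2l//; apply: leq_trans (count_size _ _) _.
  by apply: leq_trans szL; rewrite leq_addl.
rewrite -!mulr_sumr exprS /avg; set c := _ ^+ size es; set A := \sum_y _.
have n0' : n%:R != 0 :> R by rewrite pnatr_eq0 -lt0n.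
move: nL0; set d : R := (n - L)%:R => d0.
by apply: eqle; field; rewrite n0' gt_eqF.
Qed.

End Batches.

Section Concentration.
Variables (R : realType) (n : nat).
Implicit Types (s t : env n) (G : seq ('I_n * 'I_n * 'I_n)).
Local Notation E := ('I_n * 'I_n)%type.
Implicit Types (e : E) (es X : seq E) (ys : seq 'I_n).
Local Notation EE := (@EE R n).
Local Notation PG := (@PG R n).
Variables (J : finType) (S : seq 'I_n) (f : E -> env n -> 'I_n -> J -> R) (mu : E -> R).
Variables (w lam K : R) (M L : nat).
Hypotheses (mu0 : forall e, 0 <= mu e) (mu1 : \sum_e mu e = 1).
Hypotheses (muS : forall e, mu e != 0 -> e.1 \in S) (muw : forall e, mu e <= w).
Hypotheses (fS : forall e y j, indep_of S (fun s => f e s y j)).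
Hypotheses (f1 : forall e s y, \sum_j `|f e s y j| <= 1).
Hypotheses (J0 : (0 < #|J|)%N) (M0 : (0 < M)%N) (lam0 : 0 < lam) (Ln : (L < n)%N).
Hypothesis K0 : 0 <= K.
Hypothesis ML : (n%:R / (n - L)%:R) ^+ M <= 2 :> R.

Definition fluct s : R := \sum_j `|\sum_e mu e * centered (f e s) (tgt s e) j|.

Let theta := lam + K / (lam * M%:R).

Let Phi es ys s : R :=
  M%:R^-1 * \sum_j `|batch_sum (fun e => centered (f e s)) es ys j|.

(** [g] stands for an event, read off the rows outside [S], on which the functions [f e] have small
    l2 norm. It is a general nonnegative function because the induction on moments multiplies it by
    batch fluctuations. *)
Definition tame (g : env n -> R) : Prop :=
  [/\ indep_of S g, forall s, 0 <= g s &
      forall s, g s != 0 -> forall e, mu e != 0 ->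
        #|J|%:R * avg (fun y => \sum_j f e s y j ^+ 2) <= K].

Let n0 : (0 < n)%N. Proof. exact: leq_ltn_trans (leq0n _) Ln. Qed.

Let Phi_ge0 es ys s : 0 <= Phi es ys s.
Proof. by rewrite mulr_ge0 ?invr_ge0 ?ler0n// sumr_ge0. Qed.

Let Phi_le2 es ys s : size es = M -> Phi es ys s <= 2.
Proof. by move=> szM; rewrite ler_pdivrMl ?ltr0n// -szM; exact: batch_sum_L1. Qed.

Let indep_Phi es ys : indep_of S (Phi es ys).
Proof.
move=> s t st; rewrite /Phi; congr (_ * _); apply: eq_bigr => j _; congr `|_|.
elim: es ys => [|e es IH] [|y ys] //=; rewrite IH; congr (_ + _).
rewrite /centered (fS _ _ _ st); congr (_ - _); apply: avg_ext => y'; exact: fS _ _ _ st.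
Qed.

Let avl_Phi es s : size es = M -> (forall e, e \in es -> mu e != 0) ->
  (forall e, mu e != 0 -> #|J|%:R * avg (fun y => \sum_j f e s y j ^+ 2) <= K) ->
  avl M (fun ys => Phi es ys s) <= theta.
Proof.
move=> sz es0 fK; rewrite -sz /Phi /theta -sz; apply: avl_L1 => //.
- by move=> e j _; exact: centered_mean.
- move=> e ees; apply: le_trans (fK e (es0 e ees)).
  by rewrite ler_wpM2l ?ler0n// centered_sqr.
- by rewrite sz.
Qed.

Let theta_ge0 : 0 <= theta.
Proof. by rewrite addr_ge0 ?(ltW lam0)// divr_ge0// mulr_ge0 ?(ltW lam0) ?ler0n. Qed.

Let fluct_ge0 s : 0 <= fluct s. Proof. exact: sumr_ge0. Qed.

Lemma fresh_notin X es Y : (forall e, e \in es -> e \in Y -> e \in X) ->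
  fresh X es -> fresh Y es.
Proof.
elim: es X Y => [|e es IH] X Y //= YX /andP[eX fr]; apply/andP; split.
  by apply: contra eX; apply: YX; rewrite inE eqxx.
apply: (IH (e :: X)) => // e' e'es; rewrite !inE => /predU1P[->|e'Y].
  by rewrite eqxx.
by rewrite YX ?orbT// inE e'es orbT.
Qed.

(** One factor [fluct] is replaced by a batch mean. A stale batch is unlikely and its mean is at
    most 2. A fresh batch is exposed: its targets join [G], and its fluctuation for fixed targets
    depends only on rows outside [S], so it is absorbed in [g] for the induction hypothesis. Each
    further moment thus costs a factor [B], although the factors are not independent. *)
Lemma fluct_moment A q G X g : {subset [seq u.1.1 | u <- G] <= S} ->
  (forall e, mu e != 0 -> e \in map fst G -> e \in X) ->
  (size X + q * M <= A)%N -> (size G + q * M <= L)%N -> tame g ->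
  EE (fun s => (comp G s)%:R * (g s * fluct s ^+ q)) <=
  (2 * (M%:R * A%:R * w) + 2 * theta) ^+ q * (PG G * EE g).
Proof.
have w0 : 0 <= w.
  have [e0 _|E0] := pickP (fun e : E => true); first by apply: le_trans (mu0 e0) (muw e0).
  by have := mu1; rewrite big_pred0// => /esym/eqP; rewrite oner_eq0.
elim: q G X g => [|q IH] G X g GS GX szX szG [gS g0 gK].
  rewrite expr0 mul1r -(EE_comp_indep GS gS); apply: EE_le => s.
  by rewrite expr0 mulr1.
set B := 2 * (M%:R * A%:R * w) + 2 * theta.
have B0 : 0 <= B by rewrite addr_ge0 ?mulr_ge0 ?ler0n.
have EEg0 : 0 <= EE g by exact: EE_ge0.
have PEB0 : 0 <= B ^+ q * (PG G * EE g) by rewrite mulr_ge0 ?exprn_ge0// mulr_ge0 ?PG_ge0.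
have szX' : (size X + q * M <= A)%N.
  by apply: leq_trans szX; rewrite leq_add2l mulSn leq_addl.
have szG' : (size G + q * M <= L)%N.
  by apply: leq_trans szG; rewrite leq_add2l mulSn leq_addl.
have h es : size es = M -> (forall e, e \in es -> mu e != 0) ->
  EE (fun s => (comp G s)%:R * (g s * fluct s ^+ q * Phi es (map (tgt s) es) s)) <=
  (2 * (~~ fresh X es)%:R + 2 * theta) * (B ^+ q * (PG G * EE g)).
  move=> sz es0; have [fr|_] := boolP (fresh X es); last first.
    rewrite mulr1; apply: (@le_trans _ _ (2 * (B ^+ q * (PG G * EE g)))); last first.
      by rewrite [leRHS]mulrDl lerDl mulr_ge0// mulr_ge0.
    apply: (@le_trans _ _ (2 * EE (fun s => (comp G s)%:R * (g s * fluct s ^+ q)))).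
      rewrite -EEZ; apply: EE_le => s; rewrite mulrA mulrC ler_wpM2r//.
        by rewrite mulr_ge0 ?ler0n// mulr_ge0 ?exprn_ge0.
      exact: Phi_le2.
    by rewrite ler_wpM2l//; apply: (IH G X).
  rewrite mulr0 add0r.
  have frG : fresh (map fst G) es.
    by apply: fresh_notin fr => e ees; apply: GX; apply: es0.
  apply: (@le_trans _ _ (EE (fun s => (comp G s)%:R * (g s * fluct s ^+ q *
     (if size (map (tgt s) es) == size es then Phi es (map (tgt s) es) s else 0))))).
    by apply: EE_le => s; rewrite size_map eqxx.
  apply: le_trans (@expose_batch R n L es G
    (fun ys s => g s * fluct s ^+ q * (if size ys == size es then Phi es ys s else 0))
    (fun ys => B ^+ q * EE (fun s => g s * (if size ys == size es then Phi es ys s else 0)))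
    _ _ _ _ _ _) _ => //.
  - by rewrite sz; move: szG; rewrite mulSn; lia.
  - by move=> ys s; rewrite mulr_ge0 ?mulr_ge0 ?exprn_ge0//; case: ifP.
  - move=> ys; rewrite mulr_ge0 ?exprn_ge0//; apply: EE_ge0 => s.
    by rewrite mulr_ge0//; case: ifP.
  - move=> ys szy; rewrite szy eqxx mulrCA.
    apply: le_trans (IH (extend es ys G) (es ++ X) (fun s => g s * Phi es ys s) _ _ _ _ _).
    + by apply: eqle; apply: EE_ext => s; rewrite mulrAC.
    + move=> z /mapP[t tG ->]; have : t.1 \in map fst (extend es ys G) by apply: map_f.
      rewrite extend_dom// mem_cat => /orP[/es0/muS//|/mapP[t' t'G ->]].
      by apply: GS; apply/mapP; exists t'.
    + move=> e me; rewrite extend_dom// !mem_cat => /orP[->//|eG].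
      by rewrite GX ?orbT.
    + by rewrite size_cat sz -addnA addnCA -mulSn.
    + by rewrite extend_size// sz -addnA addnCA -mulSn.
    split=> [||s gP e me].
    + by move=> s t st; rewrite (gS _ _ st) (indep_Phi _ _ st).
    + by move=> s; rewrite mulr_ge0.
    + by apply: gK => //; apply: contraNneq gP => ->; rewrite mul0r.
  rewrite sz avlZ [leRHS](_ : _ = PG G * (2 * (B ^+ q * (theta * EE g)))); last by ring.
  rewrite ler_wpM2l ?PG_ge0//; apply: ler_pM => //.
  - rewrite mulr_ge0 ?exprn_ge0//; apply: avl_ge0 => ys; apply: EE_ge0 => s.
    by rewrite mulr_ge0//; case: ifP.
  rewrite ler_wpM2l ?exprn_ge0//.
  have -> : avl M (fun ys => EE (fun s => g s * (if size ys == M then Phi es ys s else 0))) =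
    avl M (fun ys => EE (fun s => g s * Phi es ys s)).
    by apply: avl_ext => ys szy; rewrite szy eqxx.
  rewrite -(EE_avl M (fun ys s => g s * Phi es ys s)) -EEZ; apply: EE_le => s.
  rewrite avlZ mulrC; have [->|gs] := eqVneq (g s) 0; first by rewrite !mulr0.
  by rewrite ler_wpM2r//; apply: avl_Phi => //; exact: gK.
apply: (@le_trans _ _ (pick mu M (fun es => EE (fun s =>
   (comp G s)%:R * (g s * fluct s ^+ q * Phi es (map (tgt s) es) s))))).
  rewrite -(EE_pick mu M (fun es s => (comp G s)%:R * (g s * fluct s ^+ q *
     Phi es (map (tgt s) es) s))); apply: EE_le => s.
  rewrite pickZ; apply: ler_wpM2l; first exact: ler0n.
  rewrite pickZ exprSr [leLHS]mulrA; apply: ler_wpM2l.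
    by rewrite mulr_ge0 ?exprn_ge0.
  exact: (@pick_L1 R n J mu mu0 mu1 M (fun e => centered (f e s))).
apply: le_trans (pick_le mu0 (h' := fun es =>
   (2 * (~~ fresh X es)%:R + 2 * theta) * (B ^+ q * (PG G * EE g))) _) _.
  by move=> es sz es0; apply: h.
rewrite (_ : (fun es => _) = fun es => (B ^+ q * (PG G * EE g)) *
   (2 * (~~ fresh X es)%:R + 2 * theta)); last by apply/funext => es; rewrite mulrC.
rewrite pickZ pickD pickZ pick_cst// exprS mulrC -mulrA ler_wpM2r//.
rewrite lerD2r ler_wpM2l//; apply: le_trans (pick_stale mu0 mu1 _ _ muw) _.
rewrite ler_wpM2r// -!natrM ler_nat leq_mul2l; apply/orP; right.
by apply: leq_trans szX; rewrite leq_add2l mulSn leq_addr.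
Qed.

(** Markov's inequality for the moment of order [q]. As [mu] vanishes on the revealed edges, the
    moment bound starts with [X] empty: the size of the explored tree enters [L], but not the
    probability of a stale batch. *)
Lemma fluct_tail A q G g eps : {subset [seq u.1.1 | u <- G] <= S} ->
  (forall e, mu e != 0 -> e \notin map fst G) -> (q * M <= A)%N ->
  (size G + q * M <= L)%N -> tame g -> (forall s, g s <= 1) -> 0 < eps ->
  EE (fun s => (comp G s)%:R * (g s * (eps <= fluct s)%R%:R)) <=
  ((2 * (M%:R * A%:R * w) + 2 * theta) / eps) ^+ q * PG G.
Proof.
move=> GS Gmu szX szG tg g1 eps0; have [gS g0 gK] := tg.
have Gm e : mu e != 0 -> e \in map fst G -> e \in [::].
  by move=> /Gmu /negbTE ->.
have mom := @fluct_moment A q G [::] g GS Gm szX szG tg.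
set B := _ + _ in mom *.
apply: (@le_trans _ _ (eps ^- q * EE (fun s => (comp G s)%:R * (g s * fluct s ^+ q)))).
  rewrite -EEZ; apply: EE_le => s; rewrite [leRHS]mulrCA ler_wpM2l ?ler0n//.
  rewrite [leRHS]mulrCA ler_wpM2l//.
  case: (boolP (eps <= fluct s)) => ef /=; last first.
    by rewrite mulr_ge0 ?exprn_ge0// invr_ge0 exprn_ge0// ltW.
  by rewrite mulrC ler_pdivlMr ?exprn_gt0// mul1r; apply: lerXn2r; rewrite ?nnegrE// ltW.
apply: (@le_trans _ _ (eps ^- q * (B ^+ q * (PG G * EE g)))).
  by rewrite ler_wpM2l ?invr_ge0 ?exprn_ge0// ltW.
have w0 : 0 <= w.
  have [e0 _|E0] := pickP (fun e : E => true); first by apply: le_trans (mu0 e0) (muw e0).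
  by have := mu1; rewrite big_pred0// => /esym/eqP; rewrite oner_eq0.
have B0 : 0 <= B by rewrite addr_ge0 ?mulr_ge0 ?ler0n.
rewrite expr_div_n [leRHS]mulrAC [leRHS]mulrC; apply: ler_wpM2l.
  by rewrite invr_ge0 exprn_ge0// ltW.
apply: ler_wpM2l; first exact: exprn_ge0.
by rewrite ler_piMr ?PG_ge0//; apply: EE_le_cst.
Qed.

End Concentration.

(** * The averaged kernel hardly changes from one time to the next *)

Section Flatness.
Variables (R : realType) (n : nat) (p : 'M[R]_n).
Hypotheses (p0 : forall i j, 0 <= p i j) (p1 : forall i, \sum_j p i j = 1).
Implicit Types (s t : env n) (S : seq 'I_n).
Local Notation E := ('I_n * 'I_n)%type.
Implicit Types (e : E) (es : seq E) (ys : seq 'I_n).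
Local Notation EE := (@EE R n).
Local Notation hit := (hit p).
Variables (theta lam : R) (l u M : nat).
Hypotheses (n1 : (1 < n)%N) (theta0 : 0 <= theta) (lam0 : 0 < lam) (M0 : (0 < M)%N).
Hypotheses (Mn : (M < n)%N) (Mfact : (n%:R / (n - M)%:R) ^+ M <= 2 :> R).

Local Notation kr S s := (ker p theta l S u s).
Let T := (u + l)%N.
Let n0 : (0 < n)%N. Proof. exact: ltnW. Qed.

Let Phi S es ys s : R :=
  M%:R^-1 * \sum_j `|batch_sum (fun _ : E => centered (kr S s)) es ys j|.

Lemma ker_L1 S s y : \sum_j `|kr S s y j| <= 1.
Proof.
rewrite (eq_bigr (kr S s y)); last by move=> j _; rewrite ger0_norm ?ker_ge0.
exact: ker_sum_le1.
Qed.

Let indep_Phi S es ys : indep_of S (Phi S es ys).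
Proof.
move=> s t st; rewrite /Phi; congr (_ * _); apply: eq_bigr => j _; congr `|_|.
elim: es ys => [|e es IH] [|y ys] //=; rewrite IH; congr (_ + _).
rewrite /centered (indep_ker _ _ _ _ _ _ st); congr (_ - _); apply: avg_ext => y'.
exact: indep_ker st.
Qed.

Let gap_ker S s y : \sum_j `|kr [::] s y j - kr S s y j| <= hit S T s y.
Proof.
rewrite (eq_bigr (fun j => kr [::] s y j - kr S s y j)); last first.
  by move=> j _; rewrite ger0_norm// subr_ge0 ker_mono.
by rewrite sumrB lerBlDl ker_hit.
Qed.

Let gap_centered S s y :
  \sum_j `|centered (kr [::] s) y j - centered (kr S s) y j| <=
  hit S T s y + avg (hit S T s).
Proof.
apply: (@le_trans _ _ (\sum_j (`|kr [::] s y j - kr S s y j| +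
   avg (fun z => `|kr [::] s z j - kr S s z j|)))).
  apply: ler_sum => j _.
  have -> : centered (kr [::] s) y j - centered (kr S s) y j =
    kr [::] s y j - kr S s y j - avg (fun z => kr [::] s z j - kr S s z j).
    by rewrite avgB /centered; ring.
  apply: le_trans (ler_normB _ _) _; rewrite lerD2l /avg normrM.
  by rewrite ger0_norm ?invr_ge0 ?ler0n// ler_wpM2l ?invr_ge0 ?ler0n// ler_norm_sum.
rewrite big_split/= -avg_sum; apply: lerD; first exact: gap_ker.
by apply: avg_le => z; exact: gap_ker.
Qed.

Let gap_batch S es ys s : size ys = size es ->
  \sum_j `|batch_sum (fun _ : E => centered (kr [::] s)) es ys j -
           batch_sum (fun _ : E => centered (kr S s)) es ys j| <=
  \sum_(y <- ys) hit S T s y + (size es)%:R * avg (hit S T s).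
Proof.
elim: es ys => [|e es IH] ys.
  by case: ys => //= _; rewrite big_nil mul0r addr0 big1// => j _; rewrite subrr normr0.
case: ys => [//|y ys] /= [sz]; rewrite big_cons -natr1.
apply: (@le_trans _ _ (\sum_j (`|centered (kr [::] s) y j - centered (kr S s) y j| +
  `|batch_sum (fun _ : E => centered (kr [::] s)) es ys j -
    batch_sum (fun _ : E => centered (kr S s)) es ys j|))).
  by apply: ler_sum => j _; rewrite opprD addrACA; exact: ler_normD.
rewrite big_split/= mulrDl mul1r addrACA [X in _ <= X + _]addrC [leLHS]addrC.
by have := gap_centered S s y; have := IH ys sz; lra.
Qed.

Let Phi_gap S es ys s : size ys = size es -> size es = M ->
  Phi [::] es ys s <= Phi S es ys s +
    (M%:R^-1 * (\sum_(y <- ys) hit S T s y) + avg (hit S T s)).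
Proof.
move=> sz szM; have M0' : 0 < M%:R :> R by rewrite ltr0n.
have M0n : M%:R != 0 :> R by rewrite gt_eqF.
rewrite -[X in _ <= _ + (_ + X)](mulKf M0n) -!mulrDr.
rewrite ler_wpM2l ?invr_ge0 ?(ltW M0')// -szM.
apply: le_trans (lerD (lexx _) (gap_batch S s sz)).
rewrite -big_split/=; apply: ler_sum => j _.
by rewrite -lerBlDl; apply: le_trans (lerB_dist _ _).
Qed.

(** Law of the first edge read from a uniform vertex; it makes one more initial step a weighted sum
    over edges, as in [pick_L1]. *)
Let mu (e : E) : R := p e.1 e.2 / n%:R.

Let mu0 e : 0 <= mu e. Proof. by rewrite divr_ge0 ?ler0n. Qed.

Let sum_mu (F : E -> R) : \sum_e mu e * F e = avg (fun k => \sum_i p k i * F (k, i)).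
Proof.
transitivity (\sum_k \sum_i mu (k, i) * F (k, i)).
  by rewrite pair_bigA; apply: eq_bigr => -[k i] _.
rewrite /avg mulr_sumr.
apply: eq_bigr => k _; rewrite mulr_sumr; apply: eq_bigr => i _.
by rewrite /mu/=; ring.
Qed.

Let mu1 : \sum_e mu e = 1.
Proof.
transitivity (\sum_e mu e * 1); first by apply: eq_bigr => e _; rewrite mulr1.
rewrite sum_mu (avg_ext (g := fun _ => 1)) ?avg_cst// => k.
by rewrite -[RHS](p1 k); apply: eq_bigr => i _; rewrite mulr1.
Qed.

Let muw e : mu e <= n%:R^-1.
Proof.
rewrite /mu ler_piMl ?invr_ge0 ?ler0n//.
by rewrite -(p1 e.1) (bigD1 e.2)//= lerDl sumr_ge0.
Qed.

Let Q : R := n%:R * theta + 14 * T.+2%:R ^+ 3.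

Let EE_K : EE (fun s => #|'I_n|%:R * avg (fun y => \sum_j kr [::] s y j ^+ 2)) <= Q.
Proof.
rewrite card_ord EEZ (EE_avg (fun y s => \sum_j kr [::] s y j ^+ 2)).
have n0' : 0 < n%:R :> R by rewrite ltr0n.
apply: (@le_trans _ _ (n%:R * avg (fun _ : 'I_n => theta + 14 * T.+2%:R ^+ 3 / n%:R))).
  rewrite ler_wpM2l ?ler0n//; apply: avg_le => y.
  apply: (@le_trans _ _ (EE (fun s => theta + remeet p [::] T s y))).
    by apply: EE_le => s; apply: ker_remeet.
  by rewrite EED EE_cst lerD2l; apply: EE_remeet.
rewrite avg_cst// mulrDr mulrCA mulfV ?gt_eqF// mulr1.
exact: lexx.
Qed.

Let avl_Phi S es s : size es = M ->
  avl M (fun ys => Phi S es ys s) <=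
  lam + #|'I_n|%:R * avg (fun y => \sum_j kr [::] s y j ^+ 2) / (lam * M%:R).
Proof.
move=> sz; rewrite -sz /Phi -sz; apply: avl_L1 => //.
- by rewrite card_ord.
- by move=> e j _; exact: centered_mean.
- move=> e _; rewrite ler_wpM2l ?ler0n//; apply: le_trans (centered_sqr _ _) _ => //.
  apply: avg_le => y; apply: ler_sum => j _; apply: lerXn2r; rewrite ?nnegrE ?ker_ge0//.
  exact: ker_mono.
- by rewrite sz.
Qed.

Let h_ S es ys s : R := Phi S es ys s +
  (M%:R^-1 * (\sum_(y <- ys) hit S T s y) + avg (hit S T s)).

Let Phi_ge0 S es ys s : 0 <= Phi S es ys s.
Proof. by rewrite mulr_ge0 ?invr_ge0 ?ler0n// sumr_ge0. Qed.

Let h_ge0 S es ys s : 0 <= h_ S es ys s.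
Proof.
rewrite addr_ge0 ?Phi_ge0// addr_ge0//; last by apply: avg_ge0 => y; apply: hit_ge0.
by rewrite mulr_ge0 ?invr_ge0 ?ler0n// sumr_ge0// => y _; apply: hit_ge0.
Qed.

Let avl_hit k S s : avl k (fun ys => \sum_(y <- ys) hit S T s y) = k%:R * avg (hit S T s).
Proof.
elim: k => [|k IH] /=; first by rewrite big_nil mul0r.
rewrite (avg_ext (g := fun y => hit S T s y + k%:R * avg (hit S T s))).
  by rewrite avgD avg_cst// -natr1 mulrDl mul1r addrC.
move=> y; rewrite -IH -[X in _ = X + _](avl_cst k _ n0) -avlD.
by apply: avl_ext => ys _; rewrite big_cons.
Qed.

Let hit_bound : R := T.+1%:R * (M + T)%:R / n%:R.

Let EE_hit S : (size S <= M)%N -> avg (fun a => EE (fun s => hit S T s a)) <= hit_bound.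
Proof.
move=> SM; apply: le_trans (EE_avg_hit p0 p1 S T n0) _.
rewrite ler_wpM2r ?invr_ge0 ?ler0n// ler_wpM2l ?ler0n// ler_nat.
by rewrite leq_add2r.
Qed.

(** No tree is given here: the kernels are made independent of the exposed rows by avoiding the
    sources of the batch itself, at the cost of hitting probabilities. *)
Let EE_fresh es : size es = M -> fresh [::] es ->
  EE (fun s => Phi [::] es (map (tgt s) es) s) <=
  2 * (lam + Q / (lam * M%:R) + 2 * hit_bound).
Proof.
move=> sz fr; pose S := map fst es.
apply: (@le_trans _ _ (EE (fun s => (comp [::] s)%:R * h_ S es (map (tgt s) es) s))).
  by apply: EE_le => s; rewrite mul1r; apply: Phi_gap; rewrite ?size_map.
apply: le_trans (@expose_batch R n M es [::] (fun ys s => h_ S es ys s)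
  (fun ys => EE (h_ S es ys)) _ _ _ _ _ _) _ => //.
- by rewrite sz addn0.
- by move=> ys; exact: EE_ge0.
- move=> ys szy; rewrite (@EE_comp_indep R n S)//.
    move=> z /mapP[t tG ->]; have : t.1 \in map fst (extend es ys [::]) by apply: map_f.
    by rewrite extend_dom//= cats0 => h; apply: map_f.
  move=> s t st; rewrite /h_ (indep_Phi _ _ st); congr (_ + (_ * _ + _)).
    by apply: eq_bigr => y _; apply: indep_hit st.
  by apply: avg_ext => y; apply: indep_hit st.
rewrite PG_nil mul1r sz; apply: ler_pM => //.
  by apply: avl_ge0 => ys; apply: EE_ge0.
rewrite -(EE_avl M (fun ys s => h_ S es ys s)).
apply: (@le_trans _ _ (EE (fun s => (lam + (lam * M%:R)^-1 *
  (#|'I_n|%:R * avg (fun y => \sum_j kr [::] s y j ^+ 2))) + 2 * avg (hit S T s)))).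
  apply: EE_le => s; rewrite /h_ avlD; apply: lerD.
    by rewrite [X in _ + X]mulrC; exact: avl_Phi.
  rewrite avlD avl_cst// avlZ avl_hit mulKf ?pnatr_eq0 -?lt0n//.
  by rewrite mulrDl mul1r.
rewrite !EED EE_cst (EEZ (lam * M%:R)^-1) (EEZ 2).
rewrite -!addrA lerD2l; apply: lerD.
  rewrite [leRHS]mulrC ler_wpM2l//.
  by rewrite invr_ge0 mulr_ge0 ?ler0n// ltW.
rewrite ler_wpM2l// (EE_avg (fun y s => hit S T s y)) EE_hit//.
by rewrite size_map sz.
Qed.

Definition flat_bound : R :=
  2 * (lam + Q / (lam * M%:R) + 2 * hit_bound) + 2 * (M%:R * M%:R / n%:R).

(** Prepending a step from a uniform vertex gives the average over a uniform target plus a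
    fluctuation, which a first moment over one batch controls. Summed over times, this compares
    exits at different depths with the same target. *)
Lemma EE_flat :
  EE (fun s => \sum_j `|avg (fun y => ker p theta l [::] u.+1 s y j) -
                       avg (fun y => kr [::] s y j)|) <= flat_bound.
Proof.
apply: (@le_trans _ _ (EE (fun s => pick mu M (fun es => Phi [::] es (map (tgt s) es) s)))).
  apply: EE_le => s.
  apply: le_trans (@pick_L1 R n _ mu mu0 mu1 M (fun _ => centered (kr [::] s)) s M0).
  apply: ler_sum => j _; rewrite le_eqVlt; apply/orP; left; apply/eqP; congr `|_|.
  rewrite sum_mu -[avg (fun y => kr [::] s y j) in LHS](avg_cst _ n0) -avgB.
  apply: avg_ext => y; rewrite /ker lawS/= /centered /tgt/=.
  under [in RHS]eq_bigr do rewrite mulrBr.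
  by rewrite sumrB -[X in _ = _ - X]mulr_suml p1 mul1r.
rewrite (EE_pick mu M (fun es s => Phi [::] es (map (tgt s) es) s)).
apply: le_trans (pick_le mu0 (h' := fun es =>
   2 * (lam + Q / (lam * M%:R) + 2 * hit_bound) + 2 * (~~ fresh [::] es)%:R) _) _.
  move=> es sz _; have [fr|_] := boolP (fresh [::] es); first by rewrite mulr0 addr0 EE_fresh.
  rewrite mulr1 ler_wpDl//.
    rewrite mulr_ge0// !addr_ge0 ?(ltW lam0)//.
      rewrite divr_ge0//; last by rewrite mulr_ge0 ?ler0n// ltW.
      by rewrite addr_ge0 ?mulr_ge0 ?ler0n// exprn_ge0.
    by rewrite mulr_ge0// divr_ge0// mulr_ge0.
  apply: EE_le_cst => s; rewrite ler_pdivrMl ?ltr0n// -sz; apply: batch_sum_L1 => // _ y.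
  exact: ker_L1.
rewrite pickD pick_cst// pickZ lerD2l ler_wpM2l//.
by apply: le_trans (pick_stale mu0 mu1 _ _ muw) _; rewrite add0n.
Qed.

End Flatness.

(** * Best-first exploration *)

Section Exploration.
Variables (R : realType) (n : nat) (p : 'M[R]_n).
Hypotheses (p0 : forall i j, 0 <= p i j) (p1 : forall i, \sum_j p i j = 1).
Implicit Types (s t : env n).
Local Notation E := ('I_n * 'I_n)%type.
Implicit Types (e : E) (x y : 'I_n) (u : E * 'I_n).
Local Notation EE := (@EE R n).
Local Notation PG := (@PG R n).

(* The graph explored so far: revealed edges with their targets, discovered
   vertices with the weight and depth of their tree path, and those revealed
   edges which led to an already discovered vertex. *)
Record state := State {
  revealed : seq (E * 'I_n);
  disc : seq 'I_n;
  weight : 'I_n -> R;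
  depth : 'I_n -> nat;
  collisions : seq (E * 'I_n) }.
Implicit Types st : state.

Definition start i : state := State [::] [:: i] (fun=> 1) (fun=> 0%N) [::].

Definition eweight st e : R := weight st e.1 * p e.1 e.2.

Definition exits st : pred E :=
  fun e => (e.1 \in disc st) && (e \notin map fst (revealed st)).

Definition update st e y : state :=
  if y \in disc st then
    State ((e, y) :: revealed st) (disc st) (weight st) (depth st)
      ((e, y) :: collisions st)
  else
    State ((e, y) :: revealed st) (y :: disc st)
      (fun z => if z == y then eweight st e else weight st z)
      (fun z => if z == y then (depth st e.1).+1 else depth st z) (collisions st).

Variable omega : R.

(* Best first: weights of discovered vertices decrease in order of discovery. *)
Definition next st : option E :=
  [pick e | [&& exits st e, omega <= eweight st e &
    [forall e', exits st e' ==> (eweight st e' <= eweight st e)]]].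

Fixpoint run k s st : state :=
  if k is k'.+1 then
    if next st is Some e then run k' s (update st e (tgt s e)) else st
  else st.

Lemma next_some st e : next st = Some e ->
  [/\ exits st e, omega <= eweight st e &
      forall e', exits st e' -> eweight st e' <= eweight st e].
Proof.
rewrite /next; case: pickP => // e0 /and3P[ex om /forallP mx] [<-].
by split=> // e' ex'; have := mx e'; rewrite ex'.
Qed.

Lemma next_none st e : next st = None -> exits st e -> eweight st e < omega.
Proof.
rewrite /next; case: pickP => // no _ ex; rewrite ltNge; apply/negP => om.
case: (arg_maxP (eweight st) ex) => e1 ex1 mx1.
have := no e1; rewrite ex1 (le_trans om (mx1 _ ex))/= => /forallP; apply => e'.
by apply/implyP; exact: mx1.
Qed.

Lemma revealed_update st e y : revealed (update st e y) = (e, y) :: revealed st.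
Proof. by rewrite /update; case: ifP. Qed.

(** Best-first search is expressed by [v_ord]: no exit outweighs a discovered vertex. It yields
    [v_clw] at the moment of a collision. By [v_size], each revealed edge either discovers a vertex
    or is a collision. *)
Record valid st : Prop := Valid {
  v_disc : uniq (disc st);
  v_src : forall u, u \in revealed st -> u.1.1 \in disc st;
  v_uniq : uniq (map fst (revealed st));
  v_om : forall u, u \in revealed st -> omega <= eweight st u.1;
  v_wt : forall x, x \in disc st -> 0 < weight st x <= 1;
  v_ord : forall y e, y \in disc st -> exits st e -> eweight st e <= weight st y;
  v_size : (size (disc st) + size (collisions st))%N = (size (revealed st)).+1;
  v_cl : {subset collisions st <= revealed st};
  v_clw : forall u, u \in collisions st -> u.2 \in disc st /\ eweight st u.1 <= weight st u.2 }.

Lemma valid_start i : valid (start i).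
Proof.
split=> //.
- by move=> x _; rewrite ltr01 lexx.
- move=> y e _ _; rewrite /eweight /= mul1r -(p1 e.1) (bigD1 e.2)//= lerDl sumr_ge0//.
Qed.

Hypothesis om0 : 0 < omega.

Lemma p_le1 x k : p x k <= 1.
Proof. by rewrite -(p1 x) (bigD1 k)//= lerDl sumr_ge0. Qed.

Lemma valid_update st e y : valid st -> next st = Some e -> valid (update st e y).
Proof.
move=> v /next_some[/andP[ed er] oe mx]; case: v => vd vs vu vo vw vr vz vc vl.
have ewle x k : x \in disc st -> weight st x * p x k <= weight st x.
  by move=> /vw /andP[w0 _]; rewrite ler_piMr ?p_le1// ltW.
have exD e' : exits (update st e y) e' -> e'.1 \in disc st -> exits st e'.
  rewrite /exits revealed_update /= inE negb_or => /and3P[_ _ ->] ->.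
  by [].
rewrite /update; case: ifPn => yd.
  split=> //=.
  - by move=> u; rewrite inE => /predU1P[->//|]; apply: vs.
  - by rewrite er.
  - by move=> u; rewrite inE => /predU1P[->//|]; apply: vo.
  - move=> z e' zd /andP[/= e'd]; rewrite inE negb_or => /andP[_ e'r].
    by apply: vr => //; apply/andP.
  - by rewrite addnS vz.
  - by move=> u; rewrite !inE => /predU1P[->|/vc ->]; rewrite ?eqxx ?orbT.
  - move=> u; rewrite inE => /predU1P[->|/vl//]; split=> //=.
    by apply: vr => //; apply/andP.
have wE x : x \in disc st -> (x == y) = false.
  by move=> xd; apply: contraNF yd => /eqP <-.
have ewE e' : e'.1 \in disc st ->
    (if e'.1 == y then eweight st e else weight st e'.1) * p e'.1 e'.2 = eweight st e'.
  by move=> /wE ->.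
split=> //=.
- by rewrite yd.
- move=> u; rewrite !inE => /predU1P[->/=|/vs ->]; rewrite ?ed orbT//.
- by rewrite er.
- move=> u; rewrite inE => /predU1P[->|ur]; rewrite /eweight/= ewE ?vs//.
  exact: vo.
- move=> x; rewrite inE => /predU1P[->|xd]; last by rewrite wE// vw.
  rewrite eqxx (lt_le_trans om0 oe)/=.
  by apply: le_trans (ewle _ _ ed) _; case/andP: (vw _ ed).
- move=> z e' zd /andP[/= e'd]; rewrite inE negb_or => /andP[e'e e'r].
  have le_e : eweight st e' <= eweight st e \/ e'.1 == y.
    move: e'd; rewrite inE => /orP[->|e'd]; first by right.
    by left; apply: mx; apply/andP.
  have lez : eweight st e <= (if z == y then eweight st e else weight st z).
    case: eqP => // /eqP zy; move: zd; rewrite inE (negbTE zy)/= => zd.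
    by apply: vr => //; apply/andP.
  rewrite /eweight/=; apply: le_trans lez; case: eqP => [_|/eqP e'y].
    rewrite ler_piMr ?p_le1//; exact: le_trans (ltW om0) oe.
  by case: le_e => //; rewrite (negbTE e'y).
- by rewrite addSn vz.
- by move=> u /vc; rewrite inE orbC => ->.
- move=> u ucl; have [u2 ul] := vl _ ucl; rewrite inE u2 orbT; split=> //.
  by rewrite /eweight/= ewE ?(vs _ (vc _ ucl))// wE.
Qed.

Lemma valid_run k s st : valid st -> valid (run k s st).
Proof.
elim: k st => [|k IH] st v //=; case e : next => [e'|] //.
by apply: IH; apply: valid_update.
Qed.

Lemma size_run k s st : (size (revealed (run k s st)) <= size (revealed st) + k)%N.
Proof.
elim: k st => [|k IH] st /=; first by rewrite addn0.
case: next => [e|]; last exact: leq_addr.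
by apply: leq_trans (IH _) _; rewrite revealed_update /= addSnnS.
Qed.

Lemma run_done k s st : next (run k s st) <> None ->
  size (revealed (run k s st)) = (size (revealed st) + k)%N.
Proof.
elim: k st => [|k IH] st /=; first by rewrite addn0.
case ne : (next st) => [e|]; last by rewrite ne.
by move=> /IH ->; rewrite revealed_update /= addSnnS.
Qed.

(** A strong Markov property: a bound valid from every state passes to the state in which the run
    stops, since the events of the possible updates partition the current one. *)
Lemma run_mono (B : state -> env n -> R) b k st :
  (forall st, valid st -> EE (fun s => (comp (revealed st) s)%:R * B st s) <=
     b * PG (revealed st)) ->
  valid st ->
  EE (fun s => (comp (revealed st) s)%:R * B (run k s st) s) <= b * PG (revealed st).
Proof.
move=> hB; elim: k st => [|k IH] st v /=; first exact: hB.
case ne : (next st) => [e|]; last exact: hB.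
rewrite (EE_split_target (revealed st) e (fun y s => B (run k s (update st e y)) s)).
have -> : PG (revealed st) = \sum_y PG (revealed (update st e y)).
  transitivity (EE (fun s => (comp (revealed st) s)%:R * 1)).
    by apply: EE_ext => s; rewrite mulr1.
  rewrite (EE_split_target (revealed st) e (fun _ _ => 1)); apply: eq_bigr => y _.
  by apply: EE_ext => s; rewrite mulr1 revealed_update.
rewrite mulr_sumr; apply: ler_sum => y _; rewrite -revealed_update; apply: IH.
exact: valid_update.
Qed.

(** Each revealed edge falls into the discovered set with conditional probability at most [rho].
    With [r = k * rho], the induction closes because [rho * r ^+ c + r ^+ c.+1] is at most
    [(k.+1 * rho) ^+ c.+1]. *)
Lemma run_collisions N k st c : (N < n)%N -> valid st ->
  (size (revealed st) + k <= N)%N ->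
  EE (fun s => (comp (revealed st) s)%:R *
    (size (collisions st) + c <= size (collisions (run k s st)))%N%:R) <=
  PG (revealed st) * (k%:R * (N.+1%:R / (n - N)%:R)) ^+ c.
Proof.
move=> Nn; set rho : R := _ / _; have rho0 : 0 <= rho by rewrite divr_ge0 ?ler0n.
have nN0 : 0 < (n - N)%:R :> R by rewrite ltr0n subn_gt0.
have base st' c' r : 0 <= r -> EE (fun s => (comp (revealed st') s)%:R *
    (size (collisions st') + c' <= size (collisions st'))%N%:R) <= PG (revealed st') * r ^+ c'.
  case: c' => [|c'] r0.
    rewrite expr0 mulr1; apply: EE_le => s; rewrite addn0 leqnn mulr1.
    exact: lexx.
  apply: le_trans (_ : 0 <= _); last by rewrite mulr_ge0 ?PG_ge0 ?exprn_ge0.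
  by apply: EE_le_cst => s; rewrite addnS ltnNge leq_addr mulr0.
elim: k st c => [|k IH] st c v sz; first by apply: base; rewrite mul0r.
rewrite /=; case ne : (next st) => [e|]; last by apply: base; rewrite mulr_ge0 ?ler0n.
case: c => [|c].
  rewrite expr0 mulr1; apply: EE_le => s; rewrite ler_piMr ?ler0n//.
  by rewrite lern1 leq_b1.
have [/andP[ed er] oe mx] := next_some ne.
have PGE : PG (revealed st) = \sum_y PG ((e, y) :: revealed st).
  transitivity (EE (fun s => (comp (revealed st) s)%:R * 1)).
    by apply: EE_ext => s; rewrite mulr1.
  rewrite (EE_split_target (revealed st) e (fun _ _ => 1)); apply: eq_bigr => y _.
  by apply: EE_ext => s; rewrite mulr1.
have PGle y : PG ((e, y) :: revealed st) <= PG (revealed st) / (n - N)%:R.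
  rewrite ler_pdivlMr//; have := @PG_cons R n (revealed st) e.1 e.2 y.
  rewrite -surjective_pairing => /(_ er); apply: le_trans.
  rewrite ler_wpM2l ?PG_ge0// ler_nat leq_sub2l//; apply: leq_trans (count_size _ _) _.
  by apply: leq_trans sz; rewrite leq_addr.
rewrite (EE_split_target (revealed st) e (fun y s =>
  (size (collisions st) + c.+1 <= size (collisions (run k s (update st e y))))%N%:R)).
pose r := k%:R * rho; have r0 : 0 <= r by rewrite mulr_ge0 ?ler0n.
apply: (@le_trans _ _ (\sum_y ((y \in disc st)%:R * (PG (revealed st) / (n - N)%:R * r ^+ c) +
    PG ((e, y) :: revealed st) * r ^+ c.+1))).
  apply: ler_sum => y _.
  have sz' : (size (revealed (update st e y)) + k <= N)%N.
    by rewrite revealed_update /= addSnnS.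
  have := IH (update st e y) _ (valid_update y v ne) sz'; rewrite revealed_update => IH'.
  case: (boolP (y \in disc st)) => yd.
    have rest0 : 0 <= PG ((e, y) :: revealed st) * r ^+ c.+1.
      by apply: mulr_ge0; [exact: PG_ge0|exact: exprn_ge0].
    rewrite mul1r ler_wpDr//.
    apply: (@le_trans _ _ (PG ((e, y) :: revealed st) * r ^+ c)); last first.
      by rewrite ler_wpM2r ?exprn_ge0.
    apply: le_trans (IH' c); apply: EE_le => s.
    by rewrite /update yd /= addnS addSn.
  rewrite mul0r add0r; apply: le_trans (IH' c.+1); apply: EE_le => s.
  by rewrite {2}/update (negbTE yd).
rewrite big_split/= -[X in _ + X]mulr_suml -PGE -[X in X + _]mulr_suml.
apply: (@le_trans _ _ (N.+1%:R * (PG (revealed st) / (n - N)%:R * r ^+ c) +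
   PG (revealed st) * r ^+ c.+1)).
  rewrite lerD2r ler_wpM2r//.
    by rewrite mulr_ge0 ?exprn_ge0// mulr_ge0 ?PG_ge0// invr_ge0 ltW.
  apply: le_trans (sum_in_seq_le _ _) _; rewrite ler_nat.
  have := v_size v; have : (size (revealed st) <= N)%N.
    by apply: leq_trans sz; rewrite leq_addr.
  by move=> ? ?; lia.
rewrite [leLHS](_ : _ = PG (revealed st) * ((k.+1%:R * rho) * r ^+ c)); last first.
  by rewrite exprS /r /rho -[k.+1%:R]natr1; ring.
rewrite exprS ler_wpM2l ?PG_ge0// ler_wpM2l ?mulr_ge0 ?ler0n//.
by rewrite lerXn2r ?nnegrE ?mulr_ge0 ?ler0n// ler_wpM2r// ler_nat.
Qed.

End Exploration.

(** * Tree paths, decomposition of the mass, and the weight of a collision *)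

Section ExploredTree.
Variables (R : realType) (n : nat) (p : 'M[R]_n).
Hypotheses (p0 : forall i j, 0 <= p i j) (p1 : forall i, \sum_j p i j = 1).
Local Notation E := ('I_n * 'I_n)%type.
Implicit Types (e : E) (x y : 'I_n) (u : E * 'I_n) (es : seq E).
Implicit Types st : state R n.
Local Notation eweight := (eweight p).
Variables (omega : R) (s : env n) (i : 'I_n).
Hypothesis om0 : 0 < omega.
Hypothesis om1 : omega <= 1.
Local Notation valid := (valid p omega).
Local Notation next := (next p omega).
Local Notation run := (run p omega).
Local Notation update := (update p).

(** That [y] is not a source on its own path and that tree edges are not collisions are the two
    facts contradicted in [collision_light]. *)
Definition tree_path st y es : Prop :=
  [/\ pathto s i es y, uniq (map fst es), y \notin map fst es,
      {subset map fst es <= disc st} &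
      [/\ size es = depth st y, wprod p es = weight st y &
          forall e, e \in es -> (e, tgt s e) \in revealed st /\ (e, tgt s e) \notin collisions st]].

Record traced st : Prop := Traced {
  t_valid : valid st;
  t_comp : comp (revealed st) s;
  t_om : forall y, y \in disc st -> omega <= weight st y;
  t_path : forall y, y \in disc st -> exists es, tree_path st y es }.

Lemma traced_start : traced (start R i).
Proof.
split=> //; first exact: valid_start.
move=> y; rewrite inE => /eqP ->; exists [::]; split=> //=.
by split=> //; rewrite /wprod big_nil.
Qed.

Lemma wprod_rcons es e : wprod p (rcons es e) = wprod p es * p e.1 e.2.
Proof. by rewrite /wprod -cats1 big_cat/= big_seq1. Qed.

Lemma traced_update st e : traced st -> next st = Some e -> traced (update st e (tgt s e)).
Proof.
move=> [v c om tp] ne; have v' := valid_update p0 p1 om0 (tgt s e) v ne.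
have [/andP[ed er] oe mx] := next_some ne.
have old y es : y \in disc st -> tree_path st y es -> tree_path (update st e (tgt s e)) y es.
  move=> yd [pe ue ye sub [sz wp rc]].
  have rc' e0 : e0 \in es -> (e0, tgt s e0) \in (e, tgt s e) :: revealed st /\
      (e0, tgt s e0) \notin (e, tgt s e) :: collisions st.
    move=> /rc[h1 h2]; rewrite !inE h1 orbT; split=> //; rewrite negb_or h2 andbT.
    apply: contra er => /eqP[<- _]; apply/mapP; by exists (e0, tgt s e0).
  rewrite /update; case: ifPn => td; first by split.
  have yt : (y == tgt s e) = false by apply: contraNF td => /eqP <-.
  split=> //=; first by move=> z zs; rewrite inE sub ?orbT.
  rewrite yt; split=> // e0 /[dup] /rc[h1 h2] /rc'[h3 _].
  by split.
split=> //.
- by rewrite revealed_update /= eqxx.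
- move=> y; rewrite /update; case: ifPn => td /=; first exact: om.
  by rewrite inE => /predU1P[->|yd]; [rewrite eqxx|case: eqP => // _; exact: om].
move=> y; have [td|td] := boolP (tgt s e \in disc st).
  rewrite /update td /= => yd; have [es es_p] := tp y yd; exists es.
  by have := old _ _ yd es_p; rewrite /update td.
rewrite {1}/update (negbTE td) /= inE => /predU1P[->|yd]; last first.
  by have [es es_p] := tp y yd; exists es; exact: old.
have [es [pe ue xe sub [sz wp rc]]] := tp _ ed.
exists (rcons es e); rewrite /tree_path map_rcons rcons_uniq xe ue; split=> //.
- by have := pathto_rcons e.2 pe; rewrite -surjective_pairing.
- rewrite mem_rcons inE negb_or; apply/andP; split.
    by apply: contraNneq td => ->.
  by apply: contra td; exact: sub.
- move=> z; rewrite mem_rcons inE /update (negbTE td) /= inE.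
  by move=> /predU1P[->|/sub ->]; rewrite ?ed ?orbT.
split.
- by rewrite size_rcons sz /update (negbTE td) /= eqxx.
- by rewrite wprod_rcons wp /update (negbTE td) /= eqxx.
move=> e0; rewrite mem_rcons inE /update (negbTE td) /= inE => /predU1P[->|/rc[h1 h2]].
  rewrite eqxx; split=> //; apply/negP => /(v_cl v) h.
  by move/negP: er; apply; apply/mapP; exists (e, tgt s e).
by rewrite h1 orbT.
Qed.

Lemma traced_run k st : traced st -> traced (run k s st).
Proof.
elim: k st => [|k IH] st tr //=; case ne : next => [e|] //.
by apply: IH; apply: traced_update.
Qed.

Section Decomposition.
Variables (h : R) (f : nat -> R -> 'I_n -> R) (T : nat).
Hypothesis fS : forall T c x, f T.+1 c x = h + \sum_k p x k * f T (c * p x k) (s x k).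

Let Fex st e := eweight st e * f (T - (depth st e.1).+1) (eweight st e) (tgt s e).
Let Fcl st u := eweight st u.1 * f (T - (depth st u.1.1).+1) (eweight st u.1) u.2.

(** Unfolds a functional of the walk along the explored tree. It is used with [h = 1] and [f = T]
    for the total weight, with [h = 0] and [f = 1] for the mass, and with [h = 0] for the law of the
    walk and for the law of its product of labels. *)
Definition decomposition st : R :=
  h * (\sum_(x <- disc st) weight st x) + \sum_(e | exits st e) Fex st e +
  \sum_(u <- collisions st) Fcl st u.

Lemma sum_source x (F : E -> R) : \sum_(e | e.1 == x) F e = \sum_k F (x, k).
Proof.
transitivity (\sum_(y | y == x) \sum_k F (y, k)); last by rewrite big_pred1_eq.
by rewrite pair_big_dep; apply: eq_big => [[a b]|[a b] _] //=; rewrite andbT.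
Qed.

Lemma decomposition_start : (0 < T)%N -> decomposition (start R i) = f T 1 i.
Proof.
move=> T0; rewrite /decomposition big_seq1/= mulr1 big_nil addr0.
rewrite (eq_bigl (fun e => e.1 == i)); last by move=> e; rewrite /exits/= inE andbT.
rewrite sum_source -(prednK T0) fS; congr (_ + _); apply: eq_bigr => k _.
by rewrite /Fex /eweight/= !mul1r -{1}(prednK T0) subn1.
Qed.

(** If the exit discovers a vertex, its term is replaced by one step of [fS]; if it collides, its
    term moves to the last sum. The depth bound keeps the subtractions from [T] from truncating. *)
Lemma decomposition_update st e : valid st -> next st = Some e ->
  (forall x, x \in disc (update st e (tgt s e)) -> (depth (update st e (tgt s e)) x < T)%N) ->
  decomposition (update st e (tgt s e)) = decomposition st.
Proof.
move=> v ne dT; have [ex oe mx] := next_some ne.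
have /andP[ed er] := ex.
have exE e' : exits (update st e (tgt s e)) e' =
    (exits st e' && (e' != e)) || ((tgt s e \notin disc st) && (e'.1 == tgt s e)).
  rewrite /exits revealed_update /= inE negb_or /update.
  case: ifPn => td /=; first by rewrite ?orbF andbA andbAC.
  rewrite inE; case: (eqVneq e'.1 (tgt s e)) => [e't|_] /=; last first.
    by rewrite ?andbF ?orbF andbA andbAC.
  rewrite e't (negbTE td) /=; apply/andP; split.
    by apply: contraNneq td => ee; rewrite -e't ee.
  apply/negP => /mapP[u ur e'u]; move/negP: td; apply; rewrite -e't e'u.
  exact: (v_src v ur).
rewrite /decomposition [in RHS](bigD1 e ex)/=.
have [td|td] := boolP (tgt s e \in disc st).
  rewrite [\sum_(e' | exits (update _ _ _) e') _](eq_bigl (fun e' => exits st e' && (e' != e))).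
    rewrite /Fex /Fcl /update td /= big_cons/= /eweight /=.
    ring.
  by move=> e'; rewrite exE td orbF.
have -> : \sum_(e' | exits (update st e (tgt s e)) e') Fex (update st e (tgt s e)) e' =
    \sum_k Fex (update st e (tgt s e)) (tgt s e, k) +
    \sum_(e' | exits st e' && (e' != e)) Fex (update st e (tgt s e)) e'.
  rewrite (eq_bigl _ _ exE) (bigID (fun e' => e'.1 == tgt s e))/=; congr (_ + _).
    rewrite -sum_source; apply: eq_bigl => e'; rewrite td /=.
    by case: (eqVneq e'.1 (tgt s e)) => [e't|_] /=; rewrite ?orbT ?andbF.
  apply: eq_bigl => e'; rewrite td /=.
  case: (eqVneq e'.1 (tgt s e)) => [e't|_] /=; last by rewrite orbF andbT.
  by rewrite orbT /exits e't (negbTE td) /= ?andbF.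
have dx : ((depth st e.1).+1 < T)%N by have := dT (tgt s e); rewrite /update (negbTE td) /= inE eqxx; exact.
have -> : \sum_(e' | exits st e' && (e' != e)) Fex (update st e (tgt s e)) e' =
    \sum_(e' | exits st e' && (e' != e)) Fex st e'.
  apply: eq_bigr => e' /andP[/andP[e'd _] _]; rewrite /Fex /eweight /update (negbTE td) /=.
  by have -> : (e'.1 == tgt s e) = false by apply: contraNF td => /eqP <-.
have -> : collisions (update st e (tgt s e)) = collisions st by rewrite /update (negbTE td).
have -> : \sum_(u <- collisions st) Fcl (update st e (tgt s e)) u =
    \sum_(u <- collisions st) Fcl st u.
  rewrite !big_seq; apply: eq_bigr => u /(v_cl v)/(v_src v) ud.
  rewrite /Fcl /eweight /update (negbTE td) /=.
  by have -> : (u.1.1 == tgt s e) = false by apply: contraNF td => /eqP <-.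
have -> : \sum_(x <- disc (update st e (tgt s e))) weight (update st e (tgt s e)) x =
    eweight st e + \sum_(x <- disc st) weight st x.
  rewrite {1}/update (negbTE td) /= big_cons {1}/update (negbTE td) /= eqxx; congr (_ + _).
  rewrite !big_seq; apply: eq_bigr => x xd; rewrite /update (negbTE td) /=.
  by have -> : (x == tgt s e) = false by apply: contraNF td => /eqP <-.
have -> : Fex st e = h * eweight st e + \sum_k Fex (update st e (tgt s e)) (tgt s e, k).
  have Te : (T - (depth st e.1).+1 = (T - (depth st e.1).+2).+1)%N by lia.
  rewrite {1}/Fex Te fS mulrDr [_ * h]mulrC; congr (_ + _).
  rewrite mulr_sumr; apply: eq_bigr => k _.
  by rewrite /Fex /update (negbTE td) /eweight /= eqxx mulrA.
ring.
Qed.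

Lemma decomposition_run k st : traced st ->
  (forall x, x \in disc (run k s st) -> (depth (run k s st) x < T)%N) ->
  decomposition (run k s st) = decomposition st.
Proof.
(* Discovered vertices keep their depth, so the bound assumed on the final state holds at every
   earlier one. *)
have grow k' st' x : traced st' -> x \in disc st' ->
    x \in disc (run k' s st') /\ depth (run k' s st') x = depth st' x.
  elim: k' st' => [|k' IH] st' tr xd //=; case ne : (next st') => [e|//].
  have tr' := traced_update tr ne.
  have xd' : x \in disc (update st' e (tgt s e)).
    by rewrite /update; case: ifP => //=; rewrite inE xd orbT.
  have [h1 h2] := IH _ tr' xd'; split=> //; rewrite h2 /update.
  case: ifPn => //= td; case: eqP => // xt; move: xd; rewrite xt.
  by rewrite (negbTE td).
elim: k st => [|k IH] st tr //=; case ne : (next st) => [e|//] dT.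
have tr' := traced_update tr ne.
rewrite IH//; apply: decomposition_update => //; first exact: t_valid.
by move=> x xd; have [h1 <-] := grow k _ _ tr' xd; exact: dT.
Qed.

End Decomposition.

Lemma decomposition_explored (h : R) f T k :
  (forall T c x, f T.+1 c x = h + \sum_k p x k * f T (c * p x k) (s x k)) -> (0 < T)%N ->
  (forall x, x \in disc (run k s (start R i)) -> (depth (run k s (start R i)) x < T)%N) ->
  decomposition h f T (run k s (start R i)) = f T 1 i.
Proof.
move=> fS T0 dT; rewrite decomposition_run//; last exact: traced_start.
exact: decomposition_start.
Qed.

Section Completion.
Variables (s0 N : nat) (eta : R).
Hypothesis s00 : (0 < s0)%N.
Hypothesis short : forall es y, pathto s i es y -> uniq (map fst es) ->
  size es = s0 -> wprod p es < omega.
Hypothesis eta2 : eta <= 2^-1.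
Hypothesis eta0 : 0 < eta.
Hypothesis acyclic : forall x es, pathto s x es x -> uniq (map fst es) -> es != [::] ->
  exists2 e, e \in es & p e.1 e.2 <= 1 - eta.
Hypothesis N_large : s0%:R < N%:R * omega.

Let st := run N s (start R i).
Let tr : traced st. Proof. exact: traced_run (traced_start). Qed.

Lemma wprod_ge0 es : 0 <= wprod p es.
Proof. exact: prodr_ge0. Qed.

Lemma wprod_le1 es : wprod p es <= 1.
Proof.
rewrite /wprod; elim: es => [|e es IH]; first by rewrite big_nil.
by rewrite big_cons mulr_ile1 ?p_le1//; apply: wprod_ge0.
Qed.

Lemma wprod_le_mem es e : e \in es -> wprod p es <= p e.1 e.2.
Proof.
move=> ees; rewrite /wprod (perm_big _ (perm_to_rem ees)) big_cons.
by rewrite ler_piMr// wprod_le1.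
Qed.

Lemma wprod_cat es es' : wprod p (es ++ es') = wprod p es * wprod p es'.
Proof. exact: big_cat. Qed.

Lemma pathto_cat t x es es' y : pathto t x (es ++ es') y ->
  exists2 z, pathto t x es z & pathto t z es' y.
Proof.
elim: es x => [|e es IH] x /=; first by exists x.
by move=> /andP[-> /IH[z ? ?]]; exists z.
Qed.

Lemma pathto_end t x es y y' : pathto t x es y -> pathto t x es y' -> y = y'.
Proof.
elim: es x => [|e es IH] x /=; first by move=> /eqP <- /eqP <-.
by move=> /andP[_ /IH h] /andP[_ /h].
Qed.

Lemma depth_lt y : y \in disc st -> (depth st y < s0)%N.
Proof.
move=> yd; have [es [pe ue ye sub [sz wp rc]]] := t_path tr yd.
rewrite ltnNge; apply/negP => szy; rewrite -sz in szy.
move: pe; rewrite -{1}(cat_take_drop s0 es) => /pathto_cat[z pz _].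
have uz : uniq (map fst (take s0 es)) by rewrite map_take take_uniq.
have := short pz uz (size_takel szy); apply/negP; rewrite -leNgt.
apply: le_trans (t_om tr yd) _; rewrite -wp -{1}(cat_take_drop s0 es) wprod_cat.
by rewrite ler_piMr ?wprod_ge0 ?wprod_le1.
Qed.

(** The weights at each depth add up to at most one, and there are at most [s0] depths; the
    decomposition of the number of steps gives this at once. *)
Lemma weights_le : \sum_(x <- disc st) weight st x <= s0%:R.
Proof.
have := @decomposition_explored 1 (fun T _ _ => T%:R) s0 N.
have step (T : nat) (c : R) x : T.+1%:R = 1 + \sum_k p x k * T%:R :> R.
  by rewrite -mulr_suml p1 mul1r -natr1 addrC.
move=> /(_ step s00 depth_lt) <-; rewrite /decomposition mul1r -addrA lerDl.
have v := t_valid tr; rewrite addr_ge0//.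
  apply: sumr_ge0 => e /andP[ed _]; rewrite mulr_ge0 ?ler0n// mulr_ge0//.
  by case/andP: (v_wt v ed) => /ltW.
rewrite big_seq; apply: sumr_ge0 => u /(v_cl v)/(v_src v) ud.
rewrite mulr_ge0 ?ler0n// mulr_ge0//.
by case/andP: (v_wt v ud) => /ltW.
Qed.

(** The edges leaving discovered vertices have total weight at most [s0], and each revealed one
    weighs at least [omega]. Hence the search ends before [N] steps and leaves only light exits. *)
Lemma revealed_le : (size (revealed st))%:R * omega <= s0%:R.
Proof.
have v := t_valid tr; apply: le_trans weights_le.
apply: (@le_trans _ _ (\sum_(e <- map fst (revealed st)) eweight st e)).
  have -> : (size (revealed st))%:R * omega = \sum_(e <- map fst (revealed st)) omega.
    by rewrite big_const_seq count_predT size_map iter_addr_0 mulr_natl.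
  by rewrite !big_seq; apply: ler_sum => e /mapP[u ur ->]; apply: (v_om v).
rewrite big_uniq ?(v_uniq v)//= big_uniq ?(v_disc v)//=.
apply: (@le_trans _ _ (\sum_(x in disc st) \sum_k eweight st (x, k))).
  rewrite pair_big_dep/= [leRHS](eq_bigr (eweight st)); last by case.
  rewrite [leRHS](bigID (mem (map fst (revealed st))))/=.
  rewrite [X in _ <= X + _](eq_bigl (fun e => e \in map fst (revealed st))); last first.
    move=> e /=; rewrite ?andbT; apply/andP/idP => [[]//|er]; split=> //.
    by case/mapP: er => u ur ->; exact: (v_src v ur).
  rewrite lerDl; apply: sumr_ge0 => -[x k] /andP[/andP[xd _] _].
  by rewrite mulr_ge0//; case/andP: (v_wt v xd) => /ltW.
apply: ler_sum => x xd; rewrite /eweight /= -mulr_sumr p1 mulr1.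
exact: lexx.
Qed.

Lemma explored_all : next st = None.
Proof.
apply/eqP; apply: contraT => /eqP ne; have := run_done ne; rewrite add0n => sz.
have := revealed_le; rewrite sz => h.
by have := lt_le_trans N_large h; rewrite ltxx.
Qed.

Lemma exit_small e : exits st e -> eweight st e < omega.
Proof. by move=> ex; apply: next_none explored_all ex. Qed.

Lemma mass_split :
  \sum_(e | exits st e) eweight st e + \sum_(u <- collisions st) eweight st u.1 = 1.
Proof.
have := @decomposition_explored 0 (fun _ _ _ => 1) s0 N.
have step (T : nat) (c : R) x : 1 = 0 + \sum_k p x k * 1 :> R.
  by rewrite -mulr_suml p1 mul1r add0r.
move=> /(_ step s00 depth_lt); rewrite /decomposition mul0r add0r.
by under eq_bigr do rewrite mulr1; under [X in _ + X]eq_bigr do rewrite mulr1.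
Qed.

Let heavy es : Prop := forall e, e \in es -> 1 - eta < p e.1 e.2.

Lemma heavy_label x k k' : 1 - eta < p x k -> 1 - eta < p x k' -> k = k'.
Proof.
move=> hk hk'; apply/eqP/negPn/negP => kk.
have : p x k + p x k' <= 1.
  rewrite -(p1 x) (bigD1 k)//= lerD2l (bigD1 k')/= ?lerDl ?sumr_ge0//.
  by rewrite eq_sym.
by move: hk hk' eta2; set a := p x k; set b := p x k'; lra.
Qed.

(** As [1 - eta >= 1/2], a vertex has at most one heavy label, so heavy paths from a given vertex
    are deterministic. *)
Lemma heavy_prefix t x es es' y y' : pathto t x es y -> pathto t x es' y' ->
  heavy es -> heavy es' -> (size es' <= size es)%N -> exists es'', es = es' ++ es''.
Proof.
elim: es' es x => [|[x' k'] es' IH] es x; first by exists es.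
case: es => [//|[x1 k1] es] /= /andP[/eqP -> pe] /andP[/eqP -> pe'] he he' sz.
have k1k' : k1 = k'.
  by apply: (@heavy_label x); [apply: (he (x, k1))|apply: (he' (x, k'))]; rewrite inE eqxx.
subst k1; have [||es'' ->] := IH es _ pe pe' _ _ sz.
- by move=> e ees; apply: he; rewrite inE ees orbT.
- by move=> e ees; apply: he'; rewrite inE ees orbT.
by exists es''.
Qed.

(** Otherwise every label on the path through [u] is heavy, and so is the tree path to the vertex
    that [u] hits, which by the best-first order weighs at least as much. Two heavy paths from [i]
    are nested. If the tree path is at least as long, it either uses a collision edge or passes
    through its endpoint earlier; if it is shorter, the remainder is a heavy cycle. *)
Lemma collision_light u : u \in collisions st -> eweight st u.1 <= 1 - eta.
Proof.
move=> ucl; rewrite leNgt; apply/negP => hu; have v := t_valid tr.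
have ur := v_cl v ucl; have xd := v_src v ur.
have [yd wy] := v_clw v ucl.
have [ex [px ux xx sx [szx wx rx]]] := t_path tr xd.
have [ey [py uy yy sy [szy wy' ry]]] := t_path tr yd.
have tu : tgt s u.1 = u.2 by apply/eqP; exact: (allP (t_comp tr) u ur).
have pA : pathto s i (rcons ex u.1) u.2.
  by have := pathto_rcons u.1.2 px; rewrite -surjective_pairing -tu.
have hA : heavy (rcons ex u.1).
  move=> e /wprod_le_mem; apply: lt_le_trans.
  by rewrite wprod_rcons wx.
have hB : heavy ey.
  by move=> e /wprod_le_mem; apply: lt_le_trans; rewrite wy' (lt_le_trans hu).
have uA : uniq (map fst (rcons ex u.1)) by rewrite map_rcons rcons_uniq xx ux.
have [szAB|szAB] := leqP (size (rcons ex u.1)) (size ey).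
  have [C eyE] := heavy_prefix py pA hB hA szAB.
  case: C eyE => [|c C] eyE.
    have := ry u.1; rewrite eyE cats0 mem_rcons inE eqxx => /(_ isT)[_].
    by rewrite tu -surjective_pairing ucl.
  move: py; rewrite eyE => /pathto_cat[z pz /= /andP[/eqP cz _]].
  have zu : z = u.2 by exact: pathto_end pz pA.
  by move: yy; rewrite eyE map_cat mem_cat inE cz zu eqxx orbT.
have [C AE] := heavy_prefix pA py hA hB (ltnW szAB).
have C0 : C != [::].
  by apply: contraTneq szAB => C0; rewrite AE C0 cats0 ltnn.
move: (pA); rewrite AE => /pathto_cat[z pz pC].
have zu := pathto_end pz py; rewrite zu in pC.
have uC : uniq (map fst C) by move: uA; rewrite AE map_cat cat_uniq => /and3P[].
have [e eC] := acyclic pC uC C0.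
by apply/negP; rewrite -ltNge; apply: hA; rewrite AE mem_cat eC orbT.
Qed.

End Completion.

End ExploredTree.

(** * Fluctuations at the exits of an explored tree *)

Section LocalFluctuations.
Variables (R : realType) (n : nat) (p : 'M[R]_n).
Hypotheses (p0 : forall i j, 0 <= p i j) (p1 : forall i, \sum_j p i j = 1).
Local Notation E := ('I_n * 'I_n)%type.
Implicit Types (e : E) (st : state R n) (s : env n) (i : 'I_n).
Local Notation EE := (@EE R n).
Local Notation PG := (@PG R n).
Local Notation eweight := (eweight p).
Variables (omega eta : R) (N : nat).
Hypotheses (om0 : 0 < omega) (eta0 : 0 < eta).

Definition exit_mass st : R := \sum_(e | exits st e) eweight st e.

Definition exit_law st e : R := if exits st e then eweight st e / exit_mass st else 0.

(** Read off the state alone, so it can be required where the exploration stops. The mass bound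
    turns light exits into exit probabilities at most [omega / eta]. *)
Definition settled st : bool :=
  [&& eta <= exit_mass st, [forall e, exits st e ==> (eweight st e < omega)] &
      (size (revealed st) <= N)%N].

Section ExitLaw.
Variable st : state R n.
Hypotheses (v : valid p omega st) (ok : settled st).

Lemma eweight_ge0 e : exits st e -> 0 <= eweight st e.
Proof. by move=> /andP[/(v_wt v)/andP[/ltW w0 _] _]; exact: mulr_ge0. Qed.

Lemma exit_mass_gt0 : 0 < exit_mass st.
Proof. by case/and3P: ok => h _ _; exact: lt_le_trans h. Qed.

Lemma exit_law_ge0 e : 0 <= exit_law st e.
Proof.
rewrite /exit_law; case: ifP => // ex.
by rewrite divr_ge0 ?eweight_ge0// ltW ?exit_mass_gt0.
Qed.

Lemma exit_law_sum (F : E -> R) :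
  \sum_e exit_law st e * F e = (\sum_(e | exits st e) eweight st e * F e) / exit_mass st.
Proof.
rewrite [in RHS]big_mkcond/= mulr_suml; apply: eq_bigr => e _; rewrite /exit_law.
by case: ifP => _; rewrite ?mul0r// mulrAC.
Qed.

Lemma exit_law_sum1 : \sum_e exit_law st e = 1.
Proof.
transitivity (\sum_e exit_law st e * 1); first by apply: eq_bigr => e _; rewrite mulr1.
rewrite exit_law_sum; under eq_bigr do rewrite mulr1.
by rewrite divff// gt_eqF// exit_mass_gt0.
Qed.

Lemma exit_law_exits e : exit_law st e != 0 -> exits st e.
Proof. by rewrite /exit_law; case: ifP => //; rewrite eqxx. Qed.

Lemma exit_law_le e : exit_law st e <= omega / eta.
Proof.
have [h1 /forallP h2 _] := and3P ok.
rewrite /exit_law; case: ifP => ex; last by rewrite divr_ge0 ?ltW.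
apply: ler_pM => //; first exact: eweight_ge0.
- by rewrite invr_ge0 ltW ?exit_mass_gt0.
- by have := h2 e; rewrite ex => /ltW.
- by rewrite lef_pV2// posrE ?exit_mass_gt0.
Qed.

End ExitLaw.

Variables (J : finType) (f : state R n -> E -> env n -> 'I_n -> J -> R).
Variables (g : state R n -> env n -> R) (lam K eps : R) (M q : nat).
Hypotheses (fS : forall st e y j, indep_of (disc st) (fun s => f st e s y j)).
Hypotheses (f1 : forall st e s y, \sum_j `|f st e s y j| <= 1).
Hypotheses (J0 : (0 < #|J|)%N) (M0 : (0 < M)%N) (lam0 : 0 < lam).
Hypotheses (K0 : 0 <= K) (eps0 : 0 < eps).
Hypothesis Ln : (N + q * M < n)%N.
Hypothesis ML : (n%:R / (n - (N + q * M))%:R) ^+ M <= 2 :> R.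
Hypotheses (g0 : forall st s, 0 <= g st s <= 1).
Hypothesis gS : forall st, indep_of (disc st) (g st).
Hypothesis gK : forall st s, g st s != 0 -> forall e,
  #|J|%:R * avg (fun y => \sum_j f st e s y j ^+ 2) <= K.

Definition local_bound : R :=
  ((2 * (M%:R * (q * M)%:R * (omega / eta)) + 2 * (lam + K / (lam * M%:R))) / eps) ^+ q.

Definition far_exits st s : R :=
  (settled st)%:R * (g st s * (eps <= fluct (f st) (exit_law st) s)%R%:R).

Lemma local_bound_ge0 : 0 <= local_bound.
Proof.
rewrite exprn_ge0// divr_ge0 ?(ltW eps0)// addr_ge0// mulr_ge0//.
  by rewrite !mulr_ge0 ?ler0n// ?invr_ge0 ltW.
by rewrite addr_ge0 ?(ltW lam0)// divr_ge0// mulr_ge0 ?ler0n// ltW.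
Qed.

(** Exits are not revealed, and neither [f] nor [g] reads the discovered rows: given the state, the
    exits are fresh. *)
Lemma local_tail st : valid p omega st ->
  EE (fun s => (comp (revealed st) s)%:R * far_exits st s) <=
  local_bound * PG (revealed st).
Proof.
move=> v; rewrite /far_exits; have [ok|_] := boolP (settled st); last first.
  apply: (@le_trans _ _ 0); last by rewrite mulr_ge0 ?local_bound_ge0 ?PG_ge0.
  by apply: EE_le_cst => s; rewrite mul0r mulr0.
have [_ _ szN] := and3P ok.
rewrite (@EE_ext _ _ _ (fun s => (comp (revealed st) s)%:R * (g st s *
    (eps <= fluct (f st) (exit_law st) s)%R%:R))); last by move=> s; rewrite mul1r.
apply: (@fluct_tail R n J (disc st) (f st) (exit_law st) (omega / eta) lam K M
  (N + q * M) _ _ _ _ _ _ J0 M0 lam0 Ln K0 ML (q * M) q (revealed st) (g st) eps) => //.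
- exact: exit_law_ge0.
- exact: exit_law_sum1.
- by move=> e /exit_law_exits/andP[].
- exact: exit_law_le.
- by move=> x /mapP[u ur ->]; exact: (v_src v ur).
- by move=> e /exit_law_exits/andP[].
- by rewrite leq_add2r.
- split=> [||s gs e _]; [exact: gS|by move=> s; case/andP: (g0 st s)|exact: gK].
- by move=> s; case/andP: (g0 st s).
Qed.

Lemma local_tail_run i : EE (fun s => far_exits (run p omega N s (start R i)) s) <= local_bound.
Proof.
have := @run_mono R n p p0 p1 omega om0 far_exits local_bound N (start R i) local_tail
  (valid_start p0 p1 omega i).
rewrite /= PG_nil mulr1; apply: le_trans; apply: EE_le => s.
by rewrite mul1r.
Qed.

End LocalFluctuations.

(** * Contraction in a typical environment *)

Section PositivePart.
Variable R : realType.
Implicit Types a b c : R.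

Definition pos a : R := Num.max a 0.

Lemma pos_ge0 a : 0 <= pos a. Proof. by rewrite le_max lexx orbT. Qed.

Lemma le_pos a : a <= pos a. Proof. by rewrite le_max lexx. Qed.

Lemma pos_le a b : 0 <= b -> a <= b -> pos a <= b.
Proof. by move=> b0 ab; rewrite ge_max ab b0. Qed.

Lemma pos_norm a : pos a <= `|a|.
Proof. by apply: pos_le; [exact: normr_ge0|exact: ler_norm]. Qed.

Lemma posD a b : pos (a + b) <= pos a + pos b.
Proof. by apply: pos_le; rewrite ?addr_ge0 ?pos_ge0// lerD ?le_pos. Qed.

Lemma pos_mono a b : a <= b -> pos a <= pos b.
Proof. by move=> ab; apply: pos_le; rewrite ?pos_ge0// (le_trans ab)// le_pos. Qed.

Lemma posM c a : 0 <= c -> pos (c * a) <= c * pos a.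
Proof. by move=> c0; apply: pos_le; rewrite ?mulr_ge0 ?pos_ge0// ler_wpM2l// le_pos. Qed.

Lemma pos_sum I (r : seq I) (P : pred I) (F : I -> R) :
  pos (\sum_(k <- r | P k) F k) <= \sum_(k <- r | P k) pos (F k).
Proof.
apply: pos_le; first by apply: sumr_ge0 => k _; exact: pos_ge0.
by apply: ler_sum => k _; exact: le_pos.
Qed.

End PositivePart.

Section QuenchedContraction.
Variables (R : realType) (n : nat) (p : 'M[R]_n).
Hypotheses (p0 : forall i j, 0 <= p i j) (p1 : forall i, \sum_j p i j = 1).
Local Notation E := ('I_n * 'I_n)%type.
Implicit Types (e : E) (i x y j : 'I_n) (es : seq E).
Local Notation eweight := (eweight p).
Variables (s : env n) (omega eta : R) (s0 N : nat).
Hypotheses (om0 : 0 < omega) (om1 : omega <= 1) (s00 : (0 < s0)%N).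
Hypothesis short : forall i es y, pathto s i es y -> uniq (map fst es) ->
  size es = s0 -> wprod p es < omega.
Hypotheses (eta2 : eta <= 2^-1) (eta0 : 0 < eta).
Hypothesis acyclic : forall x es, pathto s x es x -> uniq (map fst es) -> es != [::] ->
  exists2 e, e \in es & p e.1 e.2 <= 1 - eta.
Hypothesis N_large : s0%:R < N%:R * omega.

Definition tree i : state R n := run p omega N s (start R i).

Hypothesis one_collision : forall i, (size (collisions (tree i)) <= 1)%N.

Let tr i : traced p omega s i (tree i).
Proof. exact: traced_run (traced_start p0 p1 s i om1). Qed.

Let v i := t_valid (tr i).

Lemma collision_mass i :
  \sum_(u <- collisions (tree i)) eweight (tree i) u.1 <= 1 - eta.
Proof.
have lt := @collision_light R n p p0 p1 omega s i om0 om1 N eta eta2 acyclic.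
move: (one_collision i) lt; rewrite /tree; case: collisions => [|u [|//]] _ lt.
  by rewrite big_nil; move: eta2; lra.
by rewrite big_seq1; apply: lt; rewrite inE.
Qed.

Let split1 i := @mass_split R n p p0 p1 omega s i om0 om1 s0 N s00 (@short i).

Lemma exit_mass_ge i : eta <= exit_mass p (tree i).
Proof. by have := split1 i; have := collision_mass i; rewrite /exit_mass /tree; lra. Qed.

Lemma exit_mass_le1 i : exit_mass p (tree i) <= 1.
Proof.
rewrite -(split1 i) lerDl big_seq; apply: sumr_ge0 => u /(v_cl (v i))/(v_src (v i)) ud.
by rewrite mulr_ge0//; case/andP: (v_wt (v i) ud) => /ltW.
Qed.

Lemma tree_settled i : settled p omega eta N (tree i).
Proof.
apply/and3P; split; first exact: exit_mass_ge.
  apply/forallP => e; apply/implyP => ex.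
  exact: (@exit_small R n p p0 p1 omega s i om0 om1 s0 N s00 (@short i) N_large).
exact: (size_run p omega N s (start R i)).
Qed.

Let dlt i x : x \in disc (tree i) -> (depth (tree i) x < s0)%N.
Proof. exact: (@depth_lt R n p p0 p1 omega s i om0 om1 s0 N (@short i)). Qed.

Lemma exit_sum_le i (F : E -> R) (b c : R) : 0 <= b ->
  (forall e, exits (tree i) e -> F e <= b) ->
  \sum_(e | exits (tree i) e) eweight (tree i) e * F e <= b.
Proof.
move=> b0 Fb; apply: (@le_trans _ _ (\sum_(e | exits (tree i) e) eweight (tree i) e * b)).
  by apply: ler_sum => e ex; rewrite ler_wpM2l ?Fb// (eweight_ge0 p0 (v i)).
by rewrite -mulr_suml ler_piMl// exit_mass_le1.
Qed.

Lemma collision_sum_le i (F : E * 'I_n -> R) (b : R) : 0 <= b ->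
  (forall u, u \in collisions (tree i) -> F u <= b) ->
  \sum_(u <- collisions (tree i)) eweight (tree i) u.1 * F u <= (1 - eta) * b.
Proof.
move=> b0 Fb.
apply: (@le_trans _ _ (\sum_(u <- collisions (tree i)) eweight (tree i) u.1 * b)).
  rewrite !big_seq; apply: ler_sum => u uc; rewrite ler_wpM2l ?Fb//.
  have ud := v_src (v i) (v_cl (v i) uc).
  by rewrite mulr_ge0//; case/andP: (v_wt (v i) ud) => /ltW.
by rewrite -mulr_suml ler_wpM2r// collision_mass.
Qed.

Section Upper.
Variables (theta : R) (l V : nat).

Definition target j : R := avg (fun y => law p [::] l s (dirac R j) y).

(** Equal to half the L1 distance, as both arguments have mass one, but decreasing in the law: lower
    bounds on the law suffice. *)
Definition defect T i : R := \sum_j pos (target j - law p [::] T s (dirac R j) i).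

(** Convexity of [pos]; consequently the worst-case defect never increases with time. *)
Lemma defectS T i : defect T.+1 i <= \sum_k p i k * defect T (s i k).
Proof.
rewrite /defect; under [leRHS]eq_bigr do rewrite mulr_sumr; rewrite exchange_big/=.
apply: ler_sum => j _; rewrite lawS/=.
have -> : target j - \sum_k p i k * law p [::] T s (dirac R j) (s i k) =
    \sum_k p i k * (target j - law p [::] T s (dirac R j) (s i k)).
  by under [in RHS]eq_bigr do rewrite mulrBr; rewrite sumrB -mulr_suml p1 mul1r.
by apply: le_trans (pos_sum _ _ _) _; apply: ler_sum => k _; exact: posM.
Qed.

Lemma defect_mono T T' m : (forall y, defect T y <= m) -> (T <= T')%N ->
  forall y, defect T' y <= m.
Proof.
move=> h /subnK <-; elim: (T' - T)%N => [|d IH] y //.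
by rewrite addSn; apply: le_trans (defectS _ _) _; apply: row_le.
Qed.

Lemma defect_le1 T y : defect T y <= 1.
Proof.
have -> : 1 = \sum_j target j.
  rewrite -avg_sum (avg_ext (g := fun _ => 1)) ?avg_cst ?(n_gt0 y)// => z.
  by rewrite -law_sum -[RHS](law_cst p1 l s 1 z); apply: law_ext => w; rewrite dirac_sum.
apply: ler_sum => j _; apply: pos_le.
  by apply: avg_ge0 => z; apply: law_ge0 => // w; apply: dirac_ge0.
by rewrite gerBl; apply: law_ge0 => // w; apply: dirac_ge0.
Qed.

(** At total time [l + b], the walk has [l] more steps than this length left after reading exit [e];
    the last [l] are those of the truncation. Avoiding [disc st] makes the kernel independent of the
    explored rows. *)
Definition exit_ker (b : nat) (st : state R n) e s y j : R :=
  ker p theta l (disc st) (b - (depth st e.1).+1) s y j.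

Variables (g eps : R).
Hypotheses (g0 : 0 <= g) (eps0 : 0 <= eps).
Hypothesis flat : forall i w, (w <= V)%N ->
  \sum_j pos (target j - avg (fun y => ker p theta l (disc (tree i)) w s y j)) <= g.

(** Through the exits, the law dominates truncated kernels whose averages are nearly [target] (error
    [g]) and whose deviation from these averages is [fluct] (error [eps]). The collision, of mass at
    most [1 - eta], falls back on the defect at an earlier time, at least [l + (b - s0)] because the
    tree is shallower than [s0]. *)
Lemma defect_step b i m : (s0 <= b)%N -> (b <= V)%N ->
  fluct (exit_ker b (tree i)) (exit_law p (tree i)) s <= eps ->
  (forall y, defect (l + (b - s0)) y <= m) -> 0 <= m ->
  defect (l + b) i <= g + eps + (1 - eta) * m.
Proof.
move=> sb bV fl hm m0; set st := tree i.
pose W e := eweight st e; pose vv e := (b - (depth st e.1).+1)%N.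
have dltb e : exits st e -> ((depth st e.1).+1 <= s0)%N by move=> /andP[ed _]; exact: dlt.
have dec j : law p [::] (l + b) s (dirac R j) i =
   \sum_(e | exits st e) W e * law p [::] (l + b - (depth st e.1).+1) s (dirac R j) (tgt s e) +
   \sum_(u <- collisions st) eweight st u.1 *
      law p [::] (l + b - (depth st u.1.1).+1) s (dirac R j) u.2.
  have := @decomposition_explored R n p p0 p1 omega s i om0 om1 0
    (fun T _ x => law p [::] T s (dirac R j) x) (l + b) N.
  rewrite /decomposition mul0r add0r => -> //.
  - by move=> T c x; rewrite add0r lawS.
  - by rewrite addn_gt0 (leq_trans s00 sb) orbT.
  - move=> x xd; apply: (leq_trans (dlt xd)); apply: (leq_trans sb); exact: leq_addl.
have tgtE j : target j = \sum_(e | exits st e) W e * target j +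
    \sum_(u <- collisions st) eweight st u.1 * target j.
  by rewrite -!mulr_suml -mulrDl (split1 i) mul1r.
pose K e y j := ker p theta l (disc st) (vv e) s y j.
apply: (@le_trans _ _ (\sum_j (
  (\sum_(e | exits st e) W e * pos (target j - avg (fun y => K e y j)) +
   `|\sum_(e | exits st e) W e * centered (K e) (tgt s e) j|) +
   \sum_(u <- collisions st) eweight st u.1 *
     pos (target j - law p [::] (l + b - (depth st u.1.1).+1) s (dirac R j) u.2)))).
  apply: ler_sum => j _.
  have W0 e : exits st e -> 0 <= W e by move=> ex; exact: (eweight_ge0 p0 (v i)).
  have C0 u : u \in collisions st -> 0 <= eweight st u.1.
    move=> /(v_cl (v i))/(v_src (v i)) ud.
    by rewrite mulr_ge0//; case/andP: (v_wt (v i) ud) => /ltW.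
  rewrite dec {1}tgtE opprD addrACA -!sumrB.
  apply: le_trans (posD _ _) _; apply: lerD; last first.
    apply: le_trans (pos_sum _ _ _) _; rewrite !big_seq; apply: ler_sum => u uc.
    by rewrite -mulrBr posM// C0.
  apply: (@le_trans _ _ (pos (\sum_(e | exits st e) W e * (target j - avg (fun y => K e y j)) +
     - \sum_(e | exits st e) W e * centered (K e) (tgt s e) j))).
    apply: pos_mono; rewrite -sumrN -big_split/=; apply: ler_sum => e ex.
    rewrite -[leLHS]mulrBr -[leRHS]mulrBr ler_wpM2l ?W0//.
    rewrite /centered [leRHS](_ : _ = target j - K e (tgt s e) j); last by ring.
    rewrite lerB//; apply: le_trans (ker_mono _ _ _ _ _ _ _ _) _ => //.
    apply: le_trans (ker_le_law _ _ _ _ _ _ _) _ => //.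
    rewrite /vv addnC addnBA//; apply: leq_trans sb; exact: dltb.
  apply: le_trans (posD _ _) _; apply: lerD.
    apply: le_trans (pos_sum _ _ _) _; apply: ler_sum => e ex.
    by rewrite posM// W0.
  by rewrite -[leRHS]normrN; exact: pos_norm.
rewrite !big_split/=; apply: lerD; first apply: lerD.
- rewrite exchange_big/=; under eq_bigr do rewrite -mulr_sumr.
  apply: exit_sum_le => // e ex; apply: flat.
  by apply: leq_trans bV; exact: leq_subr.
- apply: le_trans fl; rewrite /fluct; apply: ler_sum => j _.
  (* [fluct] is normalized by the exit mass, which is at most one, so normalizing only enlarges
     it. *)
  rewrite exit_law_sum normrM normfV (ger0_norm (ltW (exit_mass_gt0 eta0 (tree_settled i)))).
  rewrite ler_peMr// invf_ge1 ?exit_mass_le1//.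
  exact: (exit_mass_gt0 eta0 (tree_settled i)).
rewrite exchange_big/=; under eq_bigr do rewrite -mulr_sumr.
apply: collision_sum_le => // u uc; apply: (defect_mono hm).
have ud := dlt (v_src (v i) (v_cl (v i) uc)).
by move: ud sb; rewrite -/st; move: (depth st u.1.1) => d; clear; lia.
Qed.

(** [(g + eps) / eta] is the fixed point of the affine map in [defect_step], and the initial defect
    is at most 1. *)
Lemma defect_iter k : (s0 * k <= V)%N ->
  (forall i k', (0 < k')%N -> (k' <= k)%N ->
    fluct (exit_ker (s0 * k') (tree i)) (exit_law p (tree i)) s <= eps) ->
  forall i, defect (l + s0 * k) i <= (g + eps) / eta + (1 - eta) ^+ k.
Proof.
have ge0 : 0 <= (g + eps) / eta by rewrite divr_ge0 ?addr_ge0// ltW.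
have e1 : 0 <= 1 - eta by move: eta2; lra.
elim: k => [|k IH] kV fl i.
  by rewrite expr0 (le_trans (defect_le1 _ _))// lerDr.
have kV' : (s0 * k <= V)%N by apply: leq_trans kV; rewrite leq_mul2l leqnSn orbT.
have hm y : defect (l + (s0 * k.+1 - s0)) y <= (g + eps) / eta + (1 - eta) ^+ k.
  by rewrite mulnS addKn; apply: IH => // i' k' k'0 k'k; apply: fl => //; exact: leqW.
apply: le_trans (defect_step _ kV (fl _ _ _ _) hm _) _ => //.
- by rewrite mulnS leq_addr.
- by rewrite addr_ge0 ?exprn_ge0.
rewrite mulrDr -exprS addrA lerD2r.
by rewrite -subr_ge0 (_ : _ - _ = 0)//; field; rewrite gt_eqF.
Qed.

End Upper.

Section Lower.
Variables (T : nat) (gam rho thetam : R).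
Hypotheses (sT : (s0 <= T)%N) (gam0 : 0 < gam) (gam_om : 1 <= gam * omega) (thetam0 : 0 < thetam).

Definition below theta (c : R) (x : 'I_n) : R := (c < theta)%R%:R.

Definition light theta T i : R := walk p [::] T s (below theta) 1 i.

Hypothesis rho_tail : forall x, \sum_(k | p x k < (gam * omega)^-1) p x k <= rho.

Lemma light_shift theta theta' c c' T' y : 0 < theta -> 0 < theta' ->
  0 <= c -> 0 <= c' -> theta * c' <= theta' * c ->
  walk p [::] T' s (below theta) c y <= walk p [::] T' s (below theta') c' y.
Proof.
move=> th0 th0'; elim: T' c c' y => [|T' IH] c c' y c0 c0' cc /=.
  rewrite ler_nat /below; case: (ltP c theta) => // ct.
  have -> // : c' < theta'.
  rewrite -(ltr_pM2l th0); apply: le_lt_trans cc _.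
  by rewrite mulrC ltr_pM2r.
apply: row_mono => // k; apply: IH; rewrite ?mulr_ge0//.
by rewrite !mulrA ler_wpM2r.
Qed.

Lemma light_le1 theta T' c y : walk p [::] T' s (below theta) c y <= 1.
Proof. by apply: walk_le1 => // d z; rewrite /below lern1 leq_b1. Qed.

Lemma light_mono theta T' T'' i : 0 < theta -> (T' <= T'')%N ->
  light theta T' i <= light theta T'' i.
Proof.
move=> th0 /subnK <-; rewrite /light; elim: (T'' - T')%N => [|d IH] //.
apply: le_trans IH _; rewrite addSn; move: (d + T')%N => t.
elim: t (1 : R) i (@ler01 R) => [|t IH] c i c0 /=.
  rewrite -[leLHS]mul1r -(p1 i) mulr_suml; apply: ler_sum => k _.
  rewrite ler_wpM2l// /below ler_nat; case: (ltP c theta) => // ct.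
  by rewrite (le_lt_trans _ ct)// ler_piMr// p_le1.
by apply: row_mono => // k; apply: IH; rewrite mulr_ge0.
Qed.

(** One minus a surviving mass, so that walks entering [disc st] count as light: this bounds [light]
    from above without reading the explored rows. The coordinate in [unit] lets the concentration
    bound for families apply to a single function. *)
Definition light_avoid (st : state R n) (_ : E) s y (_ : unit) : R :=
  1 - walk p (disc st) T s (fun c _ => (thetam <= c)%R%:R) 1 y.

Lemma light_le_avoid st e y theta : theta <= thetam ->
  light theta T y <= light_avoid st e s y tt.
Proof.
move=> th; rewrite /light_avoid lerBrDr.
apply: (@le_trans _ _ (light theta T y +
   walk p [::] T s (fun c _ => (thetam <= c)%R%:R) 1 y)).
  by rewrite lerD2l walk_mono// => c x; rewrite ler0n.
rewrite /light; suff H t c : walk p [::] t s (below theta) c y +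
    walk p [::] t s (fun c _ => (thetam <= c)%R%:R) c y <= 1 by exact: H.
elim: t c y => [|t IH] c y /=.
  rewrite /below -natrD lern1; case: (ltP c theta) => // ct; last by rewrite add0n leq_b1.
  by rewrite leNgt (lt_le_trans ct th).
by rewrite -big_split/=; under eq_bigr do rewrite -mulrDr; apply: row_le.
Qed.

Lemma light_avoid_hit st e y :
  light_avoid st e s y tt <= light thetam T y + hit p (disc st) T s y.
Proof.
rewrite /light_avoid lerBlDr.
have := @walk_hit R n p p0 p1 (disc st) T s (fun c _ => (thetam <= c)%R%:R) 1 y.
have -> : walk p [::] T s (fun c _ => (thetam <= c)%R%:R) 1 y = 1 - light thetam T y.
  rewrite /light; suff H t c : walk p [::] t s (fun c _ => (thetam <= c)%R%:R) c y =
      1 - walk p [::] t s (below thetam) c y by exact: H.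
  elim: t c y => [|t IH] c y /=.
    by rewrite /below leNgt; case: (c < thetam); rewrite /= ?subrr ?subr0.
  under eq_bigr do rewrite IH mulrBr mulr1.
  by rewrite sumrB p1.
have h (c : R) (x : 'I_n) : 0 <= ((thetam <= c)%R%:R : R) <= 1 by rewrite ler0n lern1 leq_b1.
by move=> /(_ h); lra.
Qed.

Variables (g eps : R).
Hypotheses (g0 : 0 <= g) (eps0 : 0 <= eps) (rho0 : 0 <= rho).
Hypothesis avg_light : forall i,
  avg (fun y => light_avoid (tree i) (i, i) s y tt) <= g.

(** After an exit of weight at least [1 / gam], or a collision (of weight at least [omega]), the
    rest of the product must fall below [theta * gam]. A lighter exit leaves a vertex of weight at
    least [omega] by a label below [1 / (gam * omega)]; such exits have total mass at most
    [s0 * rho]. *)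
Lemma light_step theta i m : 0 < theta -> theta * gam <= thetam ->
  fluct (light_avoid (tree i)) (exit_law p (tree i)) s <= eps ->
  (forall y, light (theta * gam) T y <= m) -> 0 <= m ->
  light theta T i <= s0%:R * rho + (g + eps) + (1 - eta) * m.
Proof.
move=> th0 thm fl hm m0; set st := tree i.
have gam1 : 1 <= gam.
  by apply: le_trans gam_om _; rewrite ler_piMr// ltW.
have dec : light theta T i =
   \sum_(e | exits st e) eweight st e *
      walk p [::] (T - (depth st e.1).+1) s (below theta) (eweight st e) (tgt s e) +
   \sum_(u <- collisions st) eweight st u.1 *
      walk p [::] (T - (depth st u.1.1).+1) s (below theta) (eweight st u.1) u.2.
  have := @decomposition_explored R n p p0 p1 omega s i om0 om1 0
    (fun T c x => walk p [::] T s (below theta) c x) T N.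
  rewrite /decomposition mul0r add0r => -> //.
  - by move=> T' c x; rewrite add0r.
  - exact: leq_trans s00 sT.
  - by move=> x xd; apply: (leq_trans (dlt xd)).
have W0 e : exits st e -> 0 <= eweight st e by move=> ex; exact: (eweight_ge0 p0 (v i)).
have shift c T' y : gam^-1 <= c -> (T' <= T)%N ->
    walk p [::] T' s (below theta) c y <= light (theta * gam) T y.
  move=> cg T'T; apply: le_trans (@light_mono (theta * gam) _ _ y _ T'T); last exact: mulr_gt0.
  have c0 : 0 <= c by apply: le_trans cg; rewrite invr_ge0 ltW.
  apply: light_shift => //; first exact: mulr_gt0.
  rewrite mulr1 -mulrA ler_peMr ?(ltW th0)//.
  by rewrite -(mulfV (lt0r_neq0 gam0)) ler_wpM2l// ltW.
rewrite dec; apply: lerD; last first.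
  apply: collision_sum_le => // u uc; apply: le_trans (hm u.2); apply: shift; last exact: leq_subr.
  have ur := v_cl (v i) uc; apply: le_trans (v_om (v i) ur).
  by rewrite -[gam^-1]mul1r ler_pdivrMr// mulrC.
apply: (@le_trans _ _ (\sum_(e | exits st e) (if eweight st e < gam^-1 then eweight st e else 0)
   + \sum_(e | exits st e) eweight st e * light_avoid st e s (tgt s e) tt)).
  rewrite -big_split/=; apply: ler_sum => e ex.
  have la0 : 0 <= light_avoid st e s (tgt s e) tt.
    by rewrite subr_ge0 walk_le1// => c x; rewrite lern1 leq_b1.
  case: ifPn => [_|]; last rewrite -leNgt => cg.
    apply: ler_wpDr; first by apply: mulr_ge0 => //; exact: W0.
    rewrite -[leRHS]mulr1; apply: ler_wpM2l; [exact: W0|exact: light_le1].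
  rewrite add0r; apply: ler_wpM2l; first exact: W0.
  apply: le_trans (light_le_avoid _ _ _ thm).
  by apply: shift => //; exact: leq_subr.
apply: lerD.
  apply: (@le_trans _ _ (\sum_(x in disc st) \sum_(k | p x k < (gam * omega)^-1) weight st x * p x k)).
    rewrite pair_big_dep/= -big_mkcondr/=.
    apply: (@le_trans _ _ (\sum_(e | exits st e && (eweight st e < gam^-1)) weight st e.1 * p e.1 e.2)).
      exact: lexx.
    rewrite [leRHS](bigID (fun e => exits st e && (eweight st e < gam^-1)))/=.
    rewrite [X in _ <= X + _](eq_bigl (fun e => exits st e && (eweight st e < gam^-1))).
      rewrite lerDl; apply: sumr_ge0 => e /andP[/andP[ed _] _].
      by rewrite mulr_ge0//; case/andP: (v_wt (v i) ed) => /ltW.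
    move=> e; apply/andP/idP => [[]//|ex]; split=> //; case/andP: ex => /andP[ed er] ew.
    rewrite ed /= -[X in _ < X]mul1r ltr_pdivlMr ?mulr_gt0//.
    have := t_om (tr i) ed => omw.
    rewrite mulrCA; apply: (@le_lt_trans _ _ (gam * eweight st e)).
      by rewrite ler_wpM2l ?(ltW gam0)// mulrC ler_wpM2r.
    by rewrite -(mulfV (lt0r_neq0 gam0)) ltr_pM2l.
  apply: (@le_trans _ _ (\sum_(x in disc st) weight st x * rho)).
    apply: ler_sum => x xd; rewrite -mulr_sumr ler_wpM2l ?rho_tail//.
    by case/andP: (v_wt (v i) xd) => /ltW.
  rewrite -mulr_suml ler_wpM2r// -big_uniq ?(v_disc (v i))//=.
  exact: (@weights_le R n p p0 p1 omega s i om0 om1 s0 N s00 (@short i)).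
pose a := avg (fun y => light_avoid st (i, i) s y tt).
have -> : \sum_(e | exits st e) eweight st e * light_avoid st e s (tgt s e) tt =
   exit_mass p st * a +
   \sum_(e | exits st e) eweight st e * centered (light_avoid st e s) (tgt s e) tt.
  rewrite /exit_mass mulr_suml -big_split/=; apply: eq_bigr => e _.
  by rewrite -mulrDr /centered /a addrC subrK.
have m0' := exit_mass_gt0 eta0 (tree_settled i).
apply: lerD.
  apply: (@le_trans _ _ (exit_mass p st * g)); first by rewrite ler_wpM2l ?(ltW m0')// avg_light.
  by rewrite ler_piMl// exit_mass_le1.
apply: le_trans fl; rewrite /fluct (big_pred1 tt) => [|[]//].
rewrite exit_law_sum normrM normfV (ger0_norm (ltW m0')).
apply: le_trans (ler_norm _) _; rewrite ler_peMr// invf_ge1 ?exit_mass_le1//.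
Qed.

(** Each round raises the threshold by a factor [gam], so [k] rounds are affordable as long as
    [theta * gam ^+ k] stays below the threshold of the law of large numbers. *)
Lemma light_iter k theta : 0 < theta -> theta * gam ^+ k <= thetam ->
  (forall i, fluct (light_avoid (tree i)) (exit_law p (tree i)) s <= eps) ->
  forall i, light theta T i <= (s0%:R * rho + (g + eps)) / eta + (1 - eta) ^+ k.
Proof.
have gg0 : 0 <= s0%:R * rho + (g + eps) by rewrite addr_ge0 ?mulr_ge0 ?ler0n// addr_ge0.
have ge0 : 0 <= (s0%:R * rho + (g + eps)) / eta by rewrite divr_ge0// ltW.
have e1 : 0 <= 1 - eta by move: eta2; lra.
move=> + + fl; elim: k theta => [|k IH] theta th0 thm i.
  by rewrite expr0 (le_trans (light_le1 _ _ _ _))// lerDr.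
have gam1 : 1 <= gam by apply: le_trans gam_om _; rewrite ler_piMr// ltW.
have thm' : theta * gam <= thetam.
  apply: le_trans thm; rewrite exprS mulrA ler_peMr ?exprn_ege1//.
  by apply: mulr_ge0; apply: ltW.
have hm y : light (theta * gam) T y <= (s0%:R * rho + (g + eps)) / eta + (1 - eta) ^+ k.
  by apply: IH; [exact: mulr_gt0|rewrite -mulrA -exprS].
apply: le_trans (light_step th0 thm' (fl i) hm _) _; first by rewrite addr_ge0 ?exprn_ge0.
rewrite mulrDr -exprS addrA lerD2r.
by rewrite -subr_ge0 (_ : _ - _ = 0)//; field; rewrite gt_eqF.
Qed.

End Lower.

End QuenchedContraction.

(** * Probability of a typical environment *)

Section RareEvents.
Variables (R : realType) (n : nat).
Implicit Types (A B : set (env n)) (f : env n -> R).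
Local Notation EE := (@EE R n).

Lemma Pr_le A B : (forall s, A s -> B s) -> Pr R A <= Pr R B.
Proof.
move=> AB; rewrite !PrE; apply: EE_le => s; rewrite ler_nat.
by case: asboolP => // /AB Bs; rewrite asboolT.
Qed.

Lemma Pr_ge0 A : 0 <= Pr R A.
Proof. by rewrite PrE; apply: EE_ge0 => s; exact: ler0n. Qed.

Lemma Pr_compl A : Pr R A + Pr R (fun s => ~ A s) = 1.
Proof.
rewrite !PrE -EED -[RHS](@EE1 R n); apply: EE_ext => s.
by rewrite asbool_neg; case: asboolP => _; rewrite ?addr0 ?add0r.
Qed.

Lemma Pr_markov A f c : 0 < c -> (forall s, 0 <= f s) -> (forall s, A s -> c <= f s) ->
  Pr R A <= EE f / c.
Proof.
move=> c0 f0 Af; rewrite ler_pdivlMr// PrE mulrC -EEZ; apply: EE_le => s.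
by case: asboolP => [/Af|_]; rewrite ?mulr1 ?mulr0.
Qed.

(** Removes exceptional events one at a time, each leaving its negation for the rest of the
    argument. *)
Lemma Pr_unless A B c d : Pr R A <= c -> Pr R (fun s => ~ A s /\ B s) <= d ->
  Pr R B <= c + d.
Proof.
move=> Ac Bd; apply: le_trans (lerD Ac Bd); rewrite !PrE -EED; apply: EE_le => s.
rewrite -natrD ler_nat asbool_and asbool_neg.
by case: asboolP => // Bs; rewrite andbT; case: asboolP.
Qed.

Lemma Pr_exists (I : finType) (A : I -> set (env n)) :
  Pr R (fun s => exists i, A i s) <= \sum_i Pr R (A i).
Proof.
under eq_bigr do rewrite PrE; rewrite -EE_sum PrE; apply: EE_le => s.
case: asboolP => [[i Ai]|_]; last by apply: sumr_ge0 => i _; rewrite ler0n.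
by rewrite (bigD1 i)//= (asboolT Ai) lerDl; apply: sumr_ge0 => k _; rewrite ler0n.
Qed.

Lemma Pr_exists_le (I : finType) (A : I -> set (env n)) b :
  (forall i, Pr R (A i) <= b) -> Pr R (fun s => exists i, A i s) <= #|I|%:R * b.
Proof.
move=> Ab; apply: le_trans (Pr_exists A) _.
apply: (@le_trans _ _ (\sum_(i : I) b)); first by apply: ler_sum => i _.
by rewrite sumr_const mulr_natl.
Qed.

End RareEvents.

Section Typical.
Variables (R : realType) (n : nat) (p : 'M[R]_n).
Hypotheses (p0 : forall i j, 0 <= p i j) (p1 : forall i, \sum_j p i j = 1).
Hypothesis n1 : (1 < n)%N.
Local Notation E := ('I_n * 'I_n)%type.
Implicit Types (s : env n) (e : E) (i x y j : 'I_n) (es : seq E).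
Local Notation EE := (@EE R n).
Let n0 : (0 < n)%N. Proof. exact: ltnW. Qed.
Let nR : 0 < n%:R :> R. Proof. by rewrite ltr0n. Qed.

Lemma le_term (F : 'I_n -> R) x : (forall y, 0 <= F y) -> F x <= \sum_y F y.
Proof. by move=> F0; rewrite (bigD1 x)//= lerDl; apply: sumr_ge0. Qed.

Section Cycles.
Variable eta : R.

Definition heavy_cycle s := exists x es,
  [/\ pathto s x es x, uniq (map fst es), es != [::] & forall e, e \in es -> 1 - eta < p e.1 e.2].

(** First moment with the indicator of heavy labels as weight: cycles of length [t] cost [al ^+ t],
    and for [al <= 1/2] the geometric series is at most [2 * al]. *)
Lemma Pr_heavy_cycle : near_one_frac p eta <= 2^-1 ->
  Pr R heavy_cycle <= 2 * near_one_frac p eta.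
Proof.
set al := near_one_frac p eta => al2.
pose g x k : R := (1 - eta < p x k)%R%:R.
have gE : avg (fun x => \sum_k g x k) = al by [].
have g0 x k : 0 <= g x k by exact: ler0n.
have al0 : 0 <= al by rewrite -gE; apply: avg_ge0 => x; apply: sumr_ge0.
pose f s := \sum_(t < n) \sum_x sawalk p g [::] t.+1 s (fun _ => dirac R x) 1 x.
have sa0 t s x : 0 <= sawalk p g [::] t s (fun _ => dirac R x) 1 x.
  by have := @sawalk_ge0 R n p g; apply => // *; exact: dirac_ge0.
apply: le_trans (@Pr_markov R n heavy_cycle f 1 ltr01 _ _) _.
- by move=> s; apply: sumr_ge0 => t _; apply: sumr_ge0.
- move=> s [x [es [pe ue e0 he]]].
  have [m mE] : exists m, size es = m.+1 by move: e0; case: es {pe ue he} => // e es; exists (size es).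
  have mn : (m < n)%N by rewrite -mE -(size_map fst) -(card_uniqP ue) -[n in (_ <= n)%N]card_ord max_card.
  have le_sum (G : nat -> 'I_n -> R) : (forall t y, 0 <= G t y) ->
      G m x <= \sum_(t < n) \sum_y G t y.
    move=> G0; rewrite (bigD1 (Ordinal mn))//= (bigD1 x)//= -addrA lerDl.
    by apply: addr_ge0; apply: sumr_ge0 => t _ //; apply: sumr_ge0.
  apply: le_trans (le_sum (fun t y => sawalk p g [::] t.+1 s (fun _ => dirac R y) 1 y) _);
    last by move=> t y; exact: sa0.
  have := @sawalk_path R n p g [::] s (fun _ => dirac R x) 1 x es x g0
    (fun _ => @dirac_ge0 R n x) pe ue (fun _ _ => isT).
  rewrite mE; apply: le_trans.
  rewrite /dirac eqxx mulr1 /wprod big1_seq// => e /andP[_ /he eh].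
  by rewrite /g eh.
rewrite divr1 /f EE_sum.
have : \sum_(t < n) al ^+ t.+1 <= 2 * al.
  suff H m : \sum_(t < m) al ^+ t.+1 <= 2 * al * (1 - 2^-1 ^+ m).
    have a0 : 0 <= 2^-1 ^+ n :> R by rewrite exprn_ge0// invr_ge0.
    by apply: le_trans (H n) _; move: (2^-1 ^+ n) a0 => a; nra.
  elim: m => [|m IH]; first by rewrite big_ord0 expr0 subrr mulr0.
  rewrite big_ord_recr/=; apply: le_trans (lerD IH _) _; first exact: lexx.
  have : al ^+ m.+1 <= al * 2^-1 ^+ m.
    by rewrite exprS ler_wpM2l// lerXn2r ?nnegrE ?invr_ge0.
  by rewrite [2^-1 ^+ m.+1]exprS; move: (2^-1 ^+ m) (al ^+ m.+1) => a b; lra.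
apply: le_trans; apply: ler_sum => t _; rewrite EE_sum.
by rewrite -gE; exact: EE_sawalk_cycle.
Qed.

End Cycles.

(** Markov's inequality for the power [J.+1] of the weight: the first power would give a row average
    equal to 1, hence no decay in [T]. *)
Lemma Pr_heavy_path J T (omega : R) : 0 < omega ->
  Pr R (fun s => exists x es y, [/\ pathto s x es y, uniq (map fst es),
    size es = T.+1 & omega <= wprod p es]) <=
  n%:R * avg (fun x => \sum_k p x k ^+ J.+1) ^+ T / omega ^+ J.+1.
Proof.
move=> om0; pose g x k : R := p x k ^+ J.+1.
have g0 x k : 0 <= g x k by exact: exprn_ge0.
have p_le1 x k : p x k <= 1 by rewrite -(p1 x) (bigD1 k)//= lerDl sumr_ge0.
pose f s := \sum_x sawalk p g [::] T.+1 s (fun _ _ => 1) 1 x.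
have sa0 s x : 0 <= sawalk p g [::] T.+1 s (fun _ _ => 1) 1 x.
  by have := @sawalk_ge0 R n p g; apply => // *; exact: ler01.
apply: le_trans (@Pr_markov R n _ f (omega ^+ J.+1) _ _ _) _.
- exact: exprn_gt0.
- by move=> s; apply: sumr_ge0.
- move=> s [x [es [y [pe ue sz om]]]].
  have := @sawalk_path R n p g [::] s (fun _ _ => 1) 1 x es y g0
    (fun _ _ => ler01) pe ue (fun _ _ => isT).
  rewrite sz mulr1 => le1.
  apply: (@le_trans _ _ (wprod p es ^+ J.+1)).
    by apply: lerXn2r; rewrite ?nnegrE ?(ltW om0)// (le_trans (ltW om0)).
  rewrite (_ : wprod p es ^+ J.+1 = wprod g es); last by rewrite /wprod -prodrXl.
  apply: le_trans le1 _; exact: (le_term x (sa0 s)).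
rewrite ler_wpM2r ?invr_ge0 ?exprn_ge0 ?(ltW om0)// /f EE_sum.
apply: (@le_trans _ _ (\sum_(x < n) avg (fun x => \sum_k p x k ^+ J.+1) ^+ T)); last first.
  by rewrite sumr_const card_ord mulr_natl.
apply: ler_sum => x _; apply: EE_sawalk_pow => //.
rewrite -(p1 x); apply: ler_sum => k _.
by rewrite /g exprS ler_piMr// exprn_ile1.
Qed.

Lemma Pr_collisions omega N : 0 < omega -> (N < n)%N ->
  Pr R (fun s => exists i, (1 < size (collisions (tree p s omega N i)))%N) <=
  n%:R * (N%:R * (N.+1%:R / (n - N)%:R)) ^+ 2.
Proof.
move=> om0 Nn; rewrite -[X in X%:R * _]card_ord; apply: Pr_exists_le => i.
have := @run_collisions R n p p0 p1 omega om0 N N (start R i) 2 Nn (valid_start p0 p1 omega i)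
  (leqnn _).
rewrite /= PG_nil mul1r; apply: le_trans; rewrite PrE; apply: EE_le => s.
by rewrite mul1r ler_nat /tree add0n; case: asboolP => // ->.
Qed.

Lemma Pr_ker theta l V K : 0 <= theta -> 0 < K ->
  Pr R (fun s => exists v : 'I_V.+1, K < n%:R * avg (fun y => \sum_j ker p theta l [::] v s y j ^+ 2)) <=
  V.+1%:R * ((n%:R * theta + 14 * (V + l).+2%:R ^+ 3) / K).
Proof.
move=> th0 K0; rewrite -[X in X%:R * _]card_ord; apply: Pr_exists_le => v.
pose f s := \sum_y \sum_j ker p theta l [::] v s y j ^+ 2.
have f0 s : 0 <= f s by apply: sumr_ge0 => y _; apply: sumr_ge0 => j _; exact: sqr_ge0.
apply: le_trans (@Pr_markov R n _ f K K0 f0 _) _.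
  by move=> s; rewrite /avg mulrA mulfV ?mul1r ?(gt_eqF nR)// => /ltW.
rewrite ler_wpM2r ?invr_ge0 ?(ltW K0)// /f EE_sum.
apply: (@le_trans _ _ (\sum_(y < n) (theta + 14 * (V + l).+2%:R ^+ 3 / n%:R))); last first.
  rewrite sumr_const card_ord -[leLHS]mulr_natl mulrDr lerD2l.
  by rewrite mulrC divfK// gt_eqF.
apply: ler_sum => y _.
apply: (@le_trans _ _ (theta + 14 * (v + l).+2%:R ^+ 3 / n%:R)); last first.
  rewrite lerD2l ler_wpM2r ?invr_ge0 ?(ltW nR)// ler_wpM2l// lerXn2r ?nnegrE//.
  by rewrite ler_nat !ltnS leq_add2r -ltnS.
apply: (@le_trans _ _ (EE (fun s => theta + remeet p [::] (v + l) s y))).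
  by apply: EE_le => s; exact: ker_remeet.
by rewrite EED EE_cst lerD2l; exact: EE_remeet.
Qed.

Lemma Pr_occ U b : 0 < b ->
  Pr R (fun s => exists u : 'I_U.+1, b < \sum_x occ p s u x ^+ 2) <=
  U.+1%:R * (6 * U.+2%:R ^+ 3 / n%:R / b).
Proof.
move=> b0; rewrite -[X in X%:R * _]card_ord; apply: Pr_exists_le => u.
pose f s := \sum_x occ p s u x ^+ 2.
have f0 s : 0 <= f s by apply: sumr_ge0 => x _; exact: sqr_ge0.
apply: le_trans (@Pr_markov R n _ f b b0 f0 (fun s => @ltW _ _ _ _)) _.
rewrite ler_wpM2r ?invr_ge0 ?(ltW b0)//.
rewrite (@EE_ext _ _ _ (fun s => avg (fun a => avg (fun b => meet p [::] u s a b)))); last first.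
  by move=> s; exact: occ_sqr.
have := @EE_avg_meet R n p p0 p1 u n0.
under avg_ext do rewrite -EE_avg; rewrite -EE_avg => /le_trans; apply.
rewrite ler_wpM2r ?invr_ge0 ?(ltW nR)// ler_wpM2l// lerXn2r ?nnegrE//.
by rewrite ler_nat !ltnS -ltnS.
Qed.

Lemma Pr_walk T phi D a : 0 < D -> 0 < a -> (forall c x, 0 <= phi c x <= 1) ->
  (forall c x, 0 < c -> phi c x <= (ln c + T%:R * avg_entropy p) ^+ 2 / D ^+ 2) ->
  Pr R (fun s => a < avg (walk p [::] T s phi 1)) <=
  (T%:R * log_sqr p / D ^+ 2 + T.+1%:R * T%:R / n%:R) / a.
Proof.
move=> D0 a0 phi01 phiD.
apply: le_trans (@Pr_markov R n _ (fun s => avg (walk p [::] T s phi 1)) a a0 _ _) _.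
- move=> s; apply: avg_ge0 => x; apply: walk_ge0 => // c y.
  by case/andP: (phi01 c y).
- by move=> s /ltW.
by rewrite ler_wpM2r ?invr_ge0 ?(ltW a0)//; exact: walk_lln.
Qed.

Lemma Pr_not_low T theta D a : 0 < D -> 0 < a -> 0 < theta ->
  D <= ln theta + T%:R * avg_entropy p ->
  Pr R (fun s => a < avg (walk p [::] T s (fun c _ => (theta < c)%R%:R) 1)) <=
  (T%:R * log_sqr p / D ^+ 2 + T.+1%:R * T%:R / n%:R) / a.
Proof.
move=> D0 a0 th0 thD; apply: Pr_walk => // [c x|c x c0]; first by rewrite ler0n lern1 leq_b1.
have D2 : 0 < D ^+ 2 by exact: exprn_gt0.
case: ltP => [thc|_]; last by rewrite divr_ge0 ?sqr_ge0 ?(ltW D2).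
rewrite ler_pdivlMr// mul1r; apply: lerXn2r; rewrite ?nnegrE ?(ltW D0)//.
  by apply: le_trans (ltW D0) (le_trans thD _); rewrite lerD2r ler_ln ?posrE// ltW.
by apply: le_trans thD _; rewrite lerD2r ler_ln ?posrE// ltW.
Qed.

Lemma Pr_light T theta D a : 0 < D -> 0 < a -> 0 < theta ->
  ln theta + T%:R * avg_entropy p <= - D ->
  Pr R (fun s => a < avg (light p s theta T)) <=
  (T%:R * log_sqr p / D ^+ 2 + T.+1%:R * T%:R / n%:R) / a.
Proof.
move=> D0 a0 th0 thD; apply: Pr_walk => // [c x|c x c0]; first by rewrite ler0n lern1 leq_b1.
have D2 : 0 < D ^+ 2 by exact: exprn_gt0.
rewrite /below; case: ltP => [cth|_]; last by rewrite divr_ge0 ?sqr_ge0 ?(ltW D2).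
rewrite ler_pdivlMr// mul1r -[leRHS]sqrrN.
have le : D <= - (ln c + T%:R * avg_entropy p).
  rewrite lerNr; apply: le_trans thD; rewrite lerD2r ler_ln ?posrE//; exact: ltW.
by apply: lerXn2r; rewrite ?nnegrE ?(ltW D0)// (le_trans (ltW D0)).
Qed.

Lemma Pr_flat theta lam l M V a : 0 <= theta -> 0 < lam -> (0 < M)%N -> (M < n)%N ->
  (n%:R / (n - M)%:R) ^+ M <= 2 :> R -> 0 < a ->
  Pr R (fun s => a < \sum_(u < V) \sum_j `|avg (fun y => ker p theta l [::] u.+1 s y j) -
      avg (fun y => ker p theta l [::] u s y j)|) <=
  (\sum_(u < V) flat_bound n theta lam l u M) / a.
Proof.
move=> th0 lam0 M0 Mn M2 a0.
pose f s := \sum_(u < V) \sum_j `|avg (fun y => ker p theta l [::] u.+1 s y j) -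
      avg (fun y => ker p theta l [::] u s y j)|.
apply: le_trans (@Pr_markov R n _ f a a0 _ (fun s => @ltW _ _ _ _)) _.
  by move=> s; apply: sumr_ge0 => u _; apply: sumr_ge0 => j _; exact: normr_ge0.
rewrite ler_wpM2r ?invr_ge0 ?(ltW a0)// /f EE_sum; apply: ler_sum => u _.
exact: EE_flat.
Qed.

End Typical.

Section LocalEvents.
Variables (R : realType) (n : nat) (p : 'M[R]_n).
Hypotheses (p0 : forall i j, 0 <= p i j) (p1 : forall i, \sum_j p i j = 1).
Hypothesis n1 : (1 < n)%N.
Local Notation E := ('I_n * 'I_n)%type.
Implicit Types (s : env n) (e : E) (i x y j : 'I_n) (st : state R n).
Local Notation EE := (@EE R n).
Let n0 : (0 < n)%N. Proof. exact: ltnW. Qed.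
Let nR : 0 < n%:R :> R. Proof. by rewrite ltr0n. Qed.
Variables (omega eta : R) (N : nat) (om0 : 0 < omega) (eta0 : 0 < eta).
Variables (lam K eps : R) (M q : nat).
Hypotheses (M0 : (0 < M)%N) (lam0 : 0 < lam) (K1 : 1 <= K) (eps0 : 0 < eps).
Hypothesis Ln : (N + q * M < n)%N.
Hypothesis ML : (n%:R / (n - (N + q * M))%:R) ^+ M <= 2 :> R.
Local Notation tree s i := (tree p s omega N i).
Local Notation bound := (local_bound omega eta lam K eps M q).
Let K0 : 0 <= K. Proof. exact: le_trans ler01 K1. Qed.

(** Asked for all lengths up to [V] at once, since the exits of a tree lie at different depths. *)
Definition spread theta l V S s : bool :=
  [forall v : 'I_V.+1, n%:R * avg (fun y => \sum_j ker p theta l S v s y j ^+ 2) <= K].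

Lemma spread_avoid theta l V S s : spread theta l V [::] s -> spread theta l V S s.
Proof.
move=> /forallP sp; apply/forallP => v; apply: le_trans (sp v).
rewrite ler_wpM2l ?(ltW nR)//; apply: avg_le => y; apply: ler_sum => j _.
apply: lerXn2r; rewrite ?nnegrE ?ker_ge0//; exact: ker_mono.
Qed.

(** The moment bound asks for [spread] of the kernels avoiding the tree, an event of the unexplored
    rows; it follows from [spread] of the full kernels. *)
Lemma Pr_exit_ker theta l V b : (b <= V)%N ->
  Pr R (fun s => exists i, [/\ settled p omega eta N (tree s i), spread theta l V [::] s &
    eps <= fluct (exit_ker p theta l b (tree s i)) (exit_law p (tree s i)) s]) <=
  n%:R * bound.
Proof.
move=> bV; rewrite -[X in X%:R * _]card_ord; apply: Pr_exists_le => i.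
pose g st s : R := (spread theta l V (disc st) s)%:R.
have := @local_tail_run R n p p0 p1 omega eta N om0 eta0 'I_n (exit_ker p theta l b) g
  lam K eps M q _ _ _ M0 lam0 K0 eps0 Ln ML _ _ _ i; rewrite PrE => h.
apply: le_trans (h _ _ _ _ _ _); first apply: EE_le => s.
- rewrite /far_exits; case: asboolP => [[st sp ep]|_].
    by rewrite st /g spread_avoid// !mul1r ep.
  by rewrite !mulr_ge0 ?ler0n.
- by move=> st e y j; exact: indep_ker.
- move=> st e s y; apply: le_trans (ker_sum_le1 p0 p1 theta l (disc st) (b - (depth st e.1).+1) s y).
  by apply: ler_sum => j _; rewrite ger0_norm// ker_ge0.
- by rewrite card_ord.
- by move=> st s; rewrite ler0n lern1 leq_b1.
- move=> st s t eqst; congr (_%:R); congr (nat_of_bool _); apply: eq_forallb => v.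
  congr (_ * _ <= _); apply: avg_ext => y; apply: eq_bigr => j _; congr (_ ^+ 2).
  exact: indep_ker eqst.
- move=> st s; rewrite pnatr_eq0 eqb0 negbK => /forallP sp e; rewrite card_ord.
  have vV : (b - (depth st e.1).+1 < V.+1)%N.
    by rewrite ltnS (leq_trans _ bV)// leq_subr.
  exact: sp (Ordinal vV).
Qed.

Lemma Pr_light_avoid T theta :
  Pr R (fun s => exists i, settled p omega eta N (tree s i) /\
    eps <= fluct (light_avoid p T theta (tree s i)) (exit_law p (tree s i)) s) <=
  n%:R * bound.
Proof.
rewrite -[X in X%:R * _]card_ord; apply: Pr_exists_le => i.
have := @local_tail_run R n p p0 p1 omega eta N om0 eta0 unit (light_avoid p T theta)
  (fun _ _ => 1) lam K eps M q _ _ _ M0 lam0 K0 eps0 Ln ML _ _ _ i; rewrite PrE => h.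
have la01 st e s y : 0 <= light_avoid p T theta st e s y tt <= 1.
  have w0 : 0 <= walk p (disc st) T s (fun c _ => (theta <= c)%R%:R) 1 y.
    by apply: walk_ge0 => // c x; exact: ler0n.
  have w1 : walk p (disc st) T s (fun c _ => (theta <= c)%R%:R) 1 y <= 1.
    by apply: walk_le1 => // c x; rewrite lern1 leq_b1.
  by rewrite /light_avoid subr_ge0 w1 gerBl w0.
apply: le_trans (h _ _ _ _ _ _); first apply: EE_le => s.
- rewrite /far_exits; case: asboolP => [[st ep]|_]; first by rewrite st !mul1r ep.
  by rewrite !mulr_ge0 ?ler0n.
- by move=> st e y j s t eqst; congr (1 - _); exact: indep_walk eqst.
- move=> st e s y; rewrite (big_pred1 tt) => [|[]//].
  by case/andP: (la01 st e s y) => l0 l1; rewrite ger0_norm.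
- by rewrite card_unit.
- by move=> st s; rewrite ler01 lexx.
- by move=> st s t _.
- move=> st s _ e; rewrite card_unit mul1r; apply: le_trans K1.
  rewrite -(avg_cst 1 n0); apply: avg_le => y; rewrite (big_pred1 tt) => [|[]//].
  by case/andP: (la01 st e s y) => l0 l1; rewrite exprn_ile1.
Qed.

End LocalEvents.

(** * Good environments: all exceptional events together *)

Section GoodEnvironment.
Variables (R : realType) (n : nat) (p : 'M[R]_n).
Hypotheses (p0 : forall i j, 0 <= p i j) (p1 : forall i, \sum_j p i j = 1).
Hypothesis n1 : (1 < n)%N.
Local Notation E := ('I_n * 'I_n)%type.
Implicit Types (s : env n) (e : E) (i x y j : 'I_n).
Let n0 : (0 < n)%N. Proof. exact: ltnW. Qed.
Let nR : 0 < n%:R :> R. Proof. by rewrite ltr0n. Qed.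
Variables (omega eta : R) (N J T0 C l Tl : nat).
Hypotheses (om0 : 0 < omega) (om1 : omega <= 1).
Hypotheses (eta0 : 0 < eta) (eta2 : eta <= 2^-1) (al2 : near_one_frac p eta <= 2^-1).
Variables (lam K eps : R) (M q : nat).
Hypotheses (M0 : (0 < M)%N) (q0 : (0 < q)%N) (lam0 : 0 < lam) (K1 : 1 <= K) (eps0 : 0 < eps).
Hypothesis Ln : (N + q * M < n)%N.
Hypothesis ML : (n%:R / (n - (N + q * M))%:R) ^+ M <= 2 :> R.
Hypothesis N_large : T0.+1%:R < N%:R * omega.
Let V := (T0.+1 * C)%N.
Let U := (V + l)%N.
Variables (theta D g1 b gam rho thetal : R).
Hypotheses (theta0 : 0 < theta) (D0 : 0 < D) (g10 : 0 < g1) (b0 : 0 < b).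
Hypotheses (thD : D <= ln theta + l%:R * avg_entropy p).
Hypotheses (gam0 : 0 < gam) (gam_om : 1 <= gam * omega) (rho0 : 0 <= rho) (thetal0 : 0 < thetal).
Hypothesis rho_tail : forall x, \sum_(k | p x k < (gam * omega)^-1) p x k <= rho.
Hypothesis lD : ln (thetal * gam ^+ C) + Tl%:R * avg_entropy p <= - D.
Hypotheses (sTl : (T0 < Tl)%N) (Tl_l : (Tl <= l)%N).

(** Counts at most [U.+1] times and [N.+1] explored vertices, each with occupation probability at
    most [Num.sqrt b]. *)
Definition hit_bound : R := (U.+1 * N.+1)%:R * Num.sqrt b.

Definition upper_error : R := (2 * g1 + hit_bound + eps) / eta + (1 - eta) ^+ C.

Definition lower_error : R :=
  (T0.+1%:R * rho + (g1 + hit_bound + eps)) / eta + (1 - eta) ^+ C.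

Definition good s := [/\ forall i, defect p s l (l + V) i <= upper_error,
  forall i, light p s thetal Tl i <= lower_error & \sum_j target p s l j ^+ 2 <= b].

(** One line per exceptional event, in the order in which [Pr_good] removes them. *)
Definition bad_bound : R :=
  2 * near_one_frac p eta +
  (n%:R * avg (fun x => \sum_k p x k ^+ J.+1) ^+ T0 / omega ^+ J.+1 +
  (n%:R * (N%:R * (N.+1%:R / (n - N)%:R)) ^+ 2 +
  (V.+1%:R * ((n%:R * theta + 14 * (V + l).+2%:R ^+ 3) / K) +
  (U.+1%:R * (6 * U.+2%:R ^+ 3 / n%:R / b) +
  ((l%:R * log_sqr p / D ^+ 2 + l.+1%:R * l%:R / n%:R) / g1 +
  ((\sum_(u < V) flat_bound n theta lam l u M) / g1 +
  ((Tl%:R * log_sqr p / D ^+ 2 + Tl.+1%:R * Tl%:R / n%:R) / g1 +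
  (C.+1%:R * (n%:R * local_bound omega eta lam K eps M q) +
   n%:R * local_bound omega eta lam K eps M q)))))))).

Local Notation tr s i := (tree p s omega N i).

Section Quenched.
Variable s : env n.
Hypothesis acyclic : ~ heavy_cycle p eta s.
Hypothesis short : ~ exists x es y, [/\ pathto s x es y, uniq (map fst es),
  size es = T0.+1 & omega <= wprod p es].
Hypothesis coll : ~ exists i, (1 < size (collisions (tr s i)))%N.
Hypothesis sp : ~ exists v : 'I_V.+1,
  K < n%:R * avg (fun y => \sum_j ker p theta l [::] v s y j ^+ 2).
Hypothesis occu : ~ exists u : 'I_U.+1, b < \sum_x occ p s u x ^+ 2.
Hypothesis not_low : ~ g1 < avg (walk p [::] l s (fun c _ => (theta < c)%R%:R) 1).
Hypothesis flat : ~ g1 < \sum_(u < V) \sum_j `|avg (fun y => ker p theta l [::] u.+1 s y j) -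
  avg (fun y => ker p theta l [::] u s y j)|.
Hypothesis avg_lt : ~ g1 < avg (light p s (thetal * gam ^+ C) Tl).
Hypothesis fl_ker : ~ exists k : 'I_C.+1, exists i,
  [/\ settled p omega eta N (tr s i), spread p K theta l V [::] s &
    eps <= fluct (exit_ker p theta l (T0.+1 * k) (tr s i)) (exit_law p (tr s i)) s].
Hypothesis fl_light : ~ exists i, settled p omega eta N (tr s i) /\
  eps <= fluct (light_avoid p Tl (thetal * gam ^+ C) (tr s i)) (exit_law p (tr s i)) s.

Let shortb i es y : pathto s i es y -> uniq (map fst es) ->
  size es = T0.+1 -> wprod p es < omega.
Proof. by move=> pe ue se; rewrite ltNge; apply/negP => om; apply: short; exists i, es, y. Qed.

Let acyclicb x es : pathto s x es x -> uniq (map fst es) -> es != [::] ->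
  exists2 e, e \in es & p e.1 e.2 <= 1 - eta.
Proof.
move=> pe ue e0; apply: contrapT => no; apply: acyclic; exists x, es; split=> // e ee.
by rewrite ltNge; apply/negP => le; apply: no; exists e.
Qed.

Let collb i : (size (collisions (tr s i)) <= 1)%N.
Proof. by rewrite leqNgt; apply/negP => lt; apply: coll; exists i. Qed.

Let settledb i : settled p omega eta N (tr s i).
Proof. exact: (@tree_settled R n p p0 p1 s omega eta T0.+1 N). Qed.

Lemma occ_le u x : (u <= U)%N -> occ p s u x <= Num.sqrt b.
Proof.
move=> uU; rewrite -[leLHS]ger0_norm ?occ_ge0// -sqrtr_sqr ler_wsqrtr//.
apply: (@le_trans _ _ (\sum_x occ p s u x ^+ 2)).
  by apply: (le_term x (F := fun x => occ p s u x ^+ 2)) => y; exact: sqr_ge0.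
by rewrite leNgt; apply/negP => lt; apply: occu; exists (Ordinal (uU : (u < U.+1)%N)).
Qed.

Lemma size_disc_tree i : (size (disc (tr s i)) <= N.+1)%N.
Proof.
have v : valid p omega (tr s i) := valid_run p0 p1 om0 N s (valid_start p0 p1 omega i).
have sz : (size (revealed (tr s i)) <= 0 + N)%N := size_run p omega N s (start R i).
by move: sz; rewrite add0n -ltnS -(v_size v); apply: leq_trans; exact: leq_addr.
Qed.

Lemma avg_hit_tree i w : (w <= U)%N -> avg (hit p (disc (tr s i)) w s) <= hit_bound.
Proof.
move=> wU; have ob u x : (u <= w)%N -> occ p s u x <= Num.sqrt b.
  by move=> uw; apply: occ_le; exact: leq_trans uw wU.
apply: le_trans (avg_hit_le_occ p0 _ ob) _.
rewrite ler_wpM2r ?sqrtr_ge0// ler_nat leq_mul ?ltnS// size_disc_tree//.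
Qed.

Lemma hit_bound_ge0 : 0 <= hit_bound.
Proof. by rewrite mulr_ge0 ?sqrtr_ge0. Qed.

Lemma ker_flat w : (w <= V)%N ->
  \sum_j `|avg (fun y => ker p theta l [::] 0 s y j) - avg (fun y => ker p theta l [::] w s y j)| <= g1.
Proof.
move=> wV; pose a u j := avg (fun y => ker p theta l [::] u s y j).
pose d u := \sum_j `|a u.+1 j - a u j|.
have d0 u : 0 <= d u by apply: sumr_ge0 => j _; exact: normr_ge0.
apply: (@le_trans _ _ (\sum_(u < w) d u)).
  elim: w {wV} => [|w IH]; first by rewrite big_ord0 big1// => j _; rewrite subrr normr0.
  rewrite big_ord_recr/=; apply: le_trans (lerD IH (lexx _)).
  rewrite -big_split/=; apply: ler_sum => j _; rewrite -/(a _ _) -/(a w j) [`|a w.+1 j - _|]distrC.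
  by apply: le_trans (ler_normD _ _); rewrite addrA subrK.
apply: (@le_trans _ _ (\sum_(u < V) d u)); last by rewrite leNgt; apply/negP.
rewrite -(big_mkord xpredT d) -(big_mkord xpredT d) (big_cat_nat (leq0n w) wV)//= lerDl.
by apply: sumr_ge0.
Qed.

(** Three losses: the truncation ([g1], law of large numbers), the change of the averaged kernel
    over [w] steps ([g1], flatness) and the avoidance of the tree ([hit_bound]). *)
Lemma target_flat i w : (w <= V)%N ->
  \sum_j pos (target p s l j - avg (fun y => ker p theta l (disc (tr s i)) w s y j)) <=
  2 * g1 + hit_bound.
Proof.
move=> wV; set S := disc _.
pose a0 j := avg (fun y => ker p theta l [::] 0 s y j).
pose aw j := avg (fun y => ker p theta l [::] w s y j).
pose aS j := avg (fun y => ker p theta l S w s y j).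
have ker_law y j : ker p theta l [::] 0 s y j <= law p [::] l s (dirac R j) y.
  exact: (ker_le_law p0 theta l 0).
have kerS y j : ker p theta l S w s y j <= ker p theta l [::] w s y j by exact: ker_mono.
apply: (@le_trans _ _ (\sum_j ((target p s l j - a0 j) + `|a0 j - aw j| + (aw j - aS j)))).
  apply: ler_sum => j _; apply: pos_le.
    apply: addr_ge0; first apply: addr_ge0; rewrite ?normr_ge0// subr_ge0; apply: avg_le => y;
      [exact: ker_law|exact: kerS].
  rewrite -/(aS j); have := ler_norm (a0 j - aw j); lra.
rewrite big_split/= [X in X + _ <= _]big_split/= (_ : 2 * g1 + hit_bound = g1 + g1 + hit_bound); last by ring.
have leS : \sum_j (aw j - aS j) <= hit_bound.
  rewrite sumrB /aw /aS -!avg_sum -avgB.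
  have wU : (w + l <= U)%N by rewrite leq_add2r.
  apply: le_trans (avg_hit_tree i wU).
  by apply: avg_le => y; rewrite lerBlDl; exact: ker_hit.
apply: (lerD _ leS); apply: (lerD _ (ker_flat wV)).
rewrite sumrB /target /a0 -!avg_sum -avgB.
apply: (@le_trans _ _ (avg (walk p [::] l s (fun c _ => (theta < c)%R%:R) 1))); last first.
  by rewrite leNgt; apply/negP.
apply: avg_le => y; rewrite -law_sum ker_sum /= lerBlDr.
rewrite (law_ext _ _ _ _ _ (g := fun=> 1)); last by move=> z; exact: dirac_sum.
rewrite law_cst//.
suff H t c : 1 <= walk p [::] t s (fun c _ => (theta < c)%R%:R) c y +
    walk p [::] t s (fun c _ => (c <= theta)%R%:R) c y by exact: H.
elim: t c y => [|t IH] c y /=; first by rewrite -natrD ler1n; case: ltP.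
rewrite -big_split/= -[leLHS](p1 y); apply: ler_sum => k _.
by rewrite -mulrDr -[leLHS]mulr1; apply: ler_wpM2l.
Qed.

Lemma typical_good : good s.
Proof.
have hb := hit_bound_ge0.
have spb : spread p K theta l V [::] s.
  by apply/forallP => v; rewrite leNgt; apply/negP => lt; apply: sp; exists v.
split.
- apply: (@defect_iter R n p p0 p1 s omega eta T0.+1 N _ _ _ _ _ _ _ _ collb theta l V
    (2 * g1 + hit_bound) eps) => //.
  + by rewrite addr_ge0// mulr_ge0// ltW.
  + exact: ltW.
  + move=> i w wV; exact: target_flat.
  + move=> i k k0 kC; rewrite leNgt; apply/negP => lt; apply: fl_ker.
    by exists (Ordinal (kC : (k < C.+1)%N)), i; split=> //; exact: ltW.
- apply: (@light_iter R n p p0 p1 s omega eta T0.+1 N _ _ _ _ _ _ _ _ collb Tl gam rho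
    (thetal * gam ^+ C) _ _ _ _ (g1 + hit_bound) eps) => //.
  + by rewrite addr_ge0// ltW.
  + exact: ltW.
  + move=> i; apply: le_trans (avg_le (light_avoid_hit p0 p1 _ _ _ _ _)) _.
    rewrite /avg big_split mulrDr; apply: lerD; first by rewrite leNgt; apply/negP.
    by apply: avg_hit_tree; rewrite (leq_trans Tl_l)// leq_addl.
  + move=> i; rewrite leNgt; apply/negP => lt; apply: fl_light.
    by exists i; split=> //; exact: ltW.
(* [target] is the occupation law at time [l], one of the times covered by [occu]. *)
rewrite leNgt; apply/negP => lt; apply: occu.
by exists (Ordinal (leq_addl V l : (l < U.+1)%N)).
Qed.

End Quenched.

Theorem Pr_good : Pr R (fun s => ~ good s) <= bad_bound.
Proof.
have Mq : (M <= N + q * M)%N by rewrite (leq_trans (leq_pmull M q0))// leq_addl.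
have Mn : (M < n)%N by exact: leq_ltn_trans Ln.
have Nn : (N < n)%N by apply: leq_ltn_trans Ln; exact: leq_addr.
have M2 : (n%:R / (n - M)%:R) ^+ M <= 2 :> R.
  apply: le_trans ML; apply: lerXn2r; rewrite ?nnegrE ?divr_ge0//.
  by rewrite ler_wpM2l// lef_pV2 ?posrE ?ltr0n ?subn_gt0// ler_nat leq_sub2l.
have K0 : 0 < K by exact: lt_le_trans K1.
have thm0 : 0 < thetal * gam ^+ C by rewrite mulr_gt0// exprn_gt0.
rewrite /bad_bound; apply: (Pr_unless (Pr_heavy_cycle n1 al2)).
apply: (Pr_unless (Pr_heavy_path p0 p1 n1 J T0 om0)).
apply: (Pr_unless (Pr_collisions p0 p1 om0 Nn)).
apply: (Pr_unless (Pr_ker p0 p1 n1 l V (ltW theta0) K0)).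
apply: (Pr_unless (Pr_occ p0 p1 n1 U b0)).
apply: (Pr_unless (Pr_not_low p0 p1 n1 D0 g10 theta0 thD)).
apply: (Pr_unless (Pr_flat p0 p1 n1 l V (ltW theta0) lam0 M0 Mn M2 g10)).
apply: (Pr_unless (Pr_light p0 p1 n1 D0 g10 thm0 lD)).
have Pk : Pr R (fun s => exists k : 'I_C.+1, exists i,
    [/\ settled p omega eta N (tr s i), spread p K theta l V [::] s &
      eps <= fluct (exit_ker p theta l (T0.+1 * k) (tr s i)) (exit_law p (tr s i)) s]) <=
    C.+1%:R * (n%:R * local_bound omega eta lam K eps M q).
  rewrite -[X in X%:R * _]card_ord; apply: Pr_exists_le => k.
  apply: (Pr_exit_ker p0 p1 n1 om0 eta0 M0 lam0 K1 eps0 Ln ML theta l (V := V)).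
  by rewrite /V leq_mul2l -ltnS ltn_ord orbT.
apply: (Pr_unless Pk).
apply: le_trans (Pr_light_avoid p0 p1 n1 om0 eta0 M0 lam0 K1 eps0 Ln ML Tl (thetal * gam ^+ C)).
apply: Pr_le => s [h9 [h8 [h7 [h6 [h5 [h4 [h3 [h2 [h1 ng]]]]]]]]].
by apply: contrapT => h10; apply: ng; exact: typical_good.
Qed.

End GoodEnvironment.

(** * Distance to the invariant law *)

Section InvariantLaw.
Variables (R : realType) (n : nat) (P : 'M[R]_n).
Hypotheses (P0 : forall i j, 0 <= P i j) (P1 : forall i, \sum_j P i j = 1).

Lemma stochastic_fixed_row : (0 < n)%N -> exists2 v : 'rV[R]_n, v != 0 & v *m P = v.
Proof.
move=> n0; pose Q := P - 1%:M.
have Q1 : Q *m (const_mx 1 : 'cV[R]_n) = 0.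
  rewrite mulmxBl mul1mx; apply/matrixP => i j; rewrite !mxE.
  by under eq_bigr do rewrite mxE mulr1; rewrite P1 subrr.
have : kermx Q != 0.
  rewrite kermx_eq0; apply/negP => Qf.
  have Qu : Q \in unitmx by rewrite -row_free_unit.
  have /matrixP/(_ (Ordinal n0) 0) : (const_mx 1 : 'cV[R]_n) = 0.
    by rewrite -[LHS]mul1mx -(mulVmx Qu) -mulmxA Q1 mulmx0.
  by rewrite !mxE => /eqP; rewrite oner_eq0.
case/rowV0Pn => v /sub_kermxP vQ v0; exists v => //.
by apply/eqP; rewrite -subr_eq0 -[X in _ - X]mulmx1 -mulmxBr vQ.
Qed.

(** [P - 1] kills the constant column, so it also has a nonzero left kernel, containing some [v].
    Then [|v| <= |v| P] entrywise, and equality of total masses forces equality everywhere. *)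
Lemma invariant_law_exists : (0 < n)%N -> exists pi, invariant_law P pi.
Proof.
move=> n0; have [v v0 vP] := stochastic_fixed_row n0.
have vE j : v 0 j = \sum_i v 0 i * P i j by rewrite -{1}vP mxE.
have le_abs j : `|v 0 j| <= \sum_i `|v 0 i| * P i j.
  rewrite {1}vE; apply: le_trans (ler_norm_sum _ _ _) _.
  by apply: ler_sum => i _; rewrite normrM [`|P i j|]ger0_norm.
have tot : \sum_j (\sum_i `|v 0 i| * P i j - `|v 0 j|) = 0.
  rewrite sumrB exchange_big/=.
  by under eq_bigr do rewrite -mulr_sumr P1 mulr1; rewrite subrr.
have eq_abs j : \sum_i `|v 0 i| * P i j = `|v 0 j|.
  apply/eqP; rewrite -subr_eq0; move: tot => /eqP.
  rewrite psumr_eq0; last by move=> k _; rewrite subr_ge0.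
  by move/allP/(_ j); rewrite mem_index_enum => /(_ isT).
pose Z := \sum_j `|v 0 j|.
have Z0 : 0 < Z.
  rewrite lt_def sumr_ge0 ?andbT//; apply: contra v0 => /eqP Z0.
  apply/eqP/rowP => j; rewrite mxE; apply/eqP; rewrite -normr_eq0.
  move: Z0 => /eqP; rewrite psumr_eq0// => /allP/(_ j); rewrite mem_index_enum => /(_ isT).
  by [].
exists (\row_j (`|v 0 j| / Z)); split.
- by move=> j; rewrite mxE divr_ge0// ltW.
- by under eq_bigr do rewrite mxE; rewrite -mulr_suml mulfV// gt_eqF.
apply/rowP => j; rewrite !mxE -eq_abs mulr_suml; apply: eq_bigr => i _.
by rewrite mxE mulrAC.
Qed.

Lemma invariant_lawX pi T : invariant_law P pi -> pi *m P ^+ T = pi.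
Proof.
case=> _ _ piP; elim: T => [|T IH]; first by rewrite expr0 mulmx1.
by rewrite exprS -[P * _]/(P *m _) mulmxA piP.
Qed.

End InvariantLaw.

Section TotalVariation.
Variables (R : realType) (n : nat).
Implicit Types (mu nu : 'rV[R]_n) (A : {set 'I_n}).

Lemma pos_subN (a : R) : pos a - pos (- a) = a.
Proof.
rewrite /pos; have [a0|/ltW a0] := leP 0 a.
  by rewrite max_r ?subr0// oppr_le0.
by rewrite max_l ?sub0r ?opprK// oppr_ge0.
Qed.

Lemma pos_addN (a : R) : pos a + pos (- a) = `|a|.
Proof.
rewrite /pos; have [a0|/ltW a0] := leP 0 a.
  by rewrite max_r ?addr0 ?ger0_norm// oppr_le0.
by rewrite max_l ?add0r ?ler0_norm// oppr_ge0.
Qed.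

Lemma sum_pos_swap (f g : 'I_n -> R) : \sum_j f j = \sum_j g j ->
  \sum_j pos (f j - g j) = \sum_j pos (g j - f j).
Proof.
move=> fg; apply/eqP; rewrite -subr_eq0 -sumrB.
rewrite (eq_bigr (fun j => f j - g j)); first by rewrite sumrB fg subrr.
by move=> j _; rewrite -(opprB (f j)) pos_subN.
Qed.

Lemma sum_norm_pos (f g : 'I_n -> R) : \sum_j f j = \sum_j g j ->
  \sum_j `|f j - g j| = 2 * \sum_j pos (f j - g j).
Proof.
move=> fg; rewrite mulr_natl mulr2n [X in _ = _ + X]sum_pos_swap// -big_split/=.
by apply: eq_bigr => j _; rewrite -(opprB (f j)) pos_addN.
Qed.

Lemma le_sum_pos (f g : 'I_n -> R) A :
  \sum_(j in A) f j - \sum_(j in A) g j <= \sum_j pos (f j - g j).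
Proof.
rewrite -sumrB [leRHS](bigID (mem A))/= -[leLHS]addr0; apply: lerD.
  by apply: ler_sum => j _; exact: le_pos.
by apply: sumr_ge0 => j _; exact: pos_ge0.
Qed.

Lemma tv_dist_le mu nu : \sum_j mu 0 j = \sum_j nu 0 j ->
  tv_dist mu nu <= \sum_j pos (nu 0 j - mu 0 j).
Proof.
move=> eq1; apply: bigmax_le; first by apply: sumr_ge0 => j _; exact: pos_ge0.
move=> A _; rewrite ler_norml; apply/andP; split.
  by rewrite lerNl opprB; exact: (le_sum_pos (nu 0) (mu 0)).
by rewrite -sum_pos_swap//; exact: (le_sum_pos (mu 0) (nu 0)).
Qed.

Lemma tv_dist_ge mu nu A : \sum_(j in A) mu 0 j - \sum_(j in A) nu 0 j <= tv_dist mu nu.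
Proof.
apply: le_trans (ler_norm _) _.
exact: (le_bigmax _ (fun A : {set 'I_n} => `|\sum_(j in A) mu 0 j - \sum_(j in A) nu 0 j|) A).
Qed.

End TotalVariation.

Section GoodConsequences.
Variables (R : realType) (n : nat) (p : 'M[R]_n).
Hypotheses (p0 : forall i j, 0 <= p i j) (p1 : forall i, \sum_j p i j = 1).
Implicit Types (i x y j : 'I_n).
Variables (s : env n) (l T0 : nat) (d : R).
Hypothesis defect_small : forall i, defect p s l T0 i <= d.
Local Notation P := (trans_mx p s).

Lemma trans_mx_ge0 i j : 0 <= P i j.
Proof. by rewrite mxE. Qed.

Lemma trans_mx_sum i : \sum_j P i j = 1.
Proof.
rewrite -(p1 i) [RHS](reindex_inj (h := ((s i)^-1)%g)); last exact: perm_inj.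
by apply: eq_bigr => j _; rewrite mxE.
Qed.

Lemma trans_mxX_sum T i : \sum_j (P ^+ T) i j = 1.
Proof.
under eq_bigr do rewrite trans_mxX; rewrite -law_sum -[RHS](law_cst p1 T s 1 i).
by apply: law_ext => z; exact: dirac_sum.
Qed.

Lemma target_sum : (0 < n)%N -> \sum_j target p s l j = 1.
Proof.
move=> n0; rewrite -avg_sum (avg_ext (g := fun _ => 1)) ?avg_cst// => z.
by rewrite -law_sum -[RHS](law_cst p1 l s 1 z); apply: law_ext => w; rewrite dirac_sum.
Qed.

Lemma defect_late T i : (T0 <= T)%N ->
  \sum_j pos (target p s l j - (P ^+ T) i j) <= d.
Proof.
move=> le; have := @defect_mono R n p p0 p1 s l T0 T d defect_small le i.
by under [X in _ -> X <= _]eq_bigr do rewrite trans_mxX.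
Qed.

(** The invariant law is a mixture of the rows of [P ^+ T], and the defect is convex. *)
Lemma target_invariant pi T : invariant_law P pi -> (T0 <= T)%N ->
  \sum_j pos (target p s l j - pi 0 j) <= d.
Proof.
move=> ipi le; have [pi0 pi1 _] := ipi.
apply: (@le_trans _ _ (\sum_j \sum_i pi 0 i * pos (target p s l j - (P ^+ T) i j))).
  apply: ler_sum => j _; rewrite -{1}(invariant_lawX T ipi) mxE.
  rewrite -{1}[target _ _ _ _]mul1r -pi1 mulr_suml -sumrB.
  apply: le_trans (pos_sum _ _ _) _; apply: ler_sum => i _.
  by rewrite -mulrBr posM.
rewrite exchange_big/= -[d]mul1r -pi1 mulr_suml; apply: ler_sum => i _.
by rewrite -mulr_sumr ler_wpM2l// defect_late.
Qed.

(** The difference [w] of two invariant laws has total mass zero, so [target] may be subtracted from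
    every row of [P ^+ T0]; the result contracts the L1 norm of [w] by the factor [2 * d < 1]. *)
Lemma good_unique : (0 < n)%N -> d < 2^-1 -> unique_invariant P.
Proof.
move=> n0 d2; have [pi ipi] := invariant_law_exists trans_mx_ge0 trans_mx_sum n0.
exists pi; split=> // pi' ipi'.
have [_ pi1 _] := ipi; have [_ pi1' _] := ipi'.
pose w j := pi 0 j - pi' 0 j; pose Z := \sum_j `|w j|.
have w0 : \sum_j w j = 0 by rewrite sumrB pi1 pi1' subrr.
have wE j : w j = \sum_i w i * ((P ^+ T0) i j - target p s l j).
  under eq_bigr do rewrite mulrBr.
  rewrite sumrB -mulr_suml w0 mul0r subr0 /w.
  rewrite -{1}(invariant_lawX T0 ipi) -{1}(invariant_lawX T0 ipi') !mxE -sumrB.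
  by apply: eq_bigr => i _; rewrite mulrBl.
have Zle : Z <= Z * (2 * d).
  apply: (@le_trans _ _ (\sum_j \sum_i `|w i| * `|target p s l j - (P ^+ T0) i j|)).
    apply: ler_sum => j _; rewrite {1}wE; apply: le_trans (ler_norm_sum _ _ _) _.
    by apply: ler_sum => i _; rewrite normrM [X in _ * X]distrC.
  rewrite exchange_big/= mulr_suml; apply: ler_sum => i _; rewrite -mulr_sumr ler_wpM2l//.
  rewrite sum_norm_pos; last by rewrite target_sum// trans_mxX_sum.
  by rewrite ler_wpM2l// defect_late.
have Z0 : 0 <= Z by apply: sumr_ge0 => j _.
have {Zle}Z0 : Z = 0.
  apply/eqP; rewrite eq_le Z0 andbT; move: Zle Z0; rewrite -/Z; move: (Z) => z; nra.
apply/rowP => j; apply/eqP; rewrite -subr_eq0 -normr_eq0; move: Z0 => /eqP.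
by rewrite psumr_eq0// => /allP/(_ j); rewrite mem_index_enum => /(_ isT).
Qed.

Lemma inv_lawP : unique_invariant P -> invariant_law P (inv_law P).
Proof. by case=> pi [ipi _]; apply: (@xgetPex _ 0 (invariant_law P)); exists pi. Qed.

Lemma good_upper T i : (0 < n)%N -> unique_invariant P -> (T0 <= T)%N ->
  dist_to_inv P T i <= 2 * d.
Proof.
move=> n0 /inv_lawP ipi le; rewrite /dist_to_inv; set pi := inv_law P in ipi *.
have [pi0 pi1 _] := ipi.
apply: le_trans (tv_dist_le _) _.
  by rewrite pi1; under eq_bigr do rewrite mxE; rewrite trans_mxX_sum.
under eq_bigr do rewrite mxE.
apply: (@le_trans _ _ (\sum_j (pos (pi 0 j - target p s l j) +
   pos (target p s l j - (P ^+ T) i j)))).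
  apply: ler_sum => j _; apply: le_trans (posD _ _).
  by rewrite addrA subrK.
rewrite big_split/= mulr_natl mulr2n; apply: lerD; last exact: defect_late.
rewrite sum_pos_swap; first exact: (target_invariant ipi (leqnn T0)).
by rewrite pi1 target_sum.
Qed.

Variables (theta b d' : R) (Tl : nat).
Hypotheses (theta0 : 0 < theta) (b0 : 0 <= b).
Hypothesis target_sqr : \sum_j target p s l j ^+ 2 <= b.
Hypothesis light_small : forall i, light p s theta Tl i <= d'.

(** A path to [j] weighs at most the probability of ending at [j], so walks ending in improbable
    states have a small product. *)
Lemma law_light (B : {set 'I_n}) T c x : 0 <= c ->
  (forall j, j \in B -> c * law p [::] T s (dirac R j) x < theta) ->
  \sum_(j in B) law p [::] T s (dirac R j) x <= walk p [::] T s (below theta) c x.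
Proof.
elim: T c x => [|T IH] c x c0 Bc.
  rewrite /= /below; under eq_bigr do rewrite law0 /=.
  have [xB|xB] := boolP (x \in B); last first.
    rewrite big1 ?ler0n// => j jB; rewrite /dirac; case: eqP => // xj.
    by move: xB; rewrite xj jB.
  have ct : c < theta by have := Bc x xB; rewrite law0 /dirac /= eqxx mulr1.
  rewrite ct (bigD1 x)//= /dirac eqxx big1 ?addr0// => j /andP[_ /negPf jx].
  by rewrite eq_sym jx.
under eq_bigr do rewrite lawS; rewrite exchange_big/=; apply: ler_sum => k _.
rewrite -mulr_sumr ler_wpM2l//; apply: IH; first exact: mulr_ge0.
move=> j jB; apply: le_lt_trans (Bc j jB); rewrite lawS /= -mulrA ler_wpM2l//.
apply: (le_term k (F := fun k => p x k * law p [::] T s (dirac R j) (s x k))) => y.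
by rewrite mulr_ge0// law_ge0// => z; exact: dirac_ge0.
Qed.

(** The states of probability at least [theta] carry mass at least [1 - d'] of the walk and number
    at most [1 / theta]. By Cauchy-Schwarz they carry at most [Num.sqrt (b / theta)] of [target],
    and at most [d] more of the invariant law. *)
Lemma good_lower T i : (0 < n)%N -> unique_invariant P -> (T <= Tl)%N ->
  1 - (d + d' + Num.sqrt (b / theta)) <= dist_to_inv P T i.
Proof.
move=> n0 /inv_lawP ipi le; rewrite /dist_to_inv; set pi := inv_law P in ipi *.
have [pi0 pi1 _] := ipi.
pose L j := law p [::] T s (dirac R j) i.
have L0 j : 0 <= L j by apply: law_ge0 => // z; exact: dirac_ge0.
have L1 : \sum_j L j = 1 by rewrite -[RHS](trans_mxX_sum T i); apply: eq_bigr => j _; rewrite trans_mxX.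
pose A := [set j | theta <= L j].
have LA : 1 - d' <= \sum_(j in A) L j.
  rewrite -L1 (bigID (mem A))/= -addrA gerDl subr_le0.
  rewrite (eq_bigl (mem (~: A))); last by move=> j; rewrite !inE.
  apply: le_trans (light_small i).
  apply: le_trans (light_mono p0 p1 s i theta0 le).
  apply: law_light => // j; rewrite !inE -ltNge mul1r; exact.
have cA : #|A|%:R <= theta^-1.
  rewrite -[leRHS]mul1r ler_pdivlMr// -[leRHS]L1 mulr_natl -sumr_const.
  apply: (@le_trans _ _ (\sum_(j in A) L j)); first by apply: ler_sum => j; rewrite inE.
  by rewrite [leRHS](bigID (mem A))/= lerDl; apply: sumr_ge0.
have tA : \sum_(j in A) target p s l j <= Num.sqrt (b / theta).
  have t0 j : 0 <= target p s l j by apply: avg_ge0 => z; apply: law_ge0 => // w; exact: dirac_ge0.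
  rewrite -[leLHS]ger0_norm ?sumr_ge0// -sqrtr_sqr ler_wsqrtr//.
  pose m := (\sum_(j in A) target p s l j) / #|A|%:R.
  have [A0|A0] := posnP #|A|.
    by rewrite (cards0_eq A0) big_set0 expr0n divr_ge0// ltW.
  have AR : 0 < #|A|%:R :> R by rewrite ltr0n.
  have mA : \sum_(j in A) target p s l j = #|A|%:R * m by rewrite /m mulrC divfK// gt_eqF.
  (* the variance of the target on A is nonnegative *)
  have : 0 <= \sum_(j in A) (target p s l j - m) ^+ 2 by apply: sumr_ge0 => j _; exact: sqr_ge0.
  have -> : \sum_(j in A) (target p s l j - m) ^+ 2 =
      \sum_(j in A) target p s l j ^+ 2 - #|A|%:R * m ^+ 2.
    under eq_bigr do rewrite sqrrB; rewrite big_split sumrB/= sumr_const.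
    by rewrite -mulr_natl sumrMnl -mulr_suml mA; ring.
  rewrite subr_ge0 mA ler_pdivlMr// => var.
  have tb : \sum_(j in A) target p s l j ^+ 2 <= b.
    apply: le_trans target_sqr; rewrite [leRHS](bigID (mem A))/= lerDl.
    by apply: sumr_ge0 => j _; exact: sqr_ge0.
  apply: le_trans (le_trans var tb).
  rewrite (_ : _ * theta = #|A|%:R * theta * (#|A|%:R * m ^+ 2)); last by ring.
  apply: ler_piMl; first by rewrite mulr_ge0 ?sqr_ge0.
  by rewrite -ler_pdivlMr// div1r.
have piA : \sum_(j in A) pi 0 j <= d + Num.sqrt (b / theta).
  have := le_sum_pos (pi 0) (target p s l) A.
  rewrite sum_pos_swap; last by rewrite pi1 target_sum.
  by have := target_invariant ipi (leqnn T0); move: tA; lra.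
apply: le_trans (tv_dist_ge _ _ A).
rewrite (eq_bigr L); last by move=> j _; rewrite mxE trans_mxX.
by move: LA piA; lra.
Qed.

End GoodConsequences.

(** * Choice of the parameters *)

Section PolynomialBounds.
Variable R : realType.

Lemma bernoulli (x : R) M : 0 <= x -> x <= 1 -> 1 - M%:R * x <= (1 - x) ^+ M.
Proof.
move=> x0 x1; elim: M => [|M IH]; first by rewrite mul0r subr0 expr0.
have h : 0 <= M%:R * x * x by rewrite !mulr_ge0.
rewrite exprS; apply: (@le_trans _ _ ((1 - x) * (1 - M%:R * x))).
  by rewrite -[M.+1%:R]natr1; move: h; move: (M%:R) => m; lra.
by rewrite ler_wpM2l// subr_ge0.
Qed.

Lemma exclusion_factor (n m M : nat) : (0 < n)%N -> (2 * (M * m) <= n)%N -> (m < n)%N ->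
  (n%:R / (n - m)%:R) ^+ M <= 2 :> R.
Proof.
move=> n0 Mm mn; have nR : 0 < n%:R :> R by rewrite ltr0n.
have x1 : m%:R / n%:R <= 1 :> R by rewrite ler_pdivrMr// mul1r ler_nat ltnW.
have x0 : 0 <= m%:R / n%:R :> R by rewrite divr_ge0.
have h2 : M%:R * (m%:R / n%:R) <= 2^-1 :> R.
  by rewrite mulrA ler_pdivrMr// ler_pdivlMl// -!natrM ler_nat.
have := bernoulli M x0 x1.
have -> : 1 - m%:R / n%:R = (n - m)%:R / n%:R :> R.
  by rewrite natrB ?(ltnW mn)// mulrBl mulfV// gt_eqF.
rewrite -(invf_div (n - m)%:R (n%:R : R)) exprVn => h.
rewrite -[leRHS]invrK lef_pV2 ?posrE ?invr_gt0//; first by apply: le_trans h; lra.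
by rewrite exprn_gt0// divr_gt0// ltr0n subn_gt0.
Qed.

Lemma half_le_sub n m : (2 * m <= n)%N -> 2^-1 * n%:R <= (n - m)%:R :> R.
Proof. by move=> mn; rewrite ler_pdivrMl// -natrM ler_nat; move: mn; lia. Qed.

Lemma succ_le_double m : (0 < m)%N -> m.+1%:R <= 2 * m%:R :> R.
Proof. by move=> m0; rewrite -natrM ler_nat; move: m0; lia. Qed.

Variables (n a : nat).
Hypotheses (a2 : (2 <= a)%N) (an : (a ^ 41 <= n)%N).
Local Notation x := (a%:R : R).
Local Notation y := (n%:R : R).
Let n0 : (0 < n)%N.
Proof. by apply: leq_trans an; rewrite expn_gt0 (leq_trans _ a2). Qed.
Let y0 : 0 < y. Proof. by rewrite ltr0n. Qed.
Let x2 : 2 <= x. Proof. by rewrite ler_nat. Qed.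
Let x1 : 1 <= x. Proof. exact: le_trans (ltW (ltr1n _ 2)) x2. Qed.
Let x0 : 0 < x. Proof. exact: lt_le_trans x1. Qed.
Let xn k : (k <= 41)%N -> x ^+ k <= y.
Proof.
move=> k41; rewrite -natrX ler_nat; apply: leq_trans an.
by rewrite leq_pexp2l// (leq_trans _ a2).
Qed.

Let xs : (a ^ 10).+1%:R <= 2 * x ^+ 10.
Proof. by rewrite -natrX; apply: succ_le_double; rewrite expn_gt0 (leq_trans _ a2). Qed.

Lemma power_over k m : (k + m <= 41)%N -> x ^+ k / y <= (x ^+ m)^-1.
Proof.
move=> km; rewrite ler_pdivrMr// mulrC ler_pdivlMr ?exprn_gt0// -exprD.
exact: xn.
Qed.

(** Origin of the exponent 41: with [a ^ 10] explored edges the probability of two collisions,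
    summed over the starting vertices, is of order [x ^+ 40 / y], and one more factor [x] is to be
    gained. *)
Lemma collision_bound : y * ((a ^ 10)%N%:R * ((a ^ 10)%N.+1%:R / (n - a ^ 10)%:R)) ^+ 2 <= 16 / x.
Proof.
have N2 : (2 * a ^ 10 <= n)%N.
  apply: leq_trans an; rewrite (@leq_trans (a ^ 11))//; first by rewrite [in leqRHS]expnS leq_mul2r a2 orbT.
  by rewrite leq_pexp2l// (leq_trans _ a2).
have d0 := half_le_sub N2; have s0 := xs.
have dp : 0 < (n - a ^ 10)%:R :> R by apply: lt_le_trans d0; rewrite mulr_gt0// invr_gt0.
apply: (@le_trans _ _ (y * (x ^+ 10 * (2 * x ^+ 10 / (2^-1 * y))) ^+ 2)).
  rewrite ler_wpM2l ?(ltW y0)//; apply: lerXn2r; rewrite ?nnegrE.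
  - by rewrite mulr_ge0// divr_ge0.
  - by rewrite mulr_ge0 ?exprn_ge0 ?divr_ge0 ?mulr_ge0 ?exprn_ge0 ?invr_ge0 ?(ltW x0) ?(ltW y0).
  rewrite natrX ler_wpM2l ?exprn_ge0 ?(ltW x0)//.
  apply: ler_pM; [exact: ler0n|by rewrite invr_ge0 ltW|exact: s0|].
  by rewrite lef_pV2// posrE mulr_gt0 ?invr_gt0.
rewrite (_ : y * _ = 16 * (x ^+ 40 / y)); last by field; rewrite gt_eqF.
by rewrite ler_wpM2l// (power_over (m := 1)).
Qed.

Lemma exclusion_fits q : (4 * q.+1 <= a)%N -> (a ^ 10 + q * a ^ 4 < n)%N /\
  (y / (n - (a ^ 10 + q * a ^ 4))%:R) ^+ (a ^ 4) <= 2.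
Proof.
move=> qa; have a0 : (0 < a)%N by exact: leq_trans a2.
have m1 : (a ^ 10 + q * a ^ 4 <= q.+1 * a ^ 10)%N.
  by rewrite mulSn leq_add2l leq_mul2l leq_pexp2l// orbT.
have m2 : (2 * (a ^ 4 * (a ^ 10 + q * a ^ 4)) <= n)%N.
  apply: leq_trans an; apply: (@leq_trans (a ^ 15)); last by rewrite leq_pexp2l.
  apply: (@leq_trans (2 * (a ^ 4 * (q.+1 * a ^ 10)))); first by rewrite !leq_mul2l m1 !orbT.
  rewrite [X in (_ * X <= _)%N]mulnCA mulnA -expnD [leqRHS]expnS leq_mul2r; apply/orP; right.
  by apply: leq_trans qa; rewrite leq_mul2r orbT.
have lt : (a ^ 10 + q * a ^ 4 < n)%N.
  apply: leq_trans m2; rewrite mulnA -[X in (X < _)%N]mul1n ltn_pmul2r ?addn_gt0 ?expn_gt0 ?a0//.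
  by rewrite (leq_trans _ (leq_pmulr _ _)) ?expn_gt0 ?a0.
by split=> //; exact: exclusion_factor.
Qed.

Variables (W B : R).
Hypotheses (W1 : 1 <= W) (B1 : 1 <= B) (BW : B * W ^+ 5 <= x).
Let W0 : 0 < W. Proof. exact: lt_le_trans W1. Qed.
Let B0 : 0 < B. Proof. exact: lt_le_trans B1. Qed.

(** The errors are polynomials of degree at most five in the times, divided by [x]; [B] is the
    constant margin that remains. *)
Lemma polylog_over c k : 0 <= c -> (k <= 5)%N -> c * W ^+ k / x <= c / B.
Proof.
move=> c0 k5; rewrite -mulrA ler_wpM2l// ler_pdivrMr// mulrC ler_pdivlMr// mulrC.
by apply: le_trans BW; rewrite ler_wpM2l ?(ltW B0)// ler_weXn2l.
Qed.

Lemma const_over c : 0 <= c -> c / x <= c / B.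
Proof. by move=> c0; have := @polylog_over c 0 c0 isT; rewrite expr0 mulr1. Qed.

Lemma ker_bound V l : (V + l).+2%:R <= W ->
  V.+1%:R * ((y * y^-1 + 14 * (V + l).+2%:R ^+ 3) / x) <= 15 / B.
Proof.
move=> lW; rewrite mulfV ?(gt_eqF y0)//.
have V1 : V.+1%:R <= W by apply: le_trans lW; rewrite ler_nat ltnS (leq_trans (leq_addr l V)).
have W3 : 1 <= W ^+ 3 by exact: exprn_ege1.
have l3 : (V + l).+2%:R ^+ 3 <= W ^+ 3 by apply: lerXn2r; rewrite ?nnegrE ?(ltW W0).
apply: le_trans (polylog_over (k := 4) _ _) => //.
rewrite mulrA ler_wpM2r ?invr_ge0 ?(ltW x0)// (_ : 15 * W ^+ 4 = W * (15 * W ^+ 3)); last by ring.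
apply: ler_pM; [exact: ler0n|by rewrite addr_ge0 ?mulr_ge0 ?exprn_ge0|exact: V1|].
move: W3 l3; move: (W ^+ 3) => w; lra.
Qed.

Lemma occ_bound U : U.+2%:R <= W ->
  U.+1%:R * (6 * U.+2%:R ^+ 3 / y / (x / y)) <= 6 / B.
Proof.
move=> UW; have U1 : U.+1%:R <= W by apply: le_trans UW; rewrite ler_nat.
apply: le_trans (polylog_over (c := 6) (k := 4) _ _) => //.
rewrite (_ : _ / (x / y) = 6 * U.+2%:R ^+ 3 / x); last by field; rewrite !gt_eqF.
rewrite mulrA ler_wpM2r ?invr_ge0 ?(ltW x0)// (_ : 6 * W ^+ 4 = W * (6 * W ^+ 3)); last by ring.
apply: ler_pM; [exact: ler0n|by rewrite mulr_ge0 ?exprn_ge0|exact: U1|].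
by rewrite ler_wpM2l// lerXn2r// nnegrE ltW.
Qed.

Lemma flat_sum_bound V l : (V + l).+2%:R <= W ->
  \sum_(u < V) flat_bound n y^-1 x^-1 l u (a ^ 4) <= 50 / B.
Proof.
move=> lW; apply: le_trans (polylog_over (k := 4) _ _) => //.
have Vb : V%:R <= W by apply: le_trans lW; rewrite ler_nat (leq_trans (leq_addr l V))// leqW.
have W3 : W <= W ^+ 3 by rewrite exprS ler_peMr ?(ltW W0)// exprn_ege1.
apply: (@le_trans _ _ (\sum_(u < V) (50 * W ^+ 3 / x))); last first.
  rewrite sumr_const card_ord -[leLHS]mulr_natl [leLHS]mulrA ler_wpM2r ?invr_ge0 ?(ltW x0)//.
  rewrite (_ : 50 * W ^+ 4 = W * (50 * W ^+ 3)); last by ring.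
  by rewrite ler_wpM2r// mulr_ge0// exprn_ge0// ltW.
apply: ler_sum => u _; rewrite /flat_bound; cbv zeta.
have uW : (u + l).+2%:R <= W.
  by apply: le_trans lW; rewrite ler_nat !ltnS leq_add2r ltnW.
set t := (u + l)%N in uW *.
have t0 : t%:R <= W by apply: le_trans uW; rewrite ler_nat leqW.
have t1 : t.+1%:R <= W by apply: le_trans uW; rewrite ler_nat.
have t3 : t.+2%:R ^+ 3 <= W ^+ 3 by apply: lerXn2r; rewrite ?nnegrE ?(ltW W0).
rewrite mulfV ?(gt_eqF y0)//.
have e1 : (1 + 14 * t.+2%:R ^+ 3) / (x^-1 * (a ^ 4)%:R) <= 15 * W ^+ 3 / x.
  rewrite natrX (_ : x^-1 * x ^+ 4 = x ^+ 3); last by field; rewrite gt_eqF.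
  apply: ler_pM; [by rewrite addr_ge0// mulr_ge0// exprn_ge0|by rewrite invr_ge0 exprn_ge0// ltW| |].
    by move: t3 W3 W1; move: (W ^+ 3) => w; lra.
  by rewrite lef_pV2 ?posrE ?exprn_gt0// ler_eXnr.
have e2 : t.+1%:R * (a ^ 4 + t)%:R / y <= 2 * W / x.
  apply: (@le_trans _ _ (W * (2 * x ^+ 4) / y)).
    rewrite ler_wpM2r ?invr_ge0 ?(ltW y0)//.
    apply: ler_pM; [exact: ler0n|exact: ler0n|exact: t1|].
    rewrite natrD natrX (_ : 2 * _ = x ^+ 4 + x ^+ 4); last by ring.
    rewrite lerD2l; apply: le_trans t0 _; apply: (@le_trans _ _ x); last by rewrite ler_eXnr.
    apply: le_trans BW; rewrite exprS mulrCA ler_peMr ?(ltW W0)//.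
    by rewrite -[1]mulr1; apply: ler_pM; rewrite ?ler01//; exact: exprn_ege1.
  rewrite (_ : W * _ / y = 2 * W * (x ^+ 4 / y)); last by ring.
  by rewrite ler_wpM2l ?mulr_ge0 ?(ltW W0)// (power_over (m := 1)).
have e3 : (a ^ 4)%:R * (a ^ 4)%:R / y <= x^-1.
  by rewrite natrX -exprD (power_over (m := 1)).
have e4 : x^-1 <= W ^+ 3 / x by rewrite ler_peMl ?invr_ge0 ?(ltW x0)// exprn_ege1.
have e5 : 2 * W / x <= 2 * (W ^+ 3 / x).
  by rewrite -mulrA ler_wpM2l// ler_wpM2r// invr_ge0 ltW.
have e6 : 15 * W ^+ 3 / x = 15 * (W ^+ 3 / x) by rewrite mulrA.
rewrite -[leRHS]mulrA; have e7 : 0 <= W ^+ 3 / x by apply: le_trans e4; rewrite invr_ge0 ltW.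
move: e1 e2 e3 e4 e5 e6 e7; set z := W ^+ 3 / x; lra.
Qed.

(** Allowing [b] to exceed [1 / n] by a factor [x] still leaves [Num.sqrt b] small against the
    [a ^ 10] explored vertices. *)
Lemma hit_bound_le U : U.+2%:R <= W -> (U.+1 * (a ^ 10).+1)%:R * Num.sqrt (x / y) <= 2 / B.
Proof.
move=> UW; have U1 : U.+1%:R <= W by apply: le_trans UW; rewrite ler_nat.
apply: le_trans (polylog_over (c := 2) (k := 1) _ _) => //.
have sq : Num.sqrt (x / y) <= (x ^+ 12)^-1.
  rewrite -[leRHS]ger0_norm ?invr_ge0 ?exprn_ge0 ?(ltW x0)// -sqrtr_sqr ler_wsqrtr//.
  by rewrite exprVn -exprM (power_over (k := 1) (m := 24)).
have s0 := xs.
apply: (@le_trans _ _ (W * (2 * x ^+ 10) * (x ^+ 12)^-1)).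
  apply: ler_pM; [exact: ler0n|exact: sqrtr_ge0| |exact: sq].
  by rewrite natrM; apply: ler_pM; [exact: ler0n|exact: ler0n|exact: U1|exact: s0].
rewrite (_ : _ / _ = 2 * W * (x ^+ 2)^-1); last by field; rewrite gt_eqF.
by rewrite expr1 ler_wpM2l ?mulr_ge0 ?(ltW W0)// lef_pV2 ?posrE ?exprn_gt0// ler_eXnr.
Qed.

(** Up to constants, a stale batch costs [x ^+ 8 / x ^+ 9] and a fresh fluctuation [1 / x]. The
    moment of order [r.+1] is thus at most [(c / x) ^+ r.+1], against at most [(2 * x) ^+ r]
    starting vertices: one factor [1 / x] is left. *)
Lemma local_bound_le r C (eta e c : R) : 0 < eta -> 0 < e -> (n < a.+1 ^ r)%N ->
  c = (2 * r.+1%:R / eta + 4) / e ->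
  C%:R * (y * local_bound (x ^+ 9)^-1 eta x^-1 x e (a ^ 4) r.+1) <=
  C%:R * 2 ^+ r * c ^+ r.+1 / B.
Proof.
move=> eta0 e0 nr cE.
have c0 : 0 <= c by rewrite cE divr_ge0 ?addr_ge0 ?divr_ge0 ?mulr_ge0 ?(ltW eta0) ?(ltW e0).
apply: le_trans (const_over _); last by rewrite !mulr_ge0 ?exprn_ge0.
have lb : local_bound (x ^+ 9)^-1 eta x^-1 x e (a ^ 4) r.+1 <= (c / x) ^+ r.+1.
  apply: lerXn2r; rewrite ?nnegrE ?divr_ge0 ?(ltW x0)//.
    rewrite addr_ge0 ?mulr_ge0 ?addr_ge0 ?invr_ge0 ?exprn_ge0 ?mulr_ge0 ?invr_ge0 ?(ltW x0) ?(ltW eta0)//.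
    by rewrite (ltW e0).
  rewrite cE [leRHS]mulrAC; apply: ler_wpM2r; first by rewrite invr_ge0 ltW.
  rewrite natrM natrX [leRHS]mulrDl.
  have -> : 2 * (x ^+ 4 * (r.+1%:R * x ^+ 4) * ((x ^+ 9)^-1 / eta)) = 2 * r.+1%:R / eta / x.
    by field; rewrite !gt_eqF.
  have -> : x / (x^-1 * x ^+ 4) = (x ^+ 2)^-1 by field; rewrite !gt_eqF.
  have : (x ^+ 2)^-1 <= x^-1 by rewrite lef_pV2 ?posrE ?exprn_gt0// ler_eXnr.
  by lra.
have yb : y <= 2 ^+ r * x ^+ r.
  rewrite -exprMn; apply: (@le_trans _ _ (a.+1%:R ^+ r)); first by rewrite -natrX ler_nat ltnW.
  by apply: lerXn2r; rewrite ?nnegrE ?mulr_ge0//; apply: succ_le_double; exact: leq_trans a2.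
apply: (@le_trans _ _ (C%:R * (2 ^+ r * x ^+ r * (c / x) ^+ r.+1))).
  rewrite ler_wpM2l//; apply: ler_pM => //.
  by rewrite exprn_ge0// divr_ge0 ?(ltW e0)// addr_ge0 ?mulr_ge0 ?addr_ge0 ?invr_ge0 ?exprn_ge0
    ?mulr_ge0 ?invr_ge0 ?(ltW x0) ?(ltW eta0).
rewrite expr_div_n [x ^+ r.+1]exprS; apply: eqle; field.
by rewrite gt_eqF//= gt_eqF// exprn_gt0.
Qed.

End PolynomialBounds.

(* With [a] close to [n ^ (1 / r)]: explored edges have weight at least
   [a ^- 9], the trees have at most [a ^ 10] edges, and fluctuations are
   averaged over batches of [a ^ 4] exits. [W] bounds all the times involved
   and [a] exceeds a large multiple of [W ^ 5]. *)
Section Scale.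
Variables (R : realType) (n : nat) (p : 'M[R]_n).
Hypotheses (p0 : forall i j, 0 <= p i j) (p1 : forall i, \sum_j p i j = 1).
Hypothesis n1 : (1 < n)%N.
Implicit Types (s : env n) (i : 'I_n).

(** A single event, for all starting vertices and all times at once, from which the three
    conclusions are drawn. *)
Definition cutoff (delta eps : R) s : Prop := unique_invariant (trans_mx p s) /\
  forall i t,
    ((1 + delta) * t_ent p <= t%:R -> dist_to_inv (trans_mx p s) t i <= eps) /\
    (t%:R <= (1 - delta) * t_ent p -> 1 - eps <= dist_to_inv (trans_mx p s) t i).

Local Notation X := (ln n%:R : R).
Local Notation H := (avg_entropy p).
Variables (delta eps zeta eta kappa cW W B c : R) (a r C J T0 l Tl : nat).
Local Notation x := (a%:R : R).
Local Notation y := (n%:R : R).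
Local Notation g1 := (eta * eps / 64).
Local Notation V := (T0.+1 * C)%N.
Hypotheses (delta0 : 0 < delta) (delta2 : delta <= 2^-1) (eps0 : 0 < eps) (eps1 : eps < 1).
Hypotheses (zeta0 : 0 < zeta) (zeta1 : zeta <= 1).
Hypotheses (eta0 : 0 < eta) (eta2 : eta <= 2^-1) (al : near_one_frac p eta <= zeta / 8).
Hypothesis etaC : (1 - eta) ^+ C <= eps / 8.
Hypothesis t_ent0 : 0 < t_ent p.
Hypotheses (arn : (a ^ r <= n)%N) (nar : (n < a.+1 ^ r)%N) (r41 : (41 <= r)%N).
Hypotheses (rJ : (9 * J.+1 <= r)%N) (rC : (3 + 10 * C)%:R <= r%:R * (delta / 2)).
Hypothesis ra : (4 * r.+2 <= a)%N.
Hypotheses (hl : (1 + delta / 3) * X <= l%:R * H) (hTl : Tl%:R * H <= (1 - delta) * X).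
Hypothesis hup : (l + V)%:R <= (1 + delta) * t_ent p.
Hypotheses (T0Tl : (T0 < Tl)%N) (Tll : (Tl <= l)%N).
Hypothesis lowTl : forall t : nat, t%:R <= (1 - delta) * t_ent p -> (t <= Tl)%N.
Hypotheses (VW : (V + l).+2%:R <= W) (T0W : T0.+1%:R <= W) (WX : W <= cW * X).
Hypothesis beta : y ^+ 4 * avg (fun z => \sum_k p z k ^+ J.+1) ^+ T0 <= 1.
Hypothesis rowL : forall z, \sum_k p z k * ln (p z k) ^+ 2 <= kappa * X.
Hypotheses (kap0 : 0 <= kappa) (kap1 : 16 * cW * kappa / delta ^+ 2 <= g1 * zeta / 32).
Hypothesis kap2 : 4 * r%:R ^+ 2 * cW * kappa <= g1.
Hypotheses (BW : B * W ^+ 5 <= x) (hB2 : 50 / B <= g1 * zeta / 16) (B0 : 0 < B).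
Hypotheses (cE : c = (2 * r.+1%:R / eta + 4) / g1).
Hypothesis hB3 : C.+2%:R * 2 ^+ r * c ^+ r.+1 / B <= zeta / 16.

Let n0 : (0 < n)%N. Proof. exact: ltnW. Qed.
Let y0 : 0 < y. Proof. by rewrite ltr0n. Qed.
Let X0 : 0 < X. Proof. by rewrite ln_gt0// ltr1n. Qed.
Let a2 : (2 <= a)%N. Proof. by apply: leq_trans ra; rewrite -[2%N]/(2 * 1)%N leq_mul. Qed.
Let x1 : 1 <= x. Proof. by rewrite ler1n (leq_trans _ a2). Qed.
Let x0 : 0 < x. Proof. exact: lt_le_trans x1. Qed.
Let an : (a ^ 41 <= n)%N.
Proof. by apply: leq_trans arn; rewrite leq_pexp2l// (leq_trans _ a2). Qed.
Let r0 : 0 < r%:R :> R. Proof. by rewrite ltr0n (leq_trans _ r41). Qed.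
Let W1 : 1 <= W. Proof. by apply: le_trans T0W; rewrite ler1n. Qed.
Let W0 : 0 < W. Proof. exact: lt_le_trans W1. Qed.
Let g0 : 0 < g1. Proof. by rewrite divr_gt0// mulr_gt0. Qed.
Let g1_le : g1 <= eps / 128.
Proof. by move: eta2 eta0 eps0; move: (eta) (eps) => u v; nra. Qed.
Let gz : g1 * zeta <= g1. Proof. by rewrite ler_piMr// ltW. Qed.
Let gz' : g1 * zeta <= zeta / 128.
Proof. by move: g1_le zeta0 eps1; move: (eta * eps / 64) (zeta) => u v; nra. Qed.
Let gz0 : 0 < g1 * zeta. Proof. exact: mulr_gt0. Qed.
Let hB1 : 1 / B <= g1 * zeta / 800.
Proof. by move: hB2; rewrite mul1r; move: (B^-1) (g1 * zeta) => b w; lra. Qed.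
Let hBk k : k%:R / B = k%:R * (1 / B) :> R. Proof. by rewrite mul1r. Qed.
Let B1 : 1 < B.
Proof.
rewrite -invf_lt1// -div1r; apply: le_lt_trans hB1 _.
by move: gz' zeta1; move: (g1 * zeta) => w; lra.
Qed.
Let B1' : 1 <= B. Proof. exact: ltW. Qed.
Let lnx : r%:R * ln x <= X.
Proof. by rewrite mulr_natl -lnXn ?ltr0n ?(leq_trans _ a2)// ler_ln ?posrE ?exprn_gt0// -natrX ler_nat. Qed.
Let lnx' : X <= 2 * r%:R * ln x.
Proof.
have -> : 2 * r%:R * ln x = ln ((x ^+ 2) ^+ r).
  by rewrite -exprM lnXn// -[RHS]mulr_natl natrM.
rewrite ler_ln ?posrE ?exprn_gt0// -natrX -natrX ler_nat; apply: leq_trans (ltnW nar) _.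
rewrite leq_exp2r ?(leq_trans _ r41)// -addn1 expnS expn1.
by apply: (@leq_trans (2 * a)); [rewrite mul2n -addnn leq_add2l (leq_trans _ a2)|rewrite leq_mul2r a2 orbT].
Qed.
Let lnx0 : 0 < ln x.
Proof. by rewrite ln_gt0// ltr1n. Qed.
Let cW0 : 0 <= cW.
Proof. by rewrite -(pmulr_lge0 _ X0); apply: le_trans WX; exact: ltW. Qed.

(** [D] is of order [X], there are at most [cW * X] steps and [log_sqr <= kappa * X], so the
    variance ratio is of order [kappa]. This and [tail_bound] are the two uses of the o(log n)
    assumption. *)
Lemma lln_bound T D : T.+1%:R <= W -> D = delta * X / 4 ->
  (T%:R * log_sqr p / D ^+ 2 + T.+1%:R * T%:R / y) / g1 <= zeta / 16.
Proof.
move=> TW DE; rewrite ler_pdivrMr//.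
have TW' : T%:R <= W by apply: le_trans TW; rewrite ler_nat.
have h1 : T%:R * log_sqr p / D ^+ 2 <= 16 * cW * kappa / delta ^+ 2.
  have ls : log_sqr p <= kappa * X.
    by rewrite -(avg_cst (kappa * X) n0); apply: avg_le => z; exact: rowL.
  have D2 : 0 < D ^+ 2 by rewrite DE exprn_gt0// divr_gt0// mulr_gt0.
  rewrite ler_pdivrMr//; apply: (@le_trans _ _ (cW * X * (kappa * X))).
    apply: (@le_trans _ _ (T%:R * (kappa * X))); first by rewrite ler_wpM2l.
    by rewrite ler_wpM2r ?mulr_ge0 ?(ltW X0)// (le_trans TW').
  by apply: eqle; rewrite DE; field; rewrite gt_eqF.
have h2 : T.+1%:R * T%:R / y <= 1 / B.
  have h := polylog_over a2 W1 B1' BW (c := 1) (k := 2) ler01 isT.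
  apply: le_trans h; rewrite mul1r expr2; apply: ler_pM.
  - by rewrite mulr_ge0.
  - by rewrite invr_ge0 ltW.
  - by apply: ler_pM.
  rewrite lef_pV2 ?posrE// ler_nat; apply: leq_trans an.
  by rewrite -[X in (X <= _)%N]expn1 leq_pexp2l// (leq_trans _ a2).
move: h1 h2 hB1 kap1 gz0; rewrite [zeta / 16 * _](_ : _ = g1 * zeta / 16); last by ring.
move: (g1 * zeta) => w; lra.
Qed.

(** [9 * J.+1 <= r] keeps the inverse of [omega ^+ J.+1] below [n], well within the factor [n ^+ 4]
    granted by [beta]. *)
Lemma path_bound : y * avg (fun z => \sum_k p z k ^+ J.+1) ^+ T0 / (x ^+ 9)^-1 ^+ J.+1 <= zeta / 16.
Proof.
have bt := beta; rewrite exprVn invrK -exprM; set b := avg _ ^+ _ in bt *.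
have b0 : 0 <= b.
  by apply: exprn_ge0; apply: avg_ge0 => z; apply: sumr_ge0 => k _; exact: exprn_ge0.
have xJ : x ^+ (9 * J.+1) <= y.
  by rewrite -natrX ler_nat; apply: leq_trans arn; rewrite leq_pexp2l// (leq_trans _ a2).
apply: (@le_trans _ _ (1 / B)); last by move: hB1 gz' zeta0; lra.
apply: (@le_trans _ _ (y ^+ 2 * b)).
  rewrite (_ : y ^+ 2 * b = y * b * y); last by ring.
  by rewrite ler_wpM2l// mulr_ge0// ltW.
apply: (@le_trans _ _ (1 / y)).
  rewrite ler_pdivlMr//; apply: le_trans bt.
  rewrite mulrAC -exprSr ler_wpM2r// ler_weXn2l// ler1n//.
apply: le_trans (const_over a2 W1 B1' BW (c := 1) ler01).
rewrite !mul1r lef_pV2 ?posrE// ler_nat; apply: leq_trans an.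
by rewrite -[X in (X <= _)%N]expn1 leq_pexp2l// (leq_trans _ a2).
Qed.

(** Here [gam * omega = x]; a label below [1 / x] has squared logarithm at least [ln x ^+ 2], so
    Markov's inequality applies within the row. *)
Lemma tail_bound z : \sum_(k | p z k < (x ^+ 10 * (x ^+ 9)^-1)^-1) p z k <=
  kappa * X / ln x ^+ 2.
Proof.
have -> : x ^+ 10 * (x ^+ 9)^-1 = x by field; rewrite gt_eqF.
have l2 : 0 < ln x ^+ 2 by exact: exprn_gt0.
rewrite ler_pdivlMr// mulr_suml; apply: le_trans (rowL z).
rewrite big_mkcond/=; apply: ler_sum => k _; case: ifP => [pk|_]; last first.
  by rewrite mulr_ge0// sqr_ge0.
have [->|pz] := eqVneq (p z k) 0; first by rewrite !mul0r.
have pz0 : 0 < p z k by rewrite lt_def pz p0.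
rewrite ler_wpM2l// -[leRHS]sqrrN; apply: lerXn2r; rewrite ?nnegrE ?(ltW lnx0)//.
  by rewrite oppr_ge0 ln_le0// (le_trans (ltW pk))// invf_le1.
by rewrite -lnV ?posrE// ler_ln ?posrE ?invr_gt0// -[leLHS]invrK lef_pV2 ?posrE ?invr_gt0// ltW.
Qed.

Lemma heavy_tail_bound : T0.+1%:R * (kappa * X / ln x ^+ 2) <= g1.
Proof.
apply: le_trans kap2; rewrite mulrA ler_pdivrMr ?exprn_gt0//.
apply: (@le_trans _ _ (cW * X * (kappa * X))).
  by rewrite ler_wpM2r ?mulr_ge0 ?(ltW X0)// (le_trans T0W).
rewrite (_ : 4 * _ * _ * _ * _ = cW * kappa * (2 * r%:R * ln x) ^+ 2); last by ring.
rewrite (_ : cW * X * _ = cW * kappa * X ^+ 2); last by ring.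
rewrite ler_wpM2l ?mulr_ge0//; apply: lerXn2r; rewrite ?nnegrE ?(ltW X0)//.
by rewrite !mulr_ge0 ?(ltW lnx0).
Qed.

Let D := delta * X / 4.
(** Large enough that [b / thetal = x ^- 2], small enough that [thetal * gam ^+ C] is at most [n] to
    the power [delta / 2 - 1]. *)
Let thetal := x ^+ 3 / y.

Let D0 : 0 < D. Proof. by rewrite divr_gt0// mulr_gt0. Qed.

Lemma ln_target : D <= ln y^-1 + l%:R * H.
Proof.
rewrite lnV ?posrE//; move: hl; rewrite /D; have := mulr_gt0 delta0 X0; move: (l%:R * H) => w.
lra.
Qed.

Lemma ln_light : ln (thetal * (x ^+ 10) ^+ C) + Tl%:R * H <= - D.
Proof.
have -> : ln (thetal * (x ^+ 10) ^+ C) = (3 + 10 * C)%:R * ln x - X.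
  rewrite /thetal mulrAC -exprM -exprD lnM ?posrE ?invr_gt0 ?exprn_gt0// lnV ?posrE// lnXn//.
  by rewrite mulr_natl.
have : (3 + 10 * C)%:R * ln x <= delta / 2 * X.
  apply: (@le_trans _ _ (r%:R * (delta / 2) * ln x)); first by rewrite ler_wpM2r ?(ltW lnx0).
  by rewrite mulrAC mulrC ler_wpM2l// divr_ge0 ?(ltW delta0).
move: hTl; rewrite /D; have := mulr_gt0 delta0 X0; move: (Tl%:R * H) (_ * ln x) => u v.
lra.
Qed.

Lemma Pr_cutoff : Pr R (fun s => ~ cutoff delta eps s) <= zeta.
Proof.
have [Ln ML] := exclusion_fits R a2 an ra.
have UW : (V + l).+2%:R <= W by [].
have N_large : T0.+1%:R < (a ^ 10)%:R * (x ^+ 9)^-1 :> R.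
  rewrite natrX (_ : x ^+ 10 * _ = x); last by field; rewrite gt_eqF.
  apply: (lt_le_trans _ BW); apply: (le_lt_trans T0W).
  apply: (@lt_le_trans _ _ (B * W)); first by rewrite ltr_pMl.
  by rewrite ler_wpM2l ?(ltW B0)// ler_eXnr.
have a0 : (0 < a)%N by exact: leq_trans a2.
have om0 : 0 < (x ^+ 9)^-1 by rewrite invr_gt0 exprn_gt0.
have om1 : (x ^+ 9)^-1 <= 1 by rewrite invf_le1 ?exprn_gt0// exprn_ege1.
have al2 : near_one_frac p eta <= 2^-1 by move: al zeta1; lra.
have M0 : (0 < a ^ 4)%N by rewrite expn_gt0 a0.
have lam0 : 0 < x^-1 by rewrite invr_gt0.
have th0 : 0 < y^-1 by rewrite invr_gt0.
have b0 : 0 < x / y by rewrite divr_gt0.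
have gm0 : 0 < x ^+ 10 by exact: exprn_gt0.
have gm1 : 1 <= x ^+ 10 * (x ^+ 9)^-1.
  by rewrite (_ : x ^+ 10 * _ = x)//; field; rewrite gt_eqF.
have rho0 : 0 <= kappa * X / ln x ^+ 2 by rewrite divr_ge0 ?sqr_ge0// mulr_ge0// ltW.
have tl0 : 0 < thetal by rewrite divr_gt0// exprn_gt0.
have main := Pr_good p0 p1 n1 J om0 om1 eta0 eta2 al2 M0 (ltn0Sn _) lam0 x1 g0 Ln ML N_large
  th0 D0 g0 b0 ln_target gm0 gm1 rho0 tl0 tail_bound ln_light T0Tl Tll.
apply: le_trans (le_trans main _).
  apply: Pr_le => s nc gd; apply: nc; move: gd => [up lw tg].
  have hb : hit_bound (a ^ 10) T0 C l (x / y) <= g1.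
    apply: le_trans (hit_bound_le a2 an W1 B1' BW UW) _.
    by move: hB1 gz gz0; rewrite hBk; lra.
  (* [4 * g1 / eta = eps / 16] explains the 64 in [g1]; the other [eps / 8] comes from [etaC]. *)
  have eE (z : R) : z <= 4 * g1 -> z / eta + (1 - eta) ^+ C <= 3 * eps / 16.
    move=> z4; have : z / eta <= eps / 16.
      by rewrite ler_pdivrMr//; move: z4; lra.
    by move: etaC; lra.
  have du i : defect p s l (l + V) i <= 3 * eps / 16.
    by apply: le_trans (up i) _; apply: eE; move: hb; lra.
  have dl i : light p s thetal Tl i <= 3 * eps / 16.
    by apply: le_trans (lw i) _; apply: eE; move: hb heavy_tail_bound; lra.
  have uq : unique_invariant (trans_mx p s).
    by apply: (good_unique p0 p1 du n0); move: eps1; lra.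
  split=> // i t; split=> [tl|/lowTl tl].
    have lt : (l + V <= t)%N by rewrite -(ler_nat R) (le_trans hup).
    by apply: le_trans (good_upper p0 p1 du i n0 uq lt) _; move: eps0; lra.
  apply: le_trans (good_lower p0 p1 du tl0 (ltW b0) tg dl i n0 uq tl).
  have -> : x / y / thetal = (x^-1) ^+ 2 by rewrite /thetal; field; rewrite !gt_eqF.
  rewrite sqrtr_sqr ger0_norm ?invr_ge0 ?(ltW x0)//.
  have : x^-1 <= eps / 4.
    rewrite -div1r; apply: le_trans (const_over a2 W1 B1' BW (c := 1) ler01) _.
    by move: hB1 gz g1_le eps0; lra.
  lra.
rewrite /bad_bound.
have lW : l.+1%:R <= W by apply: le_trans VW; rewrite ler_nat ltnS (leq_trans (leq_addl V l)).
have TW : Tl.+1%:R <= W by apply: le_trans lW; rewrite ler_nat.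
have b1 := path_bound.
have b2 := le_trans (collision_bound R a2 an) (const_over a2 W1 B1' BW (c := 16) (ler0n _ _)).
have b3 := ker_bound a2 an W1 B1' BW VW.
have b4 := occ_bound a2 an W1 B1' BW UW.
have b5 := lln_bound lW (erefl D).
have b6 : (\sum_(u < V) flat_bound n y^-1 x^-1 l u (a ^ 4)) / g1 <= zeta / 16.
  rewrite ler_pdivrMr//; apply: le_trans (flat_sum_bound a2 an W1 B1' BW VW) _.
  by move: hB2; lra.
have b7 := lln_bound TW (erefl D).
have b8 := le_trans (local_bound_le a2 W1 B1' BW C.+2 eta0 g0 nar cE) hB3.
have kB k : (k <= 16)%N -> k%:R / B <= zeta / 16.
  move=> k16; have kR : k%:R <= 16 :> R by rewrite ler_nat.
  apply: (@le_trans _ _ (16 / B)); first by rewrite ler_wpM2r// invr_ge0 ltW.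
  by rewrite hBk; move: hB1 gz' zeta0; lra.
set t := y * local_bound _ _ _ _ _ _ _ in b8 *.
rewrite (_ : C.+1%:R * t + t = C.+2%:R * t); last by rewrite -[C.+2%:R]natr1 mulrDl mul1r.
pose z := zeta / 16.
(* Budget: [zeta / 4] for heavy cycles and [zeta / 16] for each of eight further terms, the two
   kinds of local fluctuations forming one of them. *)
apply: (@le_trans _ _ (zeta / 4 + (z + (z + (z + (z + (z + (z + (z + z)))))))));
  last by rewrite /z; move: zeta0; lra.
apply: lerD; first by move: al; lra.
apply: (lerD b1); apply: lerD; first exact: le_trans b2 (kB 16%N _).
apply: lerD; first exact: le_trans b3 (kB 15%N _).
apply: lerD; first exact: le_trans b4 (kB 6%N _).
by apply: (lerD b5); apply: (lerD b6); apply: (lerD b7).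
Qed.

End Scale.

(** * Consequences of the assumptions for large n *)

Section Eventually.
Local Open Scope classical_set_scope.
Variables (R : realType) (p : forall n, 'M[R]_n).
Hypotheses (p0 : forall n (i j : 'I_n), 0 <= p n i j).
Hypotheses (p1 : forall n (i : 'I_n), \sum_(j < n) p n i j = 1).
Hypotheses (sp : sparse p) (nd : non_degenerate p).

Lemma near_one_small (kappa bound : R) : 0 < kappa -> 0 < bound ->
  exists2 e : R, 0 < e < bound & \forall n \near \oo, near_one_frac (p n) e <= kappa.
Proof.
move=> k0 b0.
have : \forall e \near (0:R)^'+, (limn_esup (fun n => (near_one_frac (p n) e)%:E) < kappa%:E)%E.
  have k0E : ((0 : \bar R) < kappa%:E)%E by rewrite lte_fin.
  exact: (nd (open_ereal_lt' k0E)).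
move=> lim.
have [e [[le e0] eb]] : exists e, (((limn_esup (fun n => (near_one_frac (p n) e)%:E) < kappa%:E)%E /\
    0 < e) /\ e < bound).
  apply: (@filter_ex _ ((0:R)^'+)); apply: filterI; first apply: filterI => //.
    exact: nbhs_right_gt.
  exact: nbhs_right_lt.
exists e; first by rewrite e0 eb.
move: le; rewrite limn_esup_lim (cvg_lim _ (@cvg_esups_inf R _))//.
move=> /ereal_inf_lt[_ [N _ <-] lt]; exists N => // n /= Nn.
rewrite -lee_fin; apply: le_trans (ltW lt).
by apply: ereal_sup_ubound; exists n.
Qed.

Lemma entropy_bounded : exists2 h : R, 0 < h & \forall n \near \oo, avg_entropy (p n) <= h.
Proof.
have [/eqOP bO _] := sp.
have [h [h0 hb]] : exists h : R, 0 < h /\ \forall n \near \oo,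
    `|avg_entropy (p n) : R^o| <= h * `|(1 : R^o)|.
  apply: (@filter_ex _ (+oo_R)); apply: filterI; last exact: bO.
  exact: nbhs_pinfty_gt.
exists h => //; apply: filterS hb => n; rewrite normr1 mulr1; apply: le_trans; exact: ler_norm.
Qed.

Lemma log_sqr_small (kappa : R) : 0 < kappa -> \forall n \near \oo, forall i : 'I_n,
  \sum_k p n i k * ln (p n i k) ^+ 2 <= kappa * ln n%:R.
Proof.
move=> k0; have [_ /eqoP so] := sp; apply: filterS (so _ k0) => n h i.
have l0 : 0 <= ln n%:R :> R.
  by case: n h i => [_ []//|n _ _]; rewrite ln_ge0// ler1n.
rewrite (ger0_norm l0) in h; apply: le_trans h; apply: le_trans (ler_norm _).
exact: (le_bigmax _ (fun i => \sum_k p n i k * ln (p n i k) ^+ 2) i).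
Qed.

(** [- ln u >= 1 - u] bounds the entropy of a row below by the sum of [p * (1 - p)], which is at
    least [e] when no entry exceeds [1 - e]. *)
Lemma entropy_lower (n : nat) (e : R) : (0 < n)%N -> 0 < e ->
  e * (1 - near_one_frac (p n) e) <= avg_entropy (p n).
Proof.
move=> n0 e0; have nR : 0 < n%:R :> R by rewrite ltr0n.
have p_le1 (i k : 'I_n) : p n i k <= 1 by rewrite -(p1 i) (bigD1 k)//= lerDl sumr_ge0.
have term (i k : 'I_n) : p n i k * (1 - p n i k) <= - (p n i k * ln (p n i k)).
  have [->|pz] := eqVneq (p n i k) 0; first by rewrite !mul0r oppr0.
  have pp : 0 < p n i k by rewrite lt_def pz p0.
  rewrite -mulrN ler_wpM2l// lerNr.
  by have := @le_ln1Dx R (p n i k - 1); rewrite [1 + _]addrC subrK opprB => h; apply: h; lra.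
have row (i : 'I_n) : e * (1 - \sum_k (1 - e < p n i k)%R%:R) <=
    \sum_k - (p n i k * ln (p n i k)).
  apply: (@le_trans _ _ (\sum_k p n i k * (1 - p n i k))); last by apply: ler_sum.
  have [[k hk]|no] := pselect (exists k, 1 - e < p n i k).
    apply: (@le_trans _ _ 0).
      rewrite pmulr_rle0// subr_le0 (bigD1 k)//= hk lerDl.
      by apply: sumr_ge0 => j _; rewrite ler0n.
    by apply: sumr_ge0 => j _; rewrite mulr_ge0 ?subr_ge0.
  rewrite big1 ?subr0 ?mulr1; last first.
    by move=> k _; case: ltP => // h; case: no; exists k.
  rewrite -[leLHS]mulr1 -[X in e * X <= _](p1 i) mulr_sumr; apply: ler_sum => k _.
  rewrite mulrC ler_wpM2l//; case: (ltP (1 - e) (p n i k)) => h; last by rewrite lerBrDr addrC -lerBrDr.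
  by case: no; exists k.
rewrite /avg_entropy -[leRHS]mulrN -[X in _ <= _ * X]sumrN /near_one_frac.
apply: (@le_trans _ _ (n%:R^-1 * \sum_(i < n) e * (1 - \sum_k (1 - e < p n i k)%R%:R))).
  by rewrite -mulr_sumr sumrB sumr_const card_ord [leRHS]mulrCA [n%:R^-1 * (_ - _)]mulrBr mulVf ?lexx ?gt_eqF.
by rewrite ler_wpM2l ?invr_ge0 ?(ltW nR)//; apply: ler_sum => i _; rewrite -[leRHS]sumrN.
Qed.

Lemma entropy_away : exists2 h : R, 0 < h & \forall n \near \oo, h <= avg_entropy (p n).
Proof.
have [e /andP[e0 _] near] := @near_one_small 2^-1 1 ltac:(lra) ltr01.
exists (e / 2); first by rewrite divr_gt0.
near=> n; have n0 : (0 < n)%N by near: n; exact: nbhs_infty_gt.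
apply: le_trans (entropy_lower n0 e0).
have h : near_one_frac (p n) e <= 2^-1 by near: n.
by rewrite ler_wpM2l ?(ltW e0)//; lra.
Unshelve. all: by end_near.
Qed.

Lemma ln_unbounded (b : R) : \forall n \near \oo, b <= ln n%:R.
Proof.
near=> n; have h : expR b <= n%:R by near: n; exact: nbhs_infty_ger.
rewrite -[b]expRK ler_ln// posrE ?expR_gt0//.
exact: lt_le_trans (expR_gt0 b) h.
Unshelve. all: by end_near.
Qed.

Lemma pow_le_expR (m : nat) (z : R) : 0 <= z -> z ^+ m.+1 <= m.+1%:R ^+ m.+1 * expR z.
Proof.
move=> z0; have m0 : 0 < m.+1%:R :> R by rewrite ltr0n.
have -> : z = m.+1%:R * (z / m.+1%:R) by rewrite mulrC divfK// gt_eqF.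
rewrite exprMn expRM_natl ler_wpM2l ?exprn_ge0//.
apply: lerXn2r; rewrite ?nnegrE ?expR_ge0 ?divr_ge0//.
apply: le_trans (expR_ge1Dx _); by rewrite lerDr.
Qed.

Lemma polylog_le (m : nat) (b : R) : 0 <= b -> \forall n \near \oo, b * ln n%:R ^+ m <= n%:R.
Proof.
move=> b0; near=> n.
have n0 : (0 < n)%N by near: n; exact: nbhs_infty_gt.
have nR : 0 < n%:R :> R by rewrite ltr0n.
have lb : b * m.+1%:R ^+ m.+1 + 1 <= ln n%:R by near: n; exact: ln_unbounded.
have bm : 0 <= b * m.+1%:R ^+ m.+1 by rewrite mulr_ge0// exprn_ge0.
have l0 : 0 < ln n%:R :> R by apply: lt_le_trans lb; rewrite ltr_wpDl.
have := @pow_le_expR m (ln n%:R) (ltW l0); rewrite lnK ?posrE// => h.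
rewrite -(ler_pM2l l0) mulrCA -exprS; apply: (@le_trans _ _ (b * (m.+1%:R ^+ m.+1 * n%:R))).
  by rewrite ler_wpM2l.
rewrite mulrA ler_wpM2r ?(ltW nR)//; apply: le_trans lb; by rewrite lerDl.
Unshelve. all: by end_near.
Qed.

End Eventually.

(** * Choice of the three times *)

Section Times.
Variables (R : realType) (X H hlo hhi delta : R) (C : nat).
Hypotheses (delta0 : 0 < delta) (delta2 : delta <= 2^-1) (X1 : 1 <= X).
Hypotheses (hlo0 : 0 < hlo) (loH : hlo <= H) (Hhi : H <= hhi) (C0 : (0 < C)%N).
(** Built from the bound [hhi] and not from [H]: the depth rate must be fixed before [J] and [r],
    hence be independent of [n]. *)
Local Notation eps2 := (delta / (3 * C%:R * hhi)).
Local Notation t := (X / H).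
Hypotheses (XC : (1 + 2 * C)%:R <= delta / 3 * (X / hhi)) (XC2 : (2 * C + 3)%:R <= X).
Local Notation T0 := (Num.truncn (eps2 * X)).+1.
Local Notation l := (Num.truncn ((1 + delta / 3) * t)).+1.
Local Notation Tl := (Num.truncn ((1 - delta) * t)).
Local Notation cW := (delta / hhi + 2 / hlo + 1).

Let H0 : 0 < H. Proof. exact: lt_le_trans loH. Qed.
Let hhi0 : 0 < hhi. Proof. exact: lt_le_trans Hhi. Qed.
Let X0 : 0 < X. Proof. exact: lt_le_trans X1. Qed.
Let t0 : 0 < t. Proof. exact: divr_gt0. Qed.
Let CR : 1 <= C%:R :> R. Proof. by rewrite ler1n. Qed.
Let CR0 : 0 < C%:R :> R. Proof. by rewrite ltr0n. Qed.
Let t_hi : X / hhi <= t. Proof. by rewrite ler_pM2l// lef_pV2. Qed.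
Let t_lo : t <= X / hlo. Proof. by rewrite ler_pM2l// lef_pV2. Qed.
Let eps20 : 0 < eps2. Proof. by rewrite divr_gt0// !mulr_gt0. Qed.
Let epsC : eps2 * X * C%:R = delta / 3 * (X / hhi).
Proof. by field; rewrite !gt_eqF. Qed.
Let eps2t : eps2 * X <= delta / 3 * t.
Proof.
apply: (@le_trans _ _ (eps2 * X * C%:R)); first by rewrite ler_peMr// mulr_ge0// ltW.
by rewrite epsC ler_wpM2l// divr_ge0// ltW.
Qed.
Let T0_le : T0%:R <= eps2 * X + 1.
Proof. by rewrite -natr1 lerD2r truncn_le mulr_ge0// ltW. Qed.
Let l_le : l%:R <= (1 + delta / 3) * t + 1.
Proof.
rewrite -natr1 lerD2r truncn_le mulr_ge0 ?(ltW t0)//.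
by rewrite addr_ge0// divr_ge0// ltW.
Qed.
Let C_t : (1 + 2 * C)%:R <= delta / 3 * t.
Proof. by apply: le_trans XC _; rewrite ler_wpM2l// divr_ge0// ltW. Qed.

Lemma T0_ge : eps2 * X <= T0%:R. Proof. by rewrite ltW// truncnS_gt. Qed.

Lemma l_ge : (1 + delta / 3) * X <= l%:R * H.
Proof. by rewrite -ler_pdivrMr// -mulrA ltW// truncnS_gt. Qed.

Lemma Tl_H : Tl%:R * H <= (1 - delta) * X.
Proof.
rewrite -ler_pdivlMr// -mulrA truncn_le mulr_ge0 ?(ltW t0)//.
by move: delta2; lra.
Qed.

(** [delta] is split into three: one third for [l], one for the [C] rounds of exploration, one for
    rounding up. *)
Lemma upper_time : (l + T0.+1 * C)%:R <= (1 + delta) * t.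
Proof.
rewrite natrD natrM -[T0.+1%:R]natr1.
have h1 : (T0%:R + 1) * C%:R <= delta / 3 * t + 2 * C%:R.
  apply: (@le_trans _ _ ((eps2 * X + 2) * C%:R)).
    by apply: ler_wpM2r => //; rewrite (_ : 2 = 1 + 1)// addrA lerD2r.
  by rewrite mulrDl epsC lerD2r ler_wpM2l// divr_ge0// ltW.
have := C_t; rewrite natrD natrM => h2.
move: l_le h1 h2; set u := (T0%:R + 1) * C%:R; set v := l%:R; set w := t; set z := C%:R.
by move: u v w z => u v w z; lra.
Qed.

Lemma T0_lt_Tl : (T0 < Tl)%N.
Proof.
rewrite truncn_gt_nat -[T0.+1%:R]natr1.
have h : 3 <= delta / 3 * t by apply: le_trans C_t; rewrite ler_nat -[3%N]/(1 + 2 * 1)%N leq_add2l leq_mul2l.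
have h2 : delta * t <= 2^-1 * t by rewrite ler_wpM2r// ltW.
move: T0_le eps2t h h2; set u := T0%:R; set w := t; set v := eps2 * X.
by move: u v w => u v w; lra.
Qed.

Lemma Tl_le_l : (Tl <= l)%N.
Proof.
apply: leqW; apply: le_truncn; rewrite ler_wpM2r ?(ltW t0)//.
by move: delta0; lra.
Qed.

Lemma le_Tl (k : nat) : k%:R <= (1 - delta) * t -> (k <= Tl)%N.
Proof.
by move=> h; rewrite truncn_ge_nat// mulr_ge0 ?(ltW t0)//; move: delta2; lra.
Qed.

Lemma total_le : (T0.+1 * C + l).+2%:R <= cW * X.
Proof.
have XC' : 2 * C%:R + 3 <= X by rewrite -natrM -natrD.
have -> : (T0.+1 * C + l).+2%:R = (T0%:R + 1) * C%:R + l%:R + 2 :> R.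
  by rewrite -addn2 natrD natrD natrM -[T0.+1%:R]natr1.
move: XC'.
have h1 : (T0%:R + 1) * C%:R <= delta / 3 * (X / hhi) + 2 * C%:R.
  apply: (@le_trans _ _ ((eps2 * X + 2) * C%:R)).
    by apply: ler_wpM2r => //; rewrite (_ : 2 = 1 + 1)// addrA lerD2r.
  by rewrite mulrDl epsC.
have h2 : delta / 3 * t <= t by rewrite ler_piMl ?(ltW t0)//; move: delta2; lra.
have h3 : delta / 3 * (X / hhi) <= delta * (X / hhi).
  by rewrite ler_wpM2r ?divr_ge0 ?(ltW X0) ?(ltW hhi0)//; move: delta0; lra.
have -> : cW * X = delta * (X / hhi) + 2 * (X / hlo) + X by field; rewrite !gt_eqF.
have ll : l%:R <= t + delta / 3 * t + 1 by have := l_le; rewrite [X in _ <= X + 1]mulrDl mul1r.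
move: ll t_lo h1 h2 h3.
set u := (T0%:R + 1) * C%:R; set v := l%:R; set w := t; set z := C%:R.
set a1 := X / hlo; set a2 := delta / 3 * w; set a3 := delta / 3 * (X / hhi); set a4 := delta * (X / hhi).
move: a2 a3 a4 => a2 a3 a4; move: u v w z a1 => u v w z a1; lra.
Qed.

Lemma T0_le_total : T0.+1%:R <= cW * X.
Proof.
apply: le_trans total_le; rewrite ler_nat.
by apply: (leq_trans (leq_pmulr _ C0)); exact: (leq_trans (leq_addr l _) (leq_addl 2 _)).
Qed.

End Times.

Section Params.
Local Open Scope classical_set_scope.
Variable R : realType.

Lemma small_pow (q e : R) : 0 <= q -> q < 1 -> 0 < e -> exists k, q ^+ k <= e.
Proof.
move=> q0 q1 e0; have /cvgrPdist_le/(_ e e0) : (q ^+ n) @[n --> \oo] --> (0 : R).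
  by apply: cvg_expr; rewrite ger0_norm.
by move=> /filter_ex[k]; rewrite sub0r normrN ger0_norm ?exprn_ge0//; exists k.
Qed.

Lemma root_nat n r : (0 < r)%N -> exists a, (a ^ r <= n)%N /\ (n < a.+1 ^ r)%N.
Proof.
move=> r0; have ex : exists a, (a ^ r <= n)%N by exists 0%N; rewrite exp0n.
have ub a : (a ^ r <= n)%N -> (a <= n)%N.
  by apply: leq_trans; case: a => // a; rewrite -[X in (X <= _)%N]expn1 leq_pexp2l.
case: (ex_maxnP ex ub) => a an mx; exists a; split=> //.
by rewrite ltnNge; apply/negP => /mx; rewrite ltnn.
Qed.

(** An entry at most [1 - e] contributes its mass times at most [(1 - e) ^+ J]; a larger one
    contributes at most 1 and is counted by [near_one_frac]. *)
Lemma avg_pow_le n (p : 'M[R]_n) (e : R) J : (forall i j, 0 <= p i j) ->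
  (forall i, \sum_j p i j = 1) -> (0 < n)%N -> e <= 1 ->
  avg (fun z => \sum_k p z k ^+ J.+1) <= (1 - e) ^+ J + near_one_frac p e.
Proof.
move=> p0 p1 n0 e1; rewrite /near_one_frac -/(avg (fun i => \sum_j (1 - e < p i j)%R%:R)).
rewrite -(avg_cst ((1 - e) ^+ J) n0) -avgD; apply: avg_le => z.
rewrite -[X in X + _]mulr1 -[X in _ * X + _](p1 z) mulr_sumr -big_split/=.
have p_le1 k : p z k <= 1 by rewrite -(p1 z) (bigD1 k)//= lerDl sumr_ge0.
apply: ler_sum => k _; rewrite exprSr; case: ltP => h.
  rewrite ler_wpDl ?mulr_ge0 ?exprn_ge0 ?subr_ge0//.
  by rewrite mulr_ile1 ?exprn_ge0 ?exprn_ile1.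
rewrite addr0 ler_wpM2r//; apply: lerXn2r; rewrite ?nnegrE ?subr_ge0//.
Qed.

End Params.

Section EventuallyCutoff.
Local Open Scope classical_set_scope.
Variables (R : realType) (p : forall n, 'M[R]_n).
Hypotheses (p0 : forall n (i j : 'I_n), 0 <= p n i j).
Hypotheses (p1 : forall n (i : 'I_n), \sum_(j < n) p n i j = 1).
Hypotheses (sp : sparse p) (nd : non_degenerate p).

(** The order of choice matters: [eta] and [C] fix the contraction, [eps2] the depth of the trees,
    [e3] and [J] the decay of heavy paths; then come [r], [kappa] and [B], and only then is [n]
    taken large. *)
Lemma eventually_cutoff (delta eps zeta : R) : 0 < delta -> delta <= 2^-1 ->
  0 < eps -> eps < 1 -> 0 < zeta -> zeta <= 1 ->
  \forall n \near \oo, Pr R (fun s => ~ cutoff (p n) delta eps s) <= zeta.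
Proof.
move=> delta0 delta2 eps0 eps1 zeta0 zeta1.
have z8 : 0 < zeta / 8 by rewrite divr_gt0.
have [eta /andP[eta0 eta2] near_eta] := near_one_small nd z8 (ltac:(lra) : 0 < 2^-1 :> R).
have e8 : 0 < eps / 8 by rewrite divr_gt0.
have [C0 etaC0] := @small_pow R (1 - eta) (eps / 8) ltac:(lra) ltac:(lra) e8.
pose C := C0.+1.
have etaC : (1 - eta) ^+ C <= eps / 8.
  apply: le_trans etaC0; rewrite exprS ler_piMl ?exprn_ge0//; lra.
have [hhi hhi0 near_hi] := entropy_bounded sp.
have [hlo hlo0 near_lo] := entropy_away p0 p1 nd.
have CR0 : 0 < C%:R :> R by rewrite ltr0n.
pose eps2 := delta / (3 * C%:R * hhi).
have eps20 : 0 < eps2 by rewrite divr_gt0// !mulr_gt0.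
(* Twice [tau] is [expR (- (4 / eps2))], whose power [T0 >= eps2 * X] is at most [n ^- 4], as [beta]
   requires. *)
pose tau := expR (- (4 / eps2)) / 2.
have tau0 : 0 < tau by rewrite divr_gt0// expR_gt0.
have [e3 /andP[e30 e31] near_e3] := near_one_small nd tau0 ltr01.
have [J tauJ] := @small_pow R (1 - e3) tau ltac:(lra) ltac:(lra) tau0.
have [r [r41 rJ rC]] : exists r, [/\ (41 <= r)%N, (9 * J.+1 <= r)%N &
    (3 + 10 * C)%:R <= r%:R * (delta / 2)].
  pose m := (Num.truncn ((3 + 10 * C)%:R / (delta / 2) : R)).+1.
  exists (41 + 9 * J.+1 + m)%N; split; first by rewrite -!addnA leq_addr.
    by rewrite addnAC leq_addl.
  rewrite -ler_pdivrMr ?divr_gt0//; apply: (le_trans (ltW (truncnS_gt _))).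
  by rewrite ler_nat leq_addl.
have r0 : (0 < r)%N by exact: leq_trans r41.
have rR : 1 <= r%:R :> R by rewrite ler1n.
pose g1 := eta * eps / 64.
have g10 : 0 < g1 by rewrite divr_gt0// mulr_gt0.
have gz0 : 0 < g1 * zeta by exact: mulr_gt0.
have [cW cW0 cWE] : exists2 cW : R, 0 < cW & cW = delta / hhi + 2 / hlo + 1.
  by eexists; last reflexivity; rewrite !addr_gt0 ?divr_gt0.
pose kappa := g1 * zeta * delta ^+ 2 / (32 * 16 * cW * r%:R ^+ 2).
have kap0 : 0 < kappa by rewrite divr_gt0 ?mulr_gt0 ?exprn_gt0 ?ltr0n.
have kap1 : 16 * cW * kappa / delta ^+ 2 <= g1 * zeta / 32.
  have -> : 16 * cW * kappa / delta ^+ 2 = g1 * zeta / 32 / r%:R ^+ 2.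
    by rewrite /kappa; field; rewrite !gt_eqF ?ltr0n.
  rewrite ler_pdivrMr ?exprn_gt0 ?ltr0n//; apply: ler_peMr; last exact: exprn_ege1.
  by rewrite divr_ge0// (ltW gz0).
have kap2 : 4 * r%:R ^+ 2 * cW * kappa <= g1.
  have -> : 4 * r%:R ^+ 2 * cW * kappa = g1 * (zeta * (delta ^+ 2 / 128)).
    by rewrite /kappa; field; rewrite !gt_eqF ?ltr0n.
  rewrite ler_piMr ?(ltW g10)// mulr_ile1 ?(ltW zeta0)//.
    by rewrite divr_ge0 ?sqr_ge0.
  have : delta ^+ 2 <= 1 by rewrite exprn_ile1 ?(ltW delta0)//; lra.
  lra.
have [c c0 cE] : exists2 c : R, 0 <= c & c = (2 * r.+1%:R / eta + 4) / g1.
  eexists; last by reflexivity.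
  by rewrite divr_ge0 ?(ltW g10)// addr_ge0// divr_ge0 ?(ltW eta0)// mulr_ge0.
have [L L0 LE] : exists2 L : R, 0 <= L & L = C.+2%:R * 2 ^+ r * c ^+ r.+1.
  by eexists; last reflexivity; apply: mulr_ge0; [apply: mulr_ge0; rewrite ?exprn_ge0|exact: exprn_ge0].
have [B [B0 hB2 hB3]] : exists B : R, [/\ 0 < B, 50 / B <= g1 * zeta / 16 & L / B <= zeta / 16].
  exists (50 * 16 / (g1 * zeta) + 16 * L / zeta).
  have B800 : 0 < 50 * 16 / (g1 * zeta) by rewrite divr_gt0// mulr_gt0.
  have BL : 0 <= 16 * L / zeta by rewrite divr_ge0 ?(ltW zeta0)// mulr_ge0.
  have B0 := ltr_wpDr BL B800; split=> //.
    rewrite ler_pdivrMr//; apply: (@le_trans _ _ (g1 * zeta / 16 * (50 * 16 / (g1 * zeta)))).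
      by apply: eqle; field; rewrite !gt_eqF.
    by rewrite ler_wpM2l ?divr_ge0 ?(ltW gz0)// lerDl.
  rewrite ler_pdivrMr//; apply: (@le_trans _ _ (zeta / 16 * (16 * L / zeta))).
    by apply: eqle; field; rewrite gt_eqF.
  by rewrite ler_wpM2l ?divr_ge0 ?(ltW zeta0)// lerDr ltW.
(* [n >= (Z * X ^+ 5) ^+ r] makes the integer root [a] at least [Z * X ^+ 5 - 1]; the final [+ 1]
   absorbs this rounding. *)
pose Z := B * cW ^+ 5 + (4 * r.+2)%:R + 1.
have Z0 : 0 <= Z.
  apply: addr_ge0 => //; apply: addr_ge0 => //; apply: mulr_ge0; first exact: ltW.
  by apply: exprn_ge0; exact: ltW.
near=> n.
have n1 : (1 < n)%N by near: n; exact: nbhs_infty_gt.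
have n0 : (0 < n)%N by exact: ltnW.
have X1 : 1 <= ln n%:R :> R by near: n; exact: ln_unbounded.
have XC2 : (2 * C + 3)%:R <= ln n%:R :> R by near: n; exact: ln_unbounded.
have XC' : (1 + 2 * C)%:R * (3 * hhi / delta) <= ln n%:R by near: n; exact: ln_unbounded.
have loH : hlo <= avg_entropy (p n) by near: n.
have Hhi : avg_entropy (p n) <= hhi by near: n.
have al : near_one_frac (p n) eta <= zeta / 8 by near: n.
have al3 : near_one_frac (p n) e3 <= tau by near: n.
have rowL : forall i : 'I_n, \sum_k p n i k * ln (p n i k) ^+ 2 <= kappa * ln n%:R.
  by near: n; exact: log_sqr_small.
have big : Z ^+ r * ln n%:R ^+ (5 * r) <= n%:R.
  by near: n; apply: polylog_le; exact: exprn_ge0.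
set X := (ln n%:R : R) in X1 XC2 XC' rowL big *.
set H := avg_entropy (p n) in loH Hhi *.
have X0 : 0 < X by exact: lt_le_trans X1.
have XC : (1 + 2 * C)%:R <= delta / 3 * (X / hhi).
  rewrite (_ : delta / 3 * _ = X / (3 * hhi / delta)); last by field; rewrite !gt_eqF.
  by rewrite ler_pdivlMr ?divr_gt0 ?mulr_gt0.
have [a [arn nar]] := root_nat n r0.
have aZ : Z * X ^+ 5 - 1 <= a%:R.
  have nn : 0 <= Z * X ^+ 5 by rewrite mulr_ge0// exprn_ge0// ltW.
  have lt : Z * X ^+ 5 < a.+1%:R.
    rewrite -(@ltr_pXn2r _ r)// ?nnegrE//; apply: (@le_lt_trans _ _ n%:R).
      by rewrite exprMn -exprM.
    by rewrite -natrX ltr_nat.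
  by move: lt; rewrite -[a.+1%:R]natr1; lra.
have X5 : 1 <= X ^+ 5 by exact: exprn_ege1.
have aB : B * (cW * X) ^+ 5 + (4 * r.+2)%:R <= a%:R.
  apply: le_trans aZ; rewrite /Z; have := ler0n R (4 * r.+2).
  move: (4 * r.+2)%:R => v v0; rewrite exprMn mulrA !mulrDl mul1r.
  have : v <= v * X ^+ 5 by rewrite ler_peMr.
  by move: X5; move: (X ^+ 5) (B * cW ^+ 5) => u w; lra.
have ra : (4 * r.+2 <= a)%N.
  rewrite -(ler_nat R); apply: le_trans aB; rewrite lerDr.
  by rewrite mulr_ge0 ?(ltW B0)// exprn_ge0// mulr_ge0 ?(ltW cW0) ?(ltW X0).
have BW : B * (cW * X) ^+ 5 <= a%:R by apply: le_trans aB; rewrite lerDl.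
have H0 : 0 < H by exact: lt_le_trans loH.
have t0 : 0 < t_ent (p n) by exact: divr_gt0.
have Cp : (0 < C)%N by [].
pose T0 := (Num.truncn (eps2 * X)).+1.
have beta : n%:R ^+ 4 * avg (fun z => \sum_k p n z k ^+ J.+1) ^+ T0 <= 1.
  set b := avg _.
  have b0 : 0 <= b by apply: avg_ge0 => z; apply: sumr_ge0 => k _; exact: exprn_ge0.
  have bt : b <= expR (- (4 / eps2)).
    apply: le_trans (avg_pow_le J (@p0 n) (@p1 n) n0 (ltW e31)) _.
    by apply: le_trans (lerD tauJ al3) _; rewrite /tau; lra.
  have nE : n%:R ^+ 4 = expR (4%:R * X) :> R by rewrite expRM_natl lnK// posrE ltr0n.
  rewrite nE; apply: (@le_trans _ _ (expR (4%:R * X) * expR (- (4 / eps2)) ^+ T0)).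
    by rewrite ler_wpM2l ?expR_ge0// lerXn2r// nnegrE expR_ge0.
  rewrite -expRM_natl -expRD -[leRHS]expR0 ler_expR mulrN subr_le0.
  have -> : 4%:R * X = eps2 * X * (4 / eps2) by field; rewrite gt_eqF.
  apply: ler_wpM2r; first by rewrite divr_ge0// (ltW eps20).
  exact: T0_ge.
apply: (@Pr_cutoff R n (p n) (@p0 n) (@p1 n) n1 delta eps zeta eta kappa cW (cW * X) B c
  a r C J T0 (Num.truncn ((1 + delta / 3) * (X / H))).+1 (Num.truncn ((1 - delta) * (X / H)))) => //.
- exact: ltW.
- exact: l_ge hlo0 loH.
- exact: Tl_H delta2 X1 hlo0 loH.
- exact: upper_time delta0 X1 hlo0 loH Hhi Cp XC.
- exact: T0_lt_Tl delta0 delta2 X1 hlo0 loH Hhi Cp XC.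
- exact: Tl_le_l delta0 X1 hlo0 loH.
- move=> t; exact: le_Tl delta2 X1 hlo0 loH _.
- by rewrite cWE; exact: total_le delta0 delta2 X1 hlo0 loH Hhi Cp XC2.
- by rewrite cWE; exact: T0_le_total delta0 delta2 X1 hlo0 loH Hhi Cp XC2.
- exact: ltW.
- by rewrite -LE.
Unshelve. all: by end_near.
Qed.
End EventuallyCutoff.

(** * From the cutoff event to the three convergence statements *)

Section Conclusion.
Local Open Scope classical_set_scope.
Variables (R : realType) (p : forall n, 'M[R]_n).
Hypotheses (p0 : forall n (i j : 'I_n), 0 <= p n i j).
Hypotheses (p1 : forall n (i : 'I_n), \sum_(j < n) p n i j = 1).
Hypotheses (sp : sparse p) (nd : non_degenerate p).

Lemma Pr_cvg0 (A : forall n, set (env n)) :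
  (forall zeta : R, 0 < zeta -> zeta <= 1 -> \forall n \near \oo, Pr R (A n) <= zeta) ->
  (fun n => Pr R (A n)) @ \oo --> (0 : R).
Proof.
move=> small; apply/cvgr0Pnorm_le => e e0.
have m0 : 0 < Num.min e 1 by rewrite lt_min e0 ltr01.
apply: filterS (small _ m0 _); last by rewrite ge_min lexx orbT.
by move=> n h; rewrite ger0_norm ?Pr_ge0// (le_trans h)// ge_min lexx.
Qed.

Lemma cutoff_cvg0 (delta eps : R) (A : forall n, set (env n)) :
  0 < delta -> delta <= 2^-1 -> 0 < eps -> eps < 1 ->
  (\forall n \near \oo, forall s, cutoff (p n) delta eps s -> ~ A n s) ->
  (fun n => Pr R (A n)) @ \oo --> (0 : R).
Proof.
move=> d0 d2 e0 e1 AB; apply: Pr_cvg0 => zeta z0 z1.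
have ev := eventually_cutoff p0 p1 sp nd d0 d2 e0 e1 z0 z1.
near=> n; have h : Pr R (fun s => ~ cutoff (p n) delta eps s) <= zeta by near: n.
apply: le_trans h; apply: Pr_le => s As ct.
have nA : forall s, cutoff (p n) delta eps s -> ~ A n s by near: n.
exact: nA As.
Unshelve. all: by end_near.
Qed.

Lemma t_ent_unbounded (b : R) : 0 <= b ->
  \forall n \near \oo, 0 < t_ent (p n) /\ b <= t_ent (p n).
Proof.
move=> b0; have [hhi hhi0 near_hi] := entropy_bounded sp.
have [hlo hlo0 near_lo] := entropy_away p0 p1 nd.
near=> n.
have X0 : b * hhi + 1 <= ln n%:R by near: n; exact: ln_unbounded.
have Hhi : avg_entropy (p n) <= hhi by near: n.
have Hlo : hlo <= avg_entropy (p n) by near: n.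
have H0 : 0 < avg_entropy (p n) by exact: lt_le_trans Hlo.
have bh : 0 <= b * hhi by rewrite mulr_ge0// ltW.
have Xp : 0 < ln n%:R :> R by apply: lt_le_trans X0; rewrite ltr_wpDl.
split; first exact: divr_gt0.
rewrite /t_ent ler_pdivlMr//; apply: (@le_trans _ _ (b * hhi)); first by rewrite ler_wpM2l.
by apply: le_trans X0; rewrite lerDl.
Unshelve. all: by end_near.
Qed.

Lemma whp_unique : whp R (fun n => [set s : env n | unique_invariant (trans_mx (p n) s)]).
Proof.
rewrite /whp.
have h : (fun n => Pr R (fun s : env n => ~ unique_invariant (trans_mx (p n) s))) @ \oo --> (0 : R).
  apply: (@cutoff_cvg0 2^-1 2^-1) => //; rewrite ?invr_gt0//; first by lra.
  by near=> n => s [uq _].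
rewrite (_ : (fun n => _) = (fun n => 1 - Pr R (fun s : env n => ~ unique_invariant (trans_mx (p n) s)))).
  rewrite -[X in _ --> X]subr0; apply: cvgB => //; exact: cvg_cst.
by apply: funext => n; rewrite -(Pr_compl R [set s : env n | unique_invariant (trans_mx (p n) s)]) addrK.
Unshelve. all: by end_near.
Qed.

(** The upper bound is taken at an integer time at most one above [(1 + delta) * t_ent];
    [1 <= delta * t_ent] absorbs that unit. *)
Lemma cutoff_t_mix (n : nat) (delta e eps : R) s i : 0 < delta -> 0 < t_ent (p n) ->
  1 <= delta * t_ent (p n) -> e <= eps -> eps < 1 - e -> cutoff (p n) delta e s ->
  exists r : R, t_mix (trans_mx (p n) s) i eps = r%:E /\
    (1 - delta) * t_ent (p n) <= r <= (1 + 2 * delta) * t_ent (p n).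
Proof.
move=> d0 t0 dt ee e1 [_ ct]; set t := t_ent (p n) in t0 dt ct *.
pose T := (Num.truncn ((1 + delta) * t)).+1.
have dt0 : 0 <= (1 + delta) * t by rewrite mulr_ge0 ?(ltW t0)// addr_ge0// ltW.
have Tlo : (1 + delta) * t <= T%:R by rewrite ltW// truncnS_gt.
have Thi : T%:R <= (1 + 2 * delta) * t.
  have : T%:R <= (1 + delta) * t + 1 by rewrite -natr1 lerD2r truncn_le.
  by move: dt; lra.
have up : (t_mix (trans_mx (p n) s) i eps <= (T%:R)%:E)%E.
  by apply: ereal_inf_lbound; exists T => //=; apply: le_trans ee; exact: (ct i T).1.
have lo : (((1 - delta) * t)%:E <= t_mix (trans_mx (p n) s) i eps)%E.
  apply/ereal_infP => _ [k /= dk <-]; rewrite lee_fin leNgt; apply/negP => lt.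
  by have := (ct i k).2 (ltW lt); rewrite leNgt (le_lt_trans dk e1).
case E : (t_mix _ _ _) up lo => [r| |]//; rewrite !lee_fin => up lo.
by exists r; split=> //; rewrite lo (le_trans up).
Qed.

Lemma mixing_time_cvg (eps : R) : 0 < eps -> eps < 1 ->
  cvg_in_prob (fun n => max_mix_dev (p n) eps) 0.
Proof.
move=> e0 e1 d d0.
(* [e <= eps] bounds the mixing time from above, [eps < 1 - e] from below; [d / 2] allows for the
   [2 * delta] of [cutoff_t_mix]. *)
pose delta := Num.min (d / 2) 2^-1; pose e := Num.min eps ((1 - eps) / 2).
have dl0 : 0 < delta by rewrite lt_min divr_gt0//= invr_gt0.
have dl2 : delta <= 2^-1 by rewrite ge_min lexx orbT.
have dld : delta <= d / 2 by rewrite ge_min lexx.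
have ep0 : 0 < e by rewrite lt_min e0 divr_gt0// subr_gt0.
have ee : e <= eps by rewrite ge_min lexx.
have ee2 : e <= (1 - eps) / 2 by rewrite ge_min lexx orbT.
apply: (cutoff_cvg0 dl0 dl2 ep0 (le_lt_trans ee e1)).
have i0 : 0 <= delta^-1 by rewrite invr_ge0 ltW.
apply: filterS (t_ent_unbounded i0) => n [t0 td] s ct; apply/negP; rewrite -leNgt.
have dt : 1 <= delta * t_ent (p n) by rewrite -ler_pdivrMl// mulr1.
rewrite sube0 gee0_abs ?bigmax_ge_id//; apply: bigmax_le; first by rewrite lee_fin ltW.
move=> i _; have e1' : eps < 1 - e by lra.
have [r [-> /andP[lo hi]]] := @cutoff_t_mix n delta e eps s i dl0 t0 dt ee e1' ct.
rewrite inver gt_eqF// -EFinM -EFinB abse_EFin lee_fin.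
have h1 : 1 - delta <= r / t_ent (p n) by rewrite ler_pdivlMr.
have h2 : r / t_ent (p n) <= 1 + 2 * delta by rewrite ler_pdivrMr.
rewrite ler_norml; lra.
Qed.

Lemma min_dist_cvg (lambda : R) (t : nat -> nat) : 0 <= lambda ->
  (fun n => (t n)%:R - lambda * t_ent (p n) : R^o) =o_\oo (fun n => t_ent (p n) : R^o) ->
  lambda < 1 -> cvg_in_prob (fun n => min_dist (p n) (t n)) 1.
Proof.
move=> l0 /eqoP to l1 d d0.
(* Half the gap to 1: one [delta] for the error on [t n], another for the window of [cutoff]. *)
pose delta := Num.min ((1 - lambda) / 2) 2^-1; pose e := Num.min d 2^-1.
have dl0 : 0 < delta by rewrite lt_min divr_gt0 ?subr_gt0//= invr_gt0.
have dl2 : delta <= 2^-1 by rewrite ge_min lexx orbT.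
have dld : delta <= (1 - lambda) / 2 by rewrite ge_min lexx.
have ep0 : 0 < e by rewrite lt_min d0 invr_gt0 ltr0n.
have ed : e <= d by rewrite ge_min lexx.
have e1 : e < 1 by rewrite gt_min; apply/orP; right; lra.
apply: (cutoff_cvg0 dl0 dl2 ep0 e1).
near=> n => s [_ ct]; apply/negP; rewrite -leNgt.
have [t0 _] : 0 < t_ent (p n) /\ 0 <= t_ent (p n) by near: n; exact: t_ent_unbounded.
have tn : `|(t n)%:R - lambda * t_ent (p n)| <= delta * `|t_ent (p n)| by near: n; exact: to.
have tl : (t n)%:R <= (1 - delta) * t_ent (p n).
  move: tn; rewrite (gtr0_norm t0) ler_distl => /andP[_ h].
  apply: le_trans h _; rewrite -mulrDl ler_wpM2r ?(ltW t0)//; lra.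
rewrite -EFinB abse_EFin lee_fin distrC ger0_norm; last by rewrite subr_ge0 bigmin_le_id.
rewrite lerBlDr -lerBlDl; apply: (@le_trans _ _ (1 - e)); first by lra.
apply: le_bigmin => [|i _]; first by lra.
exact: (ct i (t n)).2.
Unshelve. all: by end_near.
Qed.

Lemma max_dist_cvg (lambda : R) (t : nat -> nat) : 0 <= lambda ->
  (fun n => (t n)%:R - lambda * t_ent (p n) : R^o) =o_\oo (fun n => t_ent (p n) : R^o) ->
  1 < lambda -> cvg_in_prob (fun n => max_dist (p n) (t n)) 0.
Proof.
move=> l0 /eqoP to l1 d d0.
pose delta := Num.min ((lambda - 1) / 2) 2^-1; pose e := Num.min d 2^-1.
have dl0 : 0 < delta by rewrite lt_min divr_gt0 ?subr_gt0//= invr_gt0.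
have dl2 : delta <= 2^-1 by rewrite ge_min lexx orbT.
have dld : delta <= (lambda - 1) / 2 by rewrite ge_min lexx.
have ep0 : 0 < e by rewrite lt_min d0 invr_gt0 ltr0n.
have ed : e <= d by rewrite ge_min lexx.
have e1 : e < 1 by rewrite gt_min; apply/orP; right; lra.
apply: (cutoff_cvg0 dl0 dl2 ep0 e1).
near=> n => s [_ ct]; apply/negP; rewrite -leNgt.
have [t0 _] : 0 < t_ent (p n) /\ 0 <= t_ent (p n) by near: n; exact: t_ent_unbounded.
have tn : `|(t n)%:R - lambda * t_ent (p n)| <= delta * `|t_ent (p n)| by near: n; exact: to.
have tl : (1 + delta) * t_ent (p n) <= (t n)%:R.
  move: tn; rewrite (gtr0_norm t0) ler_distl => /andP[h _].
  apply: le_trans h; rewrite -mulrBl ler_wpM2r ?(ltW t0)//; lra.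
rewrite sube0 abse_EFin lee_fin ger0_norm ?bigmax_ge_id//.
apply: bigmax_le => [|i _]; first exact: ltW.
by apply: le_trans ed; exact: (ct i (t n)).1.
Unshelve. all: by end_near.
Qed.

End Conclusion.

Local Open Scope classical_set_scope.
Local Open Scope ring_scope.

Theorem theorem1 (R : realType) (p : forall n : nat, 'M[R]_n)
    (p_ge0 : forall (n : nat) (i j : 'I_n), 0 <= p n i j)
    (p_noninc : forall (n : nat) (i j k : 'I_n),
        (j <= k)%N -> p n i k <= p n i j)
    (p_sum1 : forall (n : nat) (i : 'I_n), \sum_(j < n) p n i j = 1)
    (p_sparse : sparse p)
    (p_nondeg : non_degenerate p) :
  [/\ whp R (fun n => [set s : env n | unique_invariant (trans_mx (p n) s)]),
      (forall eps : R, 0 < eps -> eps < 1 ->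
         cvg_in_prob (fun n => max_mix_dev (p n) eps) 0)
    & (forall (lambda : R) (t : nat -> nat), 0 <= lambda ->
         (fun n => (t n)%:R - lambda * t_ent (p n) : R^o)
           =o_\oo (fun n => t_ent (p n) : R^o) ->
         (lambda < 1 -> cvg_in_prob (fun n => min_dist (p n) (t n)) 1) /\
         (1 < lambda -> cvg_in_prob (fun n => max_dist (p n) (t n)) 0))].
Proof.
split; first exact: whp_unique.
  by move=> eps; exact: mixing_time_cvg.
by move=> lambda t l0 tl; split=> l1; [exact: min_dist_cvg l1|exact: max_dist_cvg l1].
Qed.
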